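(* Assume that $P(\phi_0=1)<1$ and that for some $\alpha\in(0,1)$ there exists $h:(0,\infty)\to\mathbb{R}$, regularly varying with index $\alpha$, such that $\lim_{t\to\infty}h(t)\,P(Z_0>t)=1$ and $\sup_{t>0}h(t)\,P(Z_0>t)<\infty$. Let $S_n=\sum_{k=1}^nX_k$ and $b_n=\inf\{t>0:h(t)\ge n\}$, $n\in\mathbb{N}$. Then, for some $b>0$, under $P_0$ the sequence $b_n^{-1}S_n$ converges in distribution, as $n\to\infty$, to the stable law $\mathcal{L}_{\alpha,b}$.
   Context: Notation: $\mathbb{N}=\{1,2,\dots\}$, $\mathbb{Z}_+=\{0,1,2,\dots\}$. A function $h$ is regularly varying with index $\alpha\in\mathbb{R}$ if $h(t)=t^\alpha L(t)$ with $\lim_{t\to\infty}L(\lambda t)/L(t)=1$ for all $\lambda>0$. For $\alpha\in(0,1)$ and $b>0$, $\mathcal{L}_{\alpha,b}$ is the stable law of index $\alpha$ (supported on the positive reals) whose characteristic function $\widehat{\mathcal{L}}_{\alpha,b}$ satisfies $$\log\widehat{\mathcal{L}}_{\alpha,b}(t)=-b|t|^\alpha\Bigl(1-i\,\frac{t}{|t|}\tan\frac{\pi\alpha}{2}\Bigr).$$ Model: $\Phi=(\phi_n)_{n\in\mathbb{Z}}$ is an i.i.d. sequence of $[0,1]$-valued random variables; $(Z_n)_{n\in\mathbb{Z}}$ is an i.i.d. sequence of $\mathbb{Z}_+$-valued random variables, independent of $\Phi$. Let $P_\Phi$ denote the conditional probability given $\Phi$. $B=(B_{n,k})_{n,k\in\mathbb{Z}}$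 is a collection of Bernoulli variables such that $(\Phi,B)$ is independent of $(Z_n)_{n\in\mathbb{Z}}$ and, given $\Phi$, the $B_{n,k}$ are independent with $P_\Phi(B_{n,k}=1)=\phi_n$, $P_\Phi(B_{n,k}=0)=1-\phi_n$. The RCINAR(1) process $(X_n)_{n\in\mathbb{Z}_+}$ is defined by $X_0=0$ and $$X_n=\sum_{k=1}^{X_{n-1}}B_{n,k}+Z_n,\qquad n\in\mathbb{N},$$ where an empty sum is zero. $P_0$ denotes the joint law of all these objects with $X_0=0$. *)

(* Defs.v *)
From HB Require Import structures.
From mathcomp Require Import all_boot all_order all_algebra finmap.
From mathcomp Require Import all_classical all_reals all_analysis.
From mathcomp Require Import complex.
Set Implicit Arguments.
Unset Strict Implicit.
Unset Printing Implicit Defensive.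
Import Order.TTheory GRing.Theory Num.Theory.
Import numFieldNormedType.Exports.
Local Open Scope classical_set_scope.
Local Open Scope ring_scope.

Definition sigma_family d d' (T : measurableType d) (T' : measurableType d')
    (I : Type) (X : I -> T -> T') : set (set T) :=
  <<s \bigcup_i preimage_set_system setT (X i) measurable >>.

Definition independent_systems d (T : measurableType d) (R : realType)
    (P : probability T R) (F G : set (set T)) : Prop :=
  forall A C, F A -> G C -> P (A `&` C) = (P A * P C)%E.

Definition mutually_independent d d' (T : measurableType d)
    (T' : measurableType d') (R : realType) (P : probability T R)
    (I : choiceType) (X : I -> T -> T') : Prop :=
  forall (J : {fset I}) (U : I -> set T'), (forall i, measurable (U i)) ->
    P (\bigcap_(i in [set` J]) X i @^-1` U i) =
    (\prod_(i <- J) P (X i @^-1` U i))%E.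

Definition identically_distributed d d' (T : measurableType d)
    (T' : measurableType d') (R : realType) (P : probability T R)
    (I : Type) (X : I -> T -> T') : Prop :=
  forall i j (U : set T'), measurable U -> P (X i @^-1` U) = P (X j @^-1` U).

Definition iid d d' (T : measurableType d) (T' : measurableType d')
    (R : realType) (P : probability T R) (I : choiceType) (X : I -> T -> T') :=
  mutually_independent P X /\ identically_distributed P X.

(* [f] is a version of the conditional probability P(A | G). *)
Definition cond_prob_version d (T : measurableType d) (R : realType)
    (P : probability T R) (G : set (set T)) (A : set T) (f : T -> R) : Prop :=
  [/\ forall U : set R, measurable U -> G (f @^-1` U),
      P.-integrable setT (EFin \o f) &
      forall E, G E -> (\int[P]_(w in E) (f w)%:E = P (A `&` E))%E].

(* Versions of P(. | G) are a.s. unique, so it does not matter which ones are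
   multiplied. *)
Definition cond_independent d d' (T : measurableType d)
    (T' : measurableType d') (R : realType) (P : probability T R)
    (G : set (set T)) (I : choiceType) (X : I -> T -> T') : Prop :=
  forall (J : {fset I}) (U : I -> set T') (f : I -> T -> R),
    (forall i, measurable (U i)) ->
    (forall i, i \in J -> cond_prob_version P G (X i @^-1` U i) (f i)) ->
    cond_prob_version P G (\bigcap_(i in [set` J]) X i @^-1` U i)
      (fun w => \prod_(i <- J) f i w).

Definition converges_in_distribution d (T : measurableType d) (R : realType)
    (P : probability T R) (Y : nat -> T -> R) (mu : probability R R) : Prop :=
  (forall n, measurable_fun setT (Y n)) /\
  forall f : R -> R, continuous f -> bounded_fun f ->
    ('E_P[f \o Y n] @[n --> \oo] --> 'E_mu[f])%E.

Definition regularly_varying (R : realType) (h : R -> R) (alpha : R) : Prop :=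
  exists L : R -> R,
    (forall t, 0 < t -> h t = t `^ alpha * L t) /\
    forall lambda, 0 < lambda -> L (lambda * t) / L t @[t --> +oo] --> (1 : R).

Definition cexp (R : realType) (z : R[i]) : R[i] :=
  ((expR (complex.Re z) * cos (complex.Im z))
    +i* (expR (complex.Re z) * sin (complex.Im z)))%C.

Definition characteristic_function (R : realType) (mu : probability R R)
    (t : R) : R[i] :=
  ((\int[mu]_x cos (t * x)) +i* (\int[mu]_x sin (t * x)))%C.

(* The prescribed logarithm vanishes at t = 0, where t / `|t| is 0 / 0 = 0. *)
Definition is_stable_law (R : realType) (alpha b : R) (mu : probability R R) :=
  mu `]0, +oo[%classic = 1%E /\
  forall t : R, characteristic_function mu t =
    cexp (- (b * `|t| `^ alpha)%:C
          * (1 -i* (t / `|t| * tan (pi * alpha / 2))))%C.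

(* [B n k] is the indicator B_{n,k} = 1; the conditional law given [phi] is
   expressed by versions of conditional probabilities given sigma(phi). *)
Record rcinar_model d (T : measurableType d) (R : realType)
    (P : probability T R) (phi : int -> {RV P >-> R})
    (Z : int -> {RV P >-> nat}) (B : int -> int -> {RV P >-> bool}) : Prop := {
  phi_iid : iid P phi;
  phi_01 : forall n w, 0 <= phi n w <= 1;
  Z_iid : iid P Z;
  Z_indep_phi : independent_systems P (sigma_family phi) (sigma_family Z);
  Z_indep_phi_B : independent_systems P
    <<s sigma_family phi `|` sigma_family (fun nk => B nk.1 nk.2) >>
    (sigma_family Z);
  B_true : forall n k,
    cond_prob_version P (sigma_family phi) (B n k @^-1` [set true]) (phi n);
  B_false : forall n k,
    cond_prob_version P (sigma_family phi) (B n k @^-1` [set false])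
      (fun w => 1 - phi n w);
  B_cond_indep :
    cond_independent P (sigma_family phi) (fun nk => B nk.1 nk.2) }.

Fixpoint rcinar (T : Type) (Z : int -> T -> nat) (B : int -> int -> T -> bool)
    (n : nat) (w : T) : nat :=
  if n is m.+1 then
    (\sum_(1 <= k < (rcinar Z B m w).+1) B n%:Z k%:Z w + Z n%:Z w)%N
  else 0%N.

Definition partial_sum (T : Type) (X : nat -> T -> nat) (n : nat) (w : T)
  : nat := (\sum_(1 <= k < n.+1) X k w)%N.

Definition scaling (R : realType) (h : R -> R) (n : nat) : R :=
  inf [set t | 0 < t /\ n%:R <= h t].

(* Main.v *)
Require Import Defs.
From HB Require Import structures.
From mathcomp Require Import all_boot all_order all_algebra finmap.
From mathcomp Require Import all_classical all_reals all_analysis.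
From mathcomp Require Import complex.
From mathcomp Require Import measurable_realfun ring lra.
Set Implicit Arguments.
Unset Strict Implicit.
Unset Printing Implicit Defensive.
Import Order.TTheory GRing.Theory Num.Theory.
Import numFieldNormedType.Exports.
Local Open Scope classical_set_scope.
Local Open Scope ring_scope.

(** The limit law is read off from the Laplace transform of S_n / b_n, and
identified by comparing it with a rescaled sum of the i.i.d. variables Z_k.

Put q = exp (- s / b_n) and G x = 1 - E (1 - x)^Z_0.  An individual arriving at
time k survives each step i > k with probability phi_i and is counted in S_n once
for every time k, ..., n at which it is present; let 1 - v_k be the mean, given
the environment, of q to that number.  Given the environment individuals are
independent, so generating functions compose along the recursion and
  E q^(S_n) = E prod_(k <= n) (1 - G v_k)
(generating_function).  Moreover v_k = (1 - q) + q phi_(k+1) v_(k+1), so v_k is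
close to (1 - q) W_k for the perpetuity
W_k = 1 + phi_(k+1) + phi_(k+1) phi_(k+2) + ..., whose terms have
geometrically decreasing means because E phi_0 < 1 (mean_gap).

Regular variation enters only through n P (Z_0 > x b_n) --> x^-alpha together
with the domination C (1 + x^-beta) for some alpha < beta < 1
(tail_scaled_cvg, potter_bound).  Integrating against an exponential law gives
n G (x_n) --> c r^alpha as soon as x_n b_n --> r, with c = Gamma (1 - alpha)
(abelian, defect_scaled).  Since G is subadditive, replacing v_k by the
perpetuity truncated after m steps costs little when m is large
(substitution_limit); the product then behaves like
exp (- c s^alpha / n * sum_k (W_k)^alpha), and the average in the exponent obeys
a law of large numbers because truncated perpetuities at distance at least m
are independent (variance_mdependent, mean_average_dist).  Hence
  E exp (- s S_n / b_n) --> exp (- A s^alpha)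
for a constant A > 0 (laplace_partial_sum), and the continuity theorem for
Laplace transforms of nonnegative variables (laplace_continuity) produces a
limit law mu with this transform, together with convergence in distribution.

It remains to compute the characteristic function of mu.  This is done by
comparison rather than by analytic continuation of s |-> exp (- A s^alpha).  For a
suitable lambda the sums lambda / b_n * (Z_1 + ... + Z_n) have the same limiting Laplace transform.
By laplace_method the limits of all bounded continuous functionals depend on that
transform alone, so mu integrates exp (- s x) cos (t s x) and
exp (- s x) sin (t s x) to the limits found along the i.i.d. sums.  Those are
powers of a single complex number (twisted_laplace_sum), computed from the
integral of y^-alpha exp (- (1 + i t) y) (gamma_kernel_cos).  Letting the damping
s tend to 0 gives the characteristic function (cf_positive), and letting s tend
to infinity in the Laplace transform shows that mu has no atom at 0
(stable_positive). *)

(** * Bounded integrals, product laws and tails *)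

Section bounded_integrals.
Context d (T : measurableType d) (R : realType) (P : probability T R).
Implicit Types (f g : T -> R).

Lemma bounded_integrable f M : measurable_fun setT f ->
  (forall x, `|f x| <= M) -> P.-integrable setT (EFin \o f).
Proof.
move=> mf fM; apply: measurable_bounded_integrable => //.
  by rewrite (le_lt_trans (probability_le1 _ _)) ?ltry.
by exists M; split; [exact: num_real|move=> x Mx y _; exact: le_trans (fM y) (ltW Mx)].
Qed.

Lemma Rintegral_prob_cst (c : R) : \int[P]_x c = c.
Proof. by rewrite Rintegral_cst//= probability_setT mulr1. Qed.

Lemma expectation_Rintegral f : P.-integrable setT (EFin \o f) ->
  'E_P[f]%E = (\int[P]_x f x)%:E.
Proof.
by move=> f1; rewrite unlock /Rintegral fineK// integrable_fin_num.
Qed.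

Lemma Rintegral_indic (A : set T) : measurable A ->
  \int[P]_x (\1_A x) = fine (P A).
Proof. by move=> mA; rewrite /Rintegral integral_indic// setIT. Qed.

Lemma le_norm_Rintegral f M : measurable_fun setT f ->
  (forall x, `|f x| <= M) -> `|\int[P]_x f x| <= M.
Proof.
move=> mf fM; have fi := bounded_integrable mf fM.
apply: le_trans (le_normr_Rintegral _ fi) _ => //.
rewrite -[leRHS]Rintegral_prob_cst; apply: le_Rintegral => //.
  by apply: (@bounded_integrable _ M) => [|x];
    [exact: measurableT_comp|rewrite normr_id].
by apply: (@bounded_integrable _ `|M|).
Qed.

End bounded_integrals.

Section dominated.
Context d (T : measurableType d) (R : realType).
Variable mu : {measure set T -> \bar R}.

Lemma Rdominated_cvg (D : set T) (f_ : nat -> T -> R) (f g : T -> R) :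
  measurable D -> (forall n, measurable_fun D (f_ n)) -> measurable_fun D f ->
  (forall x, D x -> f_ n x @[n --> \oo] --> f x) ->
  mu.-integrable D (EFin \o g) ->
  (forall n x, D x -> `|f_ n x| <= g x) ->
  mu.-integrable D (EFin \o f) /\
  \int[mu]_(x in D) f_ n x @[n --> \oo] --> \int[mu]_(x in D) f x.
Proof.
move=> mD mf_ mf cf ig fg.
have [] := @dominated_convergence _ T R mu D mD
  (fun n x => (f_ n x)%:E) (EFin \o f) (EFin \o g).
- by move=> n; exact/measurable_EFinP.
- exact/measurable_EFinP.
- by apply: aeW => x Dx; apply: cvg_EFin; [exact: nearW|exact: cf].
- exact: ig.
- by apply: aeW => x n Dx; rewrite lee_fin fg.
move=> i0 _ i2; split=> //; apply: fine_cvg; rewrite fineK//; exact: integrable_fin_num.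
Qed.

End dominated.

Section pairs.
Context d (T : measurableType d) d' (T' : measurableType d') (R : realType)
  (P : probability T R) (Q : probability T' R).

(** Boundedness makes Fubini applicable without any further integrability
check; all exchanges of integrals below are of this form. *)
Lemma Rintegral_swap (h : T * T' -> R) (M : R) : measurable_fun setT h ->
  (forall x, `|h x| <= M) ->
  \int[P]_x \int[Q]_y h (x, y) = \int[Q]_y \int[P]_x h (x, y).
Proof.
move=> mh hM.
have := @Fubini _ _ T T' R P Q (EFin \o h).
have h1 x : Q.-integrable setT (fun y => (h (x, y))%:E).
  by apply: (@bounded_integrable _ _ _ _ _ M) => //; exact: measurableT_comp.
have h2 y : P.-integrable setT (fun x => (h (x, y))%:E).
  by apply: (@bounded_integrable _ _ _ _ _ M) => //; exact: measurableT_comp.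
move=> H; rewrite /Rintegral.
under eq_integral do rewrite fineK ?integrable_fin_num//.
under [in RHS]eq_integral do rewrite fineK ?integrable_fin_num//.
rewrite H//.
apply/integrableP; split; first exact/measurable_EFinP.
apply: le_lt_trans (_ : (\int[P \x Q]_x M%:E < +oo)%E); last first.
  have e1 : (P \x Q)%E setT = 1%E.
    by rewrite -setXTT product_measure1E//= !probability_setT mule1.
  by rewrite integral_cst//= e1 mule1 ltry.
apply: ge0_le_integral => //=.
- by apply/measurable_EFinP; exact: measurableT_comp.
- by move=> x _; rewrite lee_fin.
Qed.

End pairs.

Section laws.
Context d (T : measurableType d) d' (T' : measurableType d') (R : realType)
  (P : probability T R).

Definition mfun_of (f : T -> T') (mf : measurable_fun setT f) :
    {mfun T >-> T'} :=
  let m := isMeasurableFun.Build d d' T T' f mf in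
  MeasurableFun.Pack (MeasurableFun.Class m).

(** The law of a random variable enters an expectation only through its values
on measurable sets: this is how equalities in distribution are used. *)
Lemma law_ext (f : T -> T') (mf : measurable_fun setT f)
    (Q : probability T' R) (h : T' -> R) (M : R) :
  (forall A, measurable A -> P (f @^-1` A) = Q A) ->
  measurable_fun setT h -> (forall z, `|h z| <= M) ->
  \int[P]_x h (f x) = \int[Q]_x h x.
Proof.
move=> PQ mh hM.
have ih : measurable_fun setT (EFin \o h) by exact/measurable_EFinP.
rewrite /Rintegral; congr fine.
transitivity (\int[distribution P (mfun_of mf)]_z (h z)%:E)%E.
  rewrite integral_distribution//.
  by apply: (@bounded_integrable _ _ _ _ _ M) => //; exact: measurableT_comp.
by apply: eq_measure_integral => A mA _; exact: PQ.
Qed.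

End laws.

Section independent_pair.
Context d (T : measurableType d) (R : realType) (P : probability T R).

Definition independent_pair (f g : T -> R) := forall U V : set R,
  measurable U -> measurable V ->
  P (f @^-1` U `&` g @^-1` V) = (P (f @^-1` U) * P (g @^-1` V))%E.

(** The joint law of an independent pair is a product measure, so it can be
realised on a product of two other probability spaces carrying copies of the
marginals.  Stationarity of the perpetuities is proved with this. *)
Lemma integral_independent_pair d1 d2 (S : measurableType d1)
    (S' : measurableType d2) (Q : probability S R) (Q' : probability S' R)
    (f g : T -> R) (f' : S -> R) (g' : S' -> R) (h : R * R -> R) (M : R) :
  measurable_fun setT f -> measurable_fun setT g ->
  measurable_fun setT f' -> measurable_fun setT g' ->
  independent_pair f g ->
  (forall U : set R, measurable U -> P (f @^-1` U) = Q (f' @^-1` U)) ->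
  (forall U : set R, measurable U -> P (g @^-1` U) = Q' (g' @^-1` U)) ->
  measurable_fun setT h -> (forall z, `|h z| <= M) ->
  \int[P]_x h (f x, g x) = \int[Q]_x \int[Q']_y h (f' x, g' y).
Proof.
move=> mf mg mf' mg' fg ff' gg' mh hM.
have mfg : measurable_fun setT (fun x => (f x, g x)).
  exact: measurable_fun_pair.
have mfg' : measurable_fun setT (fun z : S * S' => (f' z.1, g' z.2)).
  by apply: measurable_fun_pair; exact: measurableT_comp.
have ih : measurable_fun setT (EFin \o h) by exact/measurable_EFinP.
pose F := distribution P (mfun_of mf); pose G := distribution P (mfun_of mg).
have PE A : measurable A -> P ((fun x => (f x, g x)) @^-1` A) = (F \x G)%E A.
  move=> mA; apply/esym; rewrite (@product_measure_unique _ _ _ _ _ F G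
    (distribution P (mfun_of mfg))) // => U V mU mV; exact: fg.
have QE A : measurable A ->
    (Q \x Q')%E ((fun z : S * S' => (f' z.1, g' z.2)) @^-1` A) = (F \x G)%E A.
  move=> mA; apply/esym; rewrite (@product_measure_unique _ _ _ _ _ F G
    (distribution (Q \x Q')%E (mfun_of mfg'))) // => U V mU mV.
  rewrite /distribution /pushforward/=.
  rewrite (_ : _ @^-1` _ = (f' @^-1` U) `*` (g' @^-1` V))//.
  rewrite product_measure1E; [by congr (_ * _)%E; apply/esym; [exact: ff'|exact: gg']
    |by rewrite -[X in measurable X]setTI; exact: mf'
    |by rewrite -[X in measurable X]setTI; exact: mg'].
rewrite (law_ext mfg PE mh hM) -(law_ext mfg' QE mh hM).
rewrite /Rintegral; congr fine.
rewrite -integral12_prod_meas1/=.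
  apply: eq_integral => x _; rewrite fineK// integrable_fin_num//.
  apply: (@bounded_integrable _ _ _ _ _ M) => //.
  apply: measurableT_comp => //.
  by apply: measurable_fun_pair => //; exact: measurable_cst.
apply: (@bounded_integrable _ _ _ _ _ M) => //.
exact: measurableT_comp.
Qed.

Lemma integral_independent_mul (f g : T -> R) (M N : R) :
  measurable_fun setT f -> measurable_fun setT g ->
  independent_pair f g ->
  (forall x, `|f x| <= M) -> (forall x, `|g x| <= N) ->
  \int[P]_x (f x * g x) = (\int[P]_x f x) * (\int[P]_x g x).
Proof.
move=> mf mg fg fM gN.
(* Truncation at the given bounds turns the product into a bounded function on the whole plane. *)
pose c (K : R) (x : R) := Num.max (- K) (Num.min K x).
have cE K x : `|x| <= K -> c K x = x.
  by rewrite ler_norml => /andP[h1 h2]; rewrite /c min_r// max_r.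
have cb K x : `|c K x| <= `|K|.
  rewrite /c ler_norml le_max ge_max ge_min lerN2 ler_norm/=.
  by rewrite -normrN ler_norm.
have mc K : measurable_fun setT (c K).
  by apply: measurable_maxr => //; apply: measurable_minr.
pose h (z : R * R) := c M z.1 * c N z.2.
have mh : measurable_fun setT h.
  by apply: measurable_funM; apply: measurableT_comp => //; exact: mc.
have hb z : `|h z| <= `|M| * `|N|.
  by rewrite /h normrM ler_pM.
have := integral_independent_pair mf mg mf mg fg (fun U _ => erefl _)
  (fun U _ => erefl _) mh hb.
rewrite (@eq_Rintegral _ _ _ P setT (fun x => f x * g x)); last first.
  by move=> x _; rewrite /h/= !cE.
move=> ->.
rewrite -RintegralZr//; last exact: bounded_integrable fM.
apply: eq_Rintegral => x _; rewrite -RintegralZl//; last exact: bounded_integrable gN.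
by apply: eq_Rintegral => y _; rewrite /h/= !cE.
Qed.

End independent_pair.

Section tails.
Context d (T : measurableType d) (R : realType) (P : probability T R).
Variable V : T -> R.
Hypothesis mV : measurable_fun setT V.

Lemma measurable_above (t : R) : measurable [set w | t < V w].
Proof.
rewrite (_ : [set w | _] = setT `&` V @^-1` `]t, +oo[); first exact: mV.
by rewrite setTI; apply/seteqP; split => w /=; rewrite in_itv/= andbT.
Qed.

Lemma tail_le1 (t : R) : fine (P [set w | t < V w]) <= 1.
Proof.
have mS := measurable_above t.
by rewrite -lee_fin fineK ?fin_num_measure ?probability_le1.
Qed.

Lemma tail_nonincreasing (s t : R) : s <= t ->
  fine (P [set w | t < V w]) <= fine (P [set w | s < V w]).
Proof.
move=> st; have mS := measurable_above.
apply: fine_le; rewrite ?fin_num_measure//.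
by apply: le_measure; rewrite ?inE// => w /=; exact: le_lt_trans.
Qed.

Lemma measurable_tail :
  measurable_fun (setT : set R) (fun t : R => fine (P [set w | t < V w])).
Proof. by apply: nonincreasing_measurable => // x y; exact: tail_nonincreasing. Qed.

Lemma tail_cvg0 : fine (P [set w | t < V w]) @[t --> +oo] --> (0 : R).
Proof.
have mS := measurable_above.
have decr : P [set w | (k%:R : R) < V w] @[k --> \oo] --> P set0.
  rewrite (_ : set0 = \bigcap_k [set w | (k%:R : R) < V w]); last first.
    apply/seteqP; split => w //= /(_ (Num.bound `|V w|) I) /=.
    by rewrite ltNge (le_trans (ler_norm _))// ltW// archi_boundP.
  apply: nonincreasing_cvg_mu => //.
  - by rewrite -ge0_fin_numE ?fin_num_measure.
  - exact: bigcapT_measurable.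
  - move=> k l kl; apply/subsetPset => w /=; apply: le_lt_trans.
    by rewrite ler_nat.
rewrite measure0 in decr.
apply/cvgrPdist_lt => e e0.
have /fine_cvgP[_ /cvgrPdist_lt /(_ _ e0)[k _ /(_ _ (leqnn k))]] := decr.
rewrite /= => Uk; near=> t.
rewrite sub0r normrN ger0_norm ?fine_ge0//.
move: Uk; rewrite /= sub0r normrN ger0_norm ?fine_ge0//; apply: le_lt_trans.
by apply: tail_nonincreasing; near: t; exact: nbhs_pinfty_ge.
Unshelve. all: by end_near. Qed.

End tails.

(** * Independence of disjoint blocks *)

Section block_independence.
Context d d' (T : measurableType d) (T' : measurableType d') (R : realType).
Variables (P : probability T R) (I : choiceType) (X : I -> T -> T').

(** Kept apart from the sigma-algebra it generates, because functions of a block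
are stated to be measurable on the measurable type built from generators. *)
Definition block_gen (A : set I) : set (set T) :=
  \bigcup_(i in A) preimage_set_system setT (X i) measurable.

Definition block (A : set I) : set (set T) := <<s block_gen A >>.

Let cyl (A : set I) : set (set T) := [set E | exists J : {fset I},
  exists2 U : I -> set T', ([set` J] `<=` A) /\ (forall i, measurable (U i)) &
    E = \bigcap_(i in [set` J]) X i @^-1` U i].

Let cylI A : setI_closed (cyl A).
Proof.
move=> _ _ [J [U [JA mU] ->]] [K [V [KA mV] ->]].
exists (J `|` K)%fset.
exists (fun i => (if i \in J then U i else setT) `&`
                 (if i \in K then V i else setT)).
  split=> [i|i]; first by rewrite /= inE => /orP[/JA|/KA].
  by apply: measurableI; case: ifP.
apply/seteqP; split=> [x [JU KV] i /=|x H].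
  rewrite inE => _; split; case: ifPn => // iJ; [exact: JU|exact: KV].
split=> i /= iJ.
  by have /= := H i; rewrite inE iJ => /(_ isT)[].
by have /= := H i; rewrite inE iJ orbT => /(_ isT)[].
Qed.

Let block_cyl A : block A `<=` <<s cyl A >>.
Proof.
apply: smallest_sub; first exact: smallest_sigma_algebra.
move=> E [i Ai [U mU <-]]; apply: sub_sigma_algebra.
exists [fset i]%fset; exists (fun=> U).
  by split=> // j /=; rewrite inE => /eqP ->.
apply/seteqP; split=> [x [_ xU] j /=|x H].
  by rewrite inE => /eqP ->.
by split=> //; apply: (H i); rewrite /= inE.
Qed.

Hypothesis mX : forall i, measurable_fun setT (X i).

Let cyl_measurable A : cyl A `<=` measurable.
Proof.
move=> _ [J [U [_ mU] ->]]; apply: fin_bigcap_measurable => // i _.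
by rewrite -[X in measurable X]setTI; exact: mX.
Qed.

Lemma block_measurable A : block A `<=` measurable.
Proof.
apply: smallest_sub; first exact: sigma_algebra_measurable.
move=> E [i Ai [U mU <-]]; exact: mX.
Qed.

Hypothesis indX : mutually_independent P X.

Let cyl_indep A B E F : A `&` B = set0 -> cyl A E -> cyl B F ->
  P (E `&` F) = (P E * P F)%E.
Proof.
move=> AB [J [U [JA mU] ->]] [K [V [KB mV] ->]].
have dJK i : i \in J -> i \in K -> False.
  move=> /JA Ai /KB Bi; have : (A `&` B) i by [].
  by rewrite AB.
pose W i := if i \in J then U i else V i.
have mW i : measurable (W i) by rewrite /W; case: ifP.
have := indX (J `|` K)%fset mW.
have -> : \bigcap_(i in [set` (J `|` K)%fset]) X i @^-1` W i =
    (\bigcap_(i in [set` J]) X i @^-1` U i) `&`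
    (\bigcap_(i in [set` K]) X i @^-1` V i).
  apply/seteqP; split=> [x H|x [JU KV] i /=].
    split=> i /= iJ; have /= := H i; rewrite inE iJ ?orbT /W => /(_ isT).
      by rewrite iJ.
    by case: ifPn => // /dJK /(_ iJ).
  rewrite inE /W => /orP[iJ|iK]; first by rewrite iJ; exact: JU.
  case: ifPn => [iJ|_]; [by have := dJK _ iJ iK|exact: KV].
move=> ->; have pe : perm_eq (J `|` K)%fset (J ++ K).
  apply: uniq_perm; rewrite ?fset_uniq//; last first.
    by move=> i; rewrite mem_cat inE.
  rewrite cat_uniq !fset_uniq/= andbT; apply/hasPn => i iK.
  by apply/negP => iJ; exact: dJK iJ iK.
rewrite (perm_big _ pe) big_cat/=.
rewrite indX// indX//; congr (_ * _)%E; apply: eq_big_seq => i iJ.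
  by rewrite /W iJ.
by rewrite /W; case: ifPn => // /dJK /(_ iJ).
Qed.

Let dynkin_indep E : measurable E ->
  dynkin [set F | measurable F /\ P (E `&` F) = (P E * P F)%E].
Proof.
move=> mE; split=> [|F [mF EF]|F tF mF].
- by split; rewrite ?setIT ?probability_setT ?mule1.
- split; first exact: measurableC.
  rewrite -setDE measureD//; last first.
    by rewrite (le_lt_trans (probability_le1 _ _)) ?ltry.
  by rewrite [X in (_ - X)%E]EF probability_setC// muleBr ?mule1 ?fin_num_measure.
- have mF' n : measurable (F n) by have [] := mF n.
  split; first exact: bigcup_measurable.
  rewrite setI_bigcupr !measure_bigcup//=; last 2 first.
    by move=> n _; exact: measurableI.
    by apply: trivIset_setIl.
  rewrite -[P E]fineK ?fin_num_measure// -nneseriesZl//.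
  apply: eq_eseriesr => n _; rewrite fineK ?fin_num_measure//.
  by have [] := mF n.
Qed.

Let cyl_block A B E F : A `&` B = set0 -> cyl A E -> block B F ->
  P (E `&` F) = (P E * P F)%E.
Proof.
move=> AB cE /block_cyl bF.
have mE := cyl_measurable cE.
suff /(_ _ bF)[] : <<s cyl B >> `<=`
  [set F | measurable F /\ P (E `&` F) = (P E * P F)%E] by [].
apply: lambda_system_subset => //.
  exact/dynkin_lambda_system/dynkin_indep.
by move=> G cG; split; [exact: cyl_measurable cG|exact: cyl_indep cE cG].
Qed.

(** The pi-lambda theorem, applied on each side in turn: the product rule holds
for cylinders by hypothesis, and the events independent of a given one form a
Dynkin system. *)
Lemma block_independence A B E F : A `&` B = set0 -> block A E -> block B F ->
  P (E `&` F) = (P E * P F)%E.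
Proof.
move=> AB /block_cyl bE bF.
have mF := block_measurable bF.
suff /(_ _ bE)[] : <<s cyl A >> `<=`
    [set E | measurable E /\ P (F `&` E) = (P F * P E)%E].
  by move=> _; rewrite setIC muleC.
apply: lambda_system_subset => //.
  exact/dynkin_lambda_system/dynkin_indep.
move=> G cG; split; first exact: cyl_measurable cG.
by rewrite setIC muleC; exact: cyl_block cG bF.
Qed.

Lemma block_independent_pair A B (f g : T -> R) : A `&` B = set0 ->
  measurable_fun (setT : set (g_sigma_algebraType (block_gen A))) f ->
  measurable_fun (setT : set (g_sigma_algebraType (block_gen B))) g ->
  independent_pair P f g.
Proof.
move=> AB mf mg U V mU mV; apply: block_independence AB _ _.
  by have := mf measurableT _ mU; rewrite setTI.
by have := mg measurableT _ mV; rewrite setTI.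
Qed.

Lemma block_measurable_fun d2 (T2 : measurableType d2) A (f : T -> T2) :
  measurable_fun (setT : set (g_sigma_algebraType (block_gen A))) f ->
  measurable_fun setT f.
Proof.
by move=> mf _ U mU; apply: (@block_measurable A); exact: mf.
Qed.

Lemma block_measurable_funS d2 (T2 : measurableType d2) A B (f : T -> T2) :
  A `<=` B ->
  measurable_fun (setT : set (g_sigma_algebraType (block_gen A))) f ->
  measurable_fun (setT : set (g_sigma_algebraType (block_gen B))) f.
Proof.
move=> AB mf _ U mU; have : block A (setT `&` f @^-1` U) by exact: mf.
apply: sub_smallest2r; first exact: smallest_sigma_algebra.
by move=> E [i Ai H]; exists i => //; exact: AB.
Qed.

Lemma block_measurable_coord A i : A i ->
  measurable_fun (setT : set (g_sigma_algebraType (block_gen A))) (X i).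
Proof.
move=> Ai _ U mU; apply: sub_sigma_algebra; exists i => //.
by exists U.
Qed.

End block_independence.

(** * Regularly varying tails and their scaling *)

Lemma near_cvg (R : realType) (T : Type) (F : set_system T) (FF : Filter F)
    (f g : T -> R) (l : R) :
  (\forall x \near F, f x = g x) -> f x @[x --> F] --> l ->
  g x @[x --> F] --> l.
Proof. by move=> fg; apply: cvg_trans; exact: near_eq_cvg. Qed.

Lemma gt1_ltr_powR (R : realType) (a : R) : 1 < a ->
  {homo powR a : x y / x < y}.
Proof.
move=> a1 x y xy; have a0 : 0 < a by lra.
by rewrite /powR gt_eqF// ltr_expR ltr_pM2r// ln_gt0.
Qed.

(** Throughout, [U] is a tail function and [h] a regularly varying function
asymptotic to [1 / U].  Everything is transferred from [h] to [U], which, unlike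
[h], is monotone. *)
Section regular_variation.
Variables (R : realType) (U h : R -> R) (alpha : R).
Hypothesis alpha_gt0 : 0 < alpha.
Hypothesis U_ge0 : forall t, 0 <= U t.
Hypothesis U_le1 : forall t, U t <= 1.
Hypothesis U_noninc : forall s t, s <= t -> U t <= U s.
Hypothesis U_cvg0 : U t @[t --> +oo] --> (0 : R).
Hypothesis h_rv : regularly_varying h alpha.
Hypothesis h_tail : h t * U t @[t --> +oo] --> (1 : R).
Hypothesis h_bound : has_ubound [set h t * U t | t in [set t | 0 < t]].

Let near_hU (e : R) : 0 < e ->
  \forall t \near +oo, 1 - e < h t * U t < 1 + e.
Proof.
move=> e0; near=> t; apply/andP; split; near: t.
  by apply: (cvgr_gt _ h_tail); rewrite ltrBlDr ltrDl.
by apply: (cvgr_lt _ h_tail); rewrite ltrDl.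
Unshelve. all: by end_near. Qed.

Lemma tail_gt0 t : 0 < U t.
Proof.
have [M [_ HM]] := near_hU (ltr01 : (0:R) < 1).
have /andP[+ _] : 1 - 1 < h (Num.max t M + 1) * U (Num.max t M + 1) < 1 + 1.
  by apply: HM; rewrite ltr_pwDr// le_max lexx orbT.
rewrite subrr => H.
have U0 : 0 < U (Num.max t M + 1).
  rewrite lt0r U_ge0 andbT; apply: contraTneq H => ->.
  by rewrite mulr0 ltxx.
by apply: (lt_le_trans U0); apply: U_noninc; rewrite ler_wpDr// le_max lexx.
Qed.

Let h_gt0 : \forall t \near +oo, 0 < h t.
Proof.
near=> t; suff : 0 < h t * U t by rewrite pmulr_lgt0 ?tail_gt0.
near: t; by apply: (cvgr_gt _ h_tail).
Unshelve. all: by end_near. Qed.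

Let h_ratio l : 0 < l -> h (l * t) / h t @[t --> +oo] --> l `^ alpha.
Proof.
move=> l0; have [L [hL cL]] := h_rv.
rewrite -[X in _ --> X]mulr1.
apply: near_cvg (cvgM (cvg_cst (l `^ alpha)) (cL l l0)); near=> t.
have t0 : 0 < t by near: t; exact: nbhs_pinfty_gt.
have ht0 : 0 < h t by near: t; exact: h_gt0.
rewrite /= !hL ?mulr_gt0// powRM ?ltW//.
have ta : t `^ alpha != 0 by rewrite gt_eqF ?powR_gt0.
have Lt : L t != 0.
  by move: ht0; rewrite hL// => /lt0r_neq0; rewrite mulf_eq0 negb_or => /andP[].
by field; rewrite ta Lt.
Unshelve. all: by end_near. Qed.

Lemma tail_regularly_varying l : 0 < l ->
  U (l * t) / U t @[t --> +oo] --> l `^ (- alpha).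
Proof.
move=> l0; have hl := h_ratio l0.
have lU : h (l * t) * U (l * t) @[t --> +oo] --> (1 : R).
  exact: (cvg_comp _ _ (gt0_cvgMry l0 cvg_id) h_tail).
have la : l `^ alpha != 0 by rewrite gt_eqF ?powR_gt0.
have -> : l `^ (- alpha) = 1 * 1^-1 * (l `^ alpha)^-1.
  by rewrite powRN invr1 !mul1r.
apply: near_cvg (cvgM (cvgM lU (cvgV (oner_neq0 _) h_tail)) (cvgV la hl)).
near=> t.
have ht0 : 0 < h t by near: t; exact: h_gt0.
have hlt0 : 0 < h (l * t).
  near: t; have := gt0_cvgMry l0 (@cvg_id _ (nbhs +oo%R)) h_gt0; exact.
rewrite /=; have Ut := tail_gt0 t; field.
by rewrite !gt_eqF.
Unshelve. all: by end_near. Qed.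

Local Notation b := (scaling h).

(** The scaling is the infimum of this set; both halves of the estimate
n U(b_n) --> 1 compare a point of it, or a point below it, with the
infimum. *)
Let lev (n : nat) : set R := [set t | 0 < t /\ n%:R <= h t].

Let lev_lb n : has_lbound (lev n).
Proof. by exists 0 => t [/ltW]. Qed.

Let lev_neq0 n : lev n !=set0.
Proof.
have : \forall t \near +oo, [/\ 0 < t, 1 - 2^-1 < h t * U t < 1 + 2^-1
  & U t < 2^-1 / n.+1%:R].
  near=> t; split; near: t; [exact: nbhs_pinfty_gt|exact: near_hU|].
  by apply: (cvgr_lt _ U_cvg0); rewrite divr_gt0.
move=> [M [_ HM]]; have [] := HM (M + 1); first by rewrite ltrDl.
set t := M + 1 => t0 /andP[hU _] Ut; exists t; split=> //.
have U0 := tail_gt0 t.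
rewrite -(ler_pM2r U0); apply: le_trans (ltW hU).
apply: (@le_trans _ _ (n.+1%:R * U t)).
  by rewrite ler_pM2r// ler_nat.
move: Ut; rewrite ltr_pdivlMr// mulrC => /ltW/le_trans; apply.
by lra.
Unshelve. all: by end_near. Qed.

Lemma scaling_ge0 n : 0 <= b n.
Proof. by apply: lb_le_inf => //; [exact: lev_neq0|move=> t [/ltW]]. Qed.

Lemma scaling_cvgy : b n @[n --> \oo] --> +oo.
Proof.
apply/cvgryPge => M; have [C HC] := h_bound.
have U0 := tail_gt0 M.
near=> n; apply: lb_le_inf; first exact: lev_neq0.
move=> t [t0 nt]; rewrite leNgt; apply/negP => tM.
have : h t * U t <= C by apply: HC; exists t.
apply/negP; rewrite -ltNge.
have nC : C / U M < n%:R by near: n; exact: nbhs_infty_gtr.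
have n0 : 0 <= h t by apply: le_trans nt.
apply: (@lt_le_trans _ _ (n%:R * U M)); first by rewrite -ltr_pdivrMr.
by apply: ler_pM => //; exact/U_noninc/ltW.
Unshelve. all: by end_near. Qed.

Let b_gt0 : \forall n \near \oo, 0 < b n.
Proof. by have /cvgryPgt := scaling_cvgy; apply. Qed.

Let along_b (P : R -> Prop) : (\forall t \near +oo, P t) ->
  \forall n \near \oo, P (b n).
Proof. by move=> H; exact: scaling_cvgy. Qed.

Let along_xb x (P : R -> Prop) : 0 < x -> (\forall t \near +oo, P t) ->
  \forall n \near \oo, P (x * b n).
Proof. by move=> x0 H; exact: (cvg_comp _ _ scaling_cvgy (gt0_cvgMry x0 cvg_id)). Qed.

(** Just above the infimum there is a point [t] with [n <= h t], and
[h t * U t] is close to 1. *)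
Let upper y e : 1 < y -> 0 < e -> \forall n \near \oo, n%:R * U (y * b n) < 1 + e.
Proof.
move=> y1 e0; have [M [_ HM]] := near_hU e0.
near=> n.
have bM : M < b n by near: n; apply: (along_b (P := fun t => M < t)); by exists M; split; [exact: num_real|].
have b0 : 0 < b n by near: n.
have [|t [t0 nt] tb] := @inf_adherent _ (lev n) ((y - 1) * b n) _ (conj (lev_neq0 n) (lev_lb n)).
  by rewrite mulr_gt0// subr_gt0.
have bt : b n <= t by apply: ge_inf; [exact: lev_lb|].
have /andP[_ hU] := HM t (lt_le_trans bM bt).
apply: le_lt_trans hU; apply: ler_pM => //.
apply/U_noninc/ltW; move: tb; rewrite -/(b n) mulrBl mul1r.
by rewrite -/(lev n) addrC subrK.
Unshelve. all: by end_near. Qed.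

(** Points below the infimum are not in the set, so [h] is less than [n] there,
while [h t * U t] is close to 1. *)
Let lower y e : 0 < y < 1 -> 0 < e -> \forall n \near \oo, 1 - e < n%:R * U (y * b n).
Proof.
move=> /andP[y0 y1] e0.
near=> n.
have b0 : 0 < b n by near: n.
have : 1 - e < h (y * b n) * U (y * b n) < 1 + e.
  near: n; apply: (along_xb (P := fun t => 1 - e < h t * U t < 1 + e)) => //.
  exact: near_hU.
move=> /andP[+ _] => /lt_le_trans; apply; rewrite ler_wpM2r// leNgt.
apply/negP => /ltW nh; suff : b n <= y * b n.
  by rewrite -{1}[b n]mul1r ler_pM2r// leNgt y1.
apply: ge_inf; first exact: lev_lb.
by split=> //; rewrite mulr_gt0.
Unshelve. all: by end_near. Qed.

Let ratio_b y : 0 < y -> U (y * b n) / U (b n) @[n --> \oo] --> y `^ (- alpha).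
Proof.
by move=> y0; exact: (cvg_comp _ _ scaling_cvgy (tail_regularly_varying y0)).
Qed.

(** The points y b_n and z b_n with y slightly above and z slightly below 1 are
controlled by the definition of the scaling, and regular variation compares
them with b_n itself. *)
Lemma tail_at_scaling : n%:R * U (b n) @[n --> \oo] --> (1 : R).
Proof.
(* The choice of y and z makes y^alpha = 1 + e and z^alpha = 1 - e. *)
have main e : 0 < e < 1 -> \forall n \near \oo,
    (1 - e) ^+ 2 * (1 - e) < n%:R * U (b n) < (1 + e) ^+ 2 * (1 + e).
  move=> /andP[e0 e1].
  have pow z : 0 < z -> (z `^ alpha^-1) `^ alpha = z.
    by move=> z0; rewrite -powRrM mulVf ?gt_eqF// powRr1// ltW.
  pose y := (1 + e) `^ alpha^-1; pose z := (1 - e) `^ alpha^-1.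
  have y0 : 0 < y by rewrite powR_gt0// addr_gt0.
  have z0 : 0 < z by rewrite powR_gt0// subr_gt0.
  have y1 : 1 < y.
    have -> : 1 = 1 `^ alpha^-1 :> R by rewrite powR1.
    by apply: gt0_ltr_powR; rewrite ?invr_gt0 ?nnegrE//; lra.
  have z1 : z < 1.
    have -> : 1 = 1 `^ alpha^-1 :> R by rewrite powR1.
    by apply: gt0_ltr_powR; rewrite ?invr_gt0 ?nnegrE//; lra.
  near=> n; have Un := tail_gt0 (b n).
  have yn := tail_gt0 (y * b n); have zn := tail_gt0 (z * b n).
  have h1 : n%:R * U (y * b n) < 1 + e by near: n; exact: upper.
  have h2 : 1 - e < n%:R * U (z * b n) by near: n; apply: lower; rewrite ?z0.
  have ye : (1 + e) ^- 2 < U (y * b n) / U (b n).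
    near: n; apply: (cvgr_gt _ (ratio_b y0)); rewrite powRN pow; last lra.
    by rewrite ltf_pV2 ?posrE ?exprn_gt0//; nra.
  have ze : U (z * b n) / U (b n) < (1 - e) ^- 2.
    near: n; apply: (cvgr_lt _ (ratio_b z0)); rewrite powRN pow; last lra.
    by rewrite ltf_pV2 ?posrE ?exprn_gt0//; nra.
  have n0 : 0 <= (n%:R : R) by [].
  have e2 : 0 < (1 + e) ^+ 2 by rewrite exprn_gt0// addr_gt0.
  have e3 : 0 < (1 - e) ^+ 2 by rewrite exprn_gt0// subr_gt0.
  apply/andP; split.
    move: ze; rewrite ltr_pdivrMr// ltr_pdivlMl// => ze.
    apply: (@lt_le_trans _ _ (n%:R * ((1 - e) ^+ 2 * U (z * b n)))).
      by rewrite mulrCA ltr_pM2l.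
    by rewrite ler_wpM2l// ltW.
  move: ye; rewrite ltr_pdivlMr// ltr_pdivrMl// => ye.
  apply: (@le_lt_trans _ _ (n%:R * ((1 + e) ^+ 2 * U (y * b n)))).
    by rewrite ler_wpM2l// ltW.
  by rewrite mulrCA ltr_pM2l.
apply/cvgrPdist_lt => e e0.
pose d := Num.min (2^-1) (e / 8).
have d0 : 0 < d by rewrite lt_min; apply/andP; split; lra.
have d1 : d <= 2^-1 by rewrite ge_min lexx.
have d2 : d <= e / 8 by rewrite ge_min lexx orbT.
have : 0 < d < 1 by apply/andP; split=> //; lra.
move=> /main; apply: filterS => n /andP[h1 h2].
rewrite ltr_norml; apply/andP; split; nra.
Unshelve. all: by end_near. Qed.

Lemma tail_scaled_cvg x : 0 < x ->
  n%:R * U (x * b n) @[n --> \oo] --> x `^ (- alpha).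
Proof.
move=> x0; rewrite -[X in _ --> X]mul1r.
apply: near_cvg (cvgM tail_at_scaling (ratio_b x0)); near=> n.
have Un := tail_gt0 (b n).
by rewrite /=; field; rewrite gt_eqF.
Unshelve. all: by end_near. Qed.

Hypothesis alpha_lt1 : alpha < 1.

(** A Potter bound: eventually halving the argument multiplies the tail by at
most 2^beta, because alpha < beta; iterating over dyadic scales controls the
ratio of tails by a power, down to a fixed threshold, below which the trivial
bound by 1 is enough.  It dominates the integrands of the Abelian argument, and
beta < 1 makes x^-beta integrable at 0. *)
Lemma potter_bound : exists C : R, exists2 beta : R, alpha < beta < 1 &
  0 < C /\ \forall n \near \oo, forall x, 0 < x ->
    n%:R * U (x * b n) <= C * (1 + x `^ (- beta)).
Proof.
have a0 := alpha_gt0; have a1 := alpha_lt1.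
(* Any exponent strictly between alpha and 1 would do. *)
pose beta := (1 + alpha) / 2.
have beta0 : 0 < beta by rewrite divr_gt0// addr_gt0.
have : \forall t \near +oo, 0 < t /\ U (2^-1 * t) <= 2 `^ beta * U t.
  near=> t; split; first by near: t; exact: nbhs_pinfty_gt.
  rewrite -ler_pdivrMr ?tail_gt0//; apply: ltW; near: t.
  apply: (cvgr_lt _ (tail_regularly_varying _)) => //.
  rewrite -powR_inv1// -powRrM mulN1r opprK//.
  have ab : alpha < beta by rewrite /beta; lra.
  by apply: gt1_ltr_powR; rewrite ?ltr1n.
move=> [M [_ HM]]; pose t0 := Num.max 1 (M + 1).
have t01 : 1 <= t0 by rewrite le_max lexx.
have t0M : M < t0 by rewrite lt_max ltrDl ltr01 orbT.
(* V is almost increasing, which is another way to state the bound. *)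
pose V t := t `^ beta * U t.
have half s t : t0 <= t -> 2^-1 * t <= s -> s <= t -> V s <= 2 `^ beta * V t.
  move=> t0t ts st; rewrite /V mulrCA; have [_ Ut] := HM t (lt_le_trans t0M t0t).
  have s0 : 0 <= s by lra.
  apply: ler_pM => //; first exact: powR_ge0.
    by apply: ge0_ler_powR; rewrite ?nnegrE//; lra.
  exact: le_trans (U_noninc ts) Ut.
have step n : forall s t, t0 <= s -> s <= t -> t <= 2 ^+ n * s -> V s <= 2 `^ beta * V t.
  elim: n => [|n IH] s t t0s st tn.
    by apply: half; lra.
  have [ts|ts] := leP (2^-1 * t) s; first by apply: half; lra.
  apply: le_trans (IH s (2^-1 * t) t0s (ltW ts) _) _.
    by rewrite -(ler_pM2l (_ : 0 < (2:R)))// mulrA mulfV// mul1r mulrA -exprS.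
  rewrite ler_wpM2l ?powR_ge0//.
  have tt : t0 <= t by lra.
  have [_ Ut] := HM t (lt_le_trans t0M tt).
  rewrite /V powRM ?invr_ge0//; last lra.
  have p2 : 0 < (2:R) `^ beta by rewrite powR_gt0.
  have -> : (2:R)^-1 `^ beta = (2 `^ beta)^-1.
    by rewrite -powR_inv1// -powRrM mulN1r powRN.
  rewrite -mulrA ler_pdivrMl//.
  by rewrite mulrCA ler_wpM2l// powR_ge0.
have big s t : t0 <= s -> s <= t -> V s <= 2 `^ beta * V t.
  move=> t0s st; have [n Hn] : exists n, t <= 2 ^+ n * s.
    have s0 : 0 < s by lra.
    have H : \forall n \near \oo, t / s <= n%:R by exact: nbhs_infty_ger.
    have [N _ HN] := H; exists N; rewrite -ler_pdivrMr//.
    apply: le_trans (HN N (leqnn _)) _; rewrite -natrX ler_nat.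
    by rewrite ltnW// ltn_expl.
  exact: step Hn.
have Ut0 := tail_gt0 t0.
pose K := 2 `^ beta / U t0.
have p1 : 1 <= (2:R) `^ beta.
  apply: (@le_trans _ _ (2 `^ 0)); first by rewrite powRr0.
  by apply: ler_powR; [rewrite ler1n|exact: ltW].
have K0 : 0 < K by rewrite divr_gt0// powR_gt0.
have all s t : 0 < s -> s <= t -> t0 <= t -> V s <= K * V t.
  move=> s0 st t0t.
  have Vt : 0 <= V t by rewrite mulr_ge0 ?powR_ge0.
  have K2 : 2 `^ beta <= K.
    by rewrite /K ler_pdivlMr// ler_piMr ?powR_ge0.
  have [ss|ss] := leP t0 s.
    by apply: le_trans (big s t ss st) _; rewrite ler_wpM2r.
  have := big t0 t (lexx _) t0t; rewrite /K mulrAC ler_pdivlMr// => /(le_trans _).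
  apply; apply: (@le_trans _ _ (t0 `^ beta * U t0)); last by [].
  rewrite ler_wpM2r//.
  apply: (@le_trans _ _ (s `^ beta * 1)).
    by rewrite ler_wpM2l ?powR_ge0.
  by rewrite mulr1 ge0_ler_powR ?nnegrE//; lra.
exists (2 * K + 2), beta; first by rewrite /beta; lra.
split; first lra.
near=> n; move=> x x0.
have b0 : 0 < b n by near: n.
have bt : t0 <= b n.
  near: n; apply: (along_b (P := fun t => t0 <= t)).
  by exists t0; split=> [|? /ltW//]; exact: num_real.
have nb : n%:R * U (b n) < 2 by near: n; apply: (cvgr_lt _ tail_at_scaling); lra.
have n0 : 0 <= (n%:R : R) by [].
have xb0 : 0 < x `^ beta by rewrite powR_gt0.
have [x1|x1] := leP x 1; last first.
  apply: (@le_trans _ _ 2).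
    apply: le_trans (ltW nb); rewrite ler_wpM2l//; apply: U_noninc.
    by rewrite ler_peMl// ltW.
  have : 0 <= x `^ (- beta) by exact: powR_ge0.
  by nra.
have xb1 : x * b n <= b n by rewrite ler_piMl// ltW.
have := all _ _ (mulr_gt0 x0 b0) xb1 bt.
rewrite /V powRM; [|exact: ltW|exact: ltW] => H.
have bb : 0 < (b n) `^ beta by rewrite powR_gt0.
have {}H : x `^ beta * U (x * b n) <= K * U (b n).
  by rewrite -(ler_pM2l bb); move: H; congr (_ <= _); ring.
rewrite powRN.
have : x `^ beta * (n%:R * U (x * b n)) <= K * 2.
  rewrite mulrCA; apply: (@le_trans _ _ (n%:R * (K * U (b n)))).
    by rewrite ler_wpM2l.
  by rewrite mulrCA ler_wpM2l// ltW.
rewrite -ler_pdivlMl// => /le_trans; apply.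
rewrite mulrDr mulr1 mulrC.
have : 0 <= (x `^ beta)^-1 by rewrite invr_ge0 ltW.
by nra.
Unshelve. all: by end_near. Qed.

End regular_variation.

(** * Integration against the exponential law *)

Lemma limn_einf_le (R : realType) (u : nat -> \bar R) (C : \bar R) :
  (forall n, u n <= C)%E -> (limn_einf u <= C)%E.
Proof.
move=> uC; rewrite limn_einf_lim; apply: lime_le; first exact: is_cvg_einfs.
apply: nearW => n; apply: le_trans (uC n).
by apply: ereal_inf_lbound; exists n => /=.
Qed.

Section derivatives.
Variable R : realType.
Implicit Types t x : R.

Lemma is_derive_mulr t x : is_derive x 1 ( *%R t) t.
Proof.
have := is_deriveZ (f := id) t (is_derive_id x 1).
by rewrite /GRing.scale/= mulr1.
Qed.

Lemma is_derive_cosM t x : is_derive x 1 (fun y => cos (t * y)) (- (t * sin (t * x))).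
Proof.
have := is_derive1_comp (is_derive_cos (t * x)) (is_derive_mulr t x).
by move=> H; apply: (is_derive_eq H); ring.
Qed.

Lemma is_derive_sinM t x : is_derive x 1 (fun y => sin (t * y)) (t * cos (t * x)).
Proof.
have := is_derive1_comp (is_derive_sin (t * x)) (is_derive_mulr t x).
by move=> H; apply: (is_derive_eq H); ring.
Qed.

Lemma is_derive_expRN x : is_derive x 1 (fun y => expR (- y)) (- expR (- x)).
Proof.
have := is_derive1_comp (is_derive_expR (- x)) (is_deriveNid x 1).
by move=> H; apply: (is_derive_eq H); ring.
Qed.

Lemma is_derive_expRN_cosM t x :
  is_derive x 1 (fun y => - (expR (- y) * cos (t * y)))
    ((cos (t * x) + t * sin (t * x)) * expR (- x)).
Proof.
have H := is_deriveN (is_deriveM (is_derive_expRN x) (is_derive_cosM t x)).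
by apply: (is_derive_eq H); rewrite /GRing.scale/=; ring.
Qed.

Lemma is_derive_expRN_sinM t x :
  is_derive x 1 (fun y => expR (- y) * sin (t * y))
    ((t * cos (t * x) - sin (t * x)) * expR (- x)).
Proof.
have H := is_deriveM (is_derive_expRN x) (is_derive_sinM t x).
by apply: (is_derive_eq H); rewrite /GRing.scale/=; ring.
Qed.

Lemma is_derive1_continuous (f : R -> R) x df : is_derive x 1 f df ->
  {for x, continuous f}.
Proof.
move=> dfx; apply: differentiable_continuous.
by apply/derivable1_diffP; exact: ex_derive.
Qed.

End derivatives.

Section expo.
Variable R : realType.
Local Notation mu := (@lebesgue_measure R).

(** Integrals over the half-line with weight exp (- y) are taken with respect to
this probability, so that bounded functions are integrable and dominated
convergence applies with constants. *)
Definition expo : probability (measurableTypeR R) R.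
refine (exponential_prob (1 : R) : probability _ _).
exact: ltr01.
Defined.

Lemma expoE : expo = exponential_prob 1 :> (set R -> \bar R).
Proof. by []. Qed.

Lemma expo_dominated : expo `<< mu.
Proof.
apply/null_content_dominatesP => A mA muA0.
rewrite expoE /exponential_prob; apply: null_set_integral => //.
apply/measurable_EFinP/measurable_funTS; exact: measurable_exponential_pdf.
Qed.

Lemma expo_density (U : set R) (f : R -> R) : measurable U ->
  U `<=` `[0, +oo[ -> expo.-integrable U (EFin \o f) ->
  \int[expo]_(x in U) f x = \int[mu]_(x in U) (f x * expR (- x)).
Proof.
move=> mU U0 fi; have mf := measurable_int _ fi.
rewrite /Rintegral; congr fine.
rewrite -(Radon_Nikodym_change_of_variables expo_dominated)//.
transitivity (\int[mu]_(x in U) ((f x)%:E * (exponential_pdf 1 x)%:E))%E; last first.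
  apply: eq_integral => x; rewrite inE => /U0/=; rewrite in_itv/= andbT => x0.
  by rewrite exponential_pdfE// mulN1r mul1r EFinM.
have mp : measurable_fun U (EFin \o exponential_pdf (1 : R)).
  by apply/measurable_EFinP/measurable_funTS; exact: measurable_exponential_pdf.
apply: ae_eq_integral => //.
- apply: emeasurable_funM => //; apply: (measurable_int mu).
  apply: (integrableS _ _ (@subsetT _ _)) => //=.
  by apply: Radon_Nikodym_integrable; exact: expo_dominated.
- by apply: emeasurable_funM.
- apply: ae_eqe_mul2l => /=.
  rewrite Radon_NikodymE//=; first exact: expo_dominated.
  move=> dom; case: cid => /= g [g1 g2 g3].
  apply: integral_ae_eq => //=.
  + exact: integrableS g2.
  + by move=> E EU mE; rewrite -g3.
Qed.

Lemma expo_lty A : measurable A -> (expo A < +oo)%E.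
Proof.
by move=> mA; rewrite (le_lt_trans (probability_le1 _ _)) ?ltry.
Qed.

#[local] Opaque expo.

(** The fundamental theorem of calculus, with the density exp (- x) absorbed in
the measure: [F] is a primitive of the integrand times that density. *)
Lemma expo_FTC (f F : R -> R) a b : 0 <= a -> a < b ->
  (forall x, a <= x <= b -> {for x, continuous f}) ->
  (forall x : R, a <= x <= b -> is_derive x 1 F (f x * expR (- x))) ->
  expo.-integrable `[a, b] (EFin \o f) /\
  \int[expo]_(x in `[a, b]) f x = F b - F a.
Proof.
move=> a0 ab cf dF.
have wf : {within `[a, b], continuous f}.
  apply: continuous_in_subspaceT => x; rewrite inE/= in_itv/=; exact: cf.
have cF x : a <= x <= b -> {for x, continuous F}.
  by move=> /dF; exact: is_derive1_continuous.
have fi : expo.-integrable `[a, b] (EFin \o f).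
  apply: measurable_bounded_integrable => //.
  - by rewrite (le_lt_trans (probability_le1 _ _)) ?ltry.
  - exact: subspace_continuous_measurable_fun.
  - have /compact_bounded[M [_ mrt]] :=
      continuous_compact wf (@segment_compact _ a b).
    by exists M; split; rewrite ?num_real// => ? ? ? ?; exact: mrt.
split=> //; rewrite expo_density//; last first.
  by move=> x /=; rewrite !in_itv/= andbT => /andP[/(le_trans a0)].
rewrite /Rintegral (@continuous_FTC2 _ (fun x => f x * expR (- x)) F)//.
- apply: continuous_in_subspaceT => x; rewrite inE/= in_itv/= => xab.
  apply: cvgM; first exact: cf.
  exact: is_derive1_continuous (is_derive_expRN x).
- split.
  + by move=> x; rewrite in_itv/= => /andP[/ltW ax /ltW xb];
      have := dF x; rewrite ax xb => /(_ isT) ?; exact: ex_derive.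
  + by apply: cvg_at_right_filter; apply: cF; rewrite lexx ltW.
  + by apply: cvg_at_left_filter; apply: cF; rewrite lexx ltW.
- move=> x; rewrite in_itv/= => /andP[/ltW ax /ltW xb].
  have := dF x; rewrite ax xb => /(_ isT) ?; rewrite derive1E.
  exact: derive_val.
Qed.

Lemma expo_null (A : set R) : measurable A -> mu A = 0%E -> expo A = 0%E.
Proof. by move=> mA; have /null_content_dominatesP := expo_dominated; exact. Qed.

(** Multiplied by the density exp (- y), these are the derivatives of
- exp (- y) cos (t y) and exp (- y) sin (t y). *)
Definition kcos (t y : R) := cos (t * y) + t * sin (t * y).
Definition ksin (t y : R) := t * cos (t * y) - sin (t * y).

Lemma continuous_cosM t : continuous (fun y : R => cos (t * y)).
Proof. by move=> x; exact: is_derive1_continuous (is_derive_cosM t x). Qed.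

Lemma continuous_sinM t : continuous (fun y : R => sin (t * y)).
Proof. by move=> x; exact: is_derive1_continuous (is_derive_sinM t x). Qed.

Lemma continuous_kcos t : continuous (kcos t).
Proof.
move=> x; apply: cvgD; first exact: continuous_cosM.
by apply: cvgM; [exact: cvg_cst|exact: continuous_sinM].
Qed.

Lemma continuous_ksin t : continuous (ksin t).
Proof.
move=> x; apply: cvgB; last exact: continuous_sinM.
by apply: cvgM; [exact: cvg_cst|exact: continuous_cosM].
Qed.

Lemma measurable_kcos t : measurable_fun setT (kcos t).
Proof. by apply: continuous_measurable_fun; exact: continuous_kcos. Qed.

Lemma measurable_ksin t : measurable_fun setT (ksin t).
Proof. by apply: continuous_measurable_fun; exact: continuous_ksin. Qed.

Lemma norm_cos_le1 (x : R) : `|cos x| <= 1.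
Proof. by rewrite ler_norml cos_geN1 cos_le1. Qed.

Lemma norm_sin_le1 (x : R) : `|sin x| <= 1.
Proof. by rewrite ler_norml sin_geN1 sin_le1. Qed.

Lemma kcos_bound t y : `|kcos t y| <= 1 + `|t|.
Proof.
apply: le_trans (ler_normD _ _) _; rewrite lerD ?norm_cos_le1// normrM.
by rewrite ler_piMr// norm_sin_le1.
Qed.

Lemma ksin_bound t y : `|ksin t y| <= 1 + `|t|.
Proof.
apply: le_trans (ler_normB _ _) _; rewrite addrC lerD ?norm_sin_le1// normrM.
by rewrite ler_piMr// norm_cos_le1.
Qed.

Lemma expo_itvcc_oo (f : R -> R) (Y : R) : measurable_fun setT f ->
  \int[expo]_(x in `[0, Y]) f x = \int[expo]_y (f y * \1_`]0, Y[ y).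
Proof.
move=> mf; rewrite Rintegral_mkcond /Rintegral; congr fine.
apply: ae_eq_integral => //.
- by apply/measurable_EFinP/measurable_restrict => //; exact: measurable_funTS.
- by apply/measurable_EFinP/measurable_funM.
exists [set 0; Y]; split.
- by apply: measurableU.
- apply: expo_null; first exact: measurableU.
  by rewrite null_set_setU//; exact: lebesgue_measure_set1.
move=> x /=; apply: contra_notP => H _.
rewrite patchE indicE; congr EFin.
have x0 : x != 0 by apply/eqP => x0; apply: H; left.
have xY : x != Y by apply/eqP => xY; apply: H; right.
have -> : (x \in `]0, Y[%classic) = (x \in `[0, Y]%classic).
  by rewrite !mem_setE !in_itv/= !lt_neqAle xY (eq_sym 0) x0.
by case: ifPn => _; rewrite ?mulr1// mulr0.
Qed.

(** The damped cosine is thus the integral of an indicator of [y < Y], which turns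
expectations of functions of a random variable into integrals of its tail. *)
Lemma expo_kcos t Y : 0 <= Y ->
  \int[expo]_y (kcos t y * \1_`]0, Y[ y) = 1 - expR (- Y) * cos (t * Y).
Proof.
rewrite le_eqVlt => /predU1P[<-|Y0].
  rewrite oppr0 expR0 mulr0 cos0 mulr1 subrr -[RHS](Rintegral_prob_cst expo).
  by apply: eq_Rintegral => x _; rewrite set_itvoo0 indicE in_set0 mulr0.
rewrite -expo_itvcc_oo; last exact: measurable_kcos.
have [_ ->] := expo_FTC (lexx 0) Y0 (fun x _ => @continuous_kcos t x)
  (fun x _ => is_derive_expRN_cosM t x).
by rewrite mulr0 cos0 oppr0 expR0 mulr1 opprK addrC.
Qed.

Lemma expo_ksin t Y : 0 <= Y ->
  \int[expo]_y (ksin t y * \1_`]0, Y[ y) = expR (- Y) * sin (t * Y).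
Proof.
rewrite le_eqVlt => /predU1P[<-|Y0].
  rewrite mulr0 sin0 mulr0 -[RHS](Rintegral_prob_cst expo).
  by apply: eq_Rintegral => x _; rewrite set_itvoo0 indicE in_set0 mulr0.
rewrite -expo_itvcc_oo; last exact: measurable_ksin.
have [_ ->] := expo_FTC (lexx 0) Y0 (fun x _ => @continuous_ksin t x)
  (fun x _ => is_derive_expRN_sinM t x).
by rewrite mulr0 sin0 mulr0 subr0.
Qed.

(** An exhaustion of the open half-line by compact intervals: powers with a
negative exponent are only continuous away from 0. *)
Let I_ n : set R := `[n.+2%:R^-1, n.+2%:R].

Let I_lt n : n.+2%:R^-1 < (n.+2%:R : R).
Proof. by rewrite (@lt_trans _ _ 1) ?ltr1n// invf_lt1 ?ltr1n ?ltr0n. Qed.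

Let I_pos n x : I_ n x -> 0 < x.
Proof. by rewrite /I_/= in_itv/= => /andP[+ _]; apply: lt_le_trans. Qed.

Let I_near x : 0 < x -> \forall n \near \oo, I_ n x.
Proof.
move=> x0; near=> n; rewrite /I_/= in_itv/=; apply/andP; split.
  rewrite invf_ple ?posrE//; apply: (@le_trans _ _ n%:R); last first.
    by rewrite ler_nat leqW.
  by near: n; exact: nbhs_infty_ger.
apply: (@le_trans _ _ n%:R); last by rewrite ler_nat leqW.
by near: n; exact: nbhs_infty_ger.
Unshelve. all: by end_near. Qed.

Let cvg_indic_I x : 0 < x -> \1_(I_ n) x @[n --> \oo] --> (1 : R).
Proof.
move=> x0; apply: (@near_cvg _ _ \oo _ (fun=> 1)); last exact: cvg_cst.
near=> n.
by rewrite indicE mem_set//; near: n; exact: I_near.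
Unshelve. all: by end_near. Qed.

Let D : set R := `]0, +oo[.

Let mD : measurable D. Proof. exact: measurable_itv. Qed.

Let I_sub n : I_ n `<=` D.
Proof. by move=> x /I_pos x0; rewrite /D/= in_itv/= andbT. Qed.

Let mI n : measurable (I_ n). Proof. exact: measurable_itv. Qed.

Let measurable_pos (f : R -> R) : (forall x, 0 < x -> {for x, continuous f}) ->
  measurable_fun D f.
Proof.
move=> cf; apply: open_continuous_measurable_fun; first exact: interval_open.
by move=> x; rewrite inE /D/= in_itv/= andbT; exact: cf.
Qed.

Lemma expo_cvg_I (f : R -> R) : expo.-integrable D (EFin \o f) ->
  \int[expo]_(x in I_ n) f x @[n --> \oo] --> \int[expo]_(x in D) f x.
Proof.
move=> fi; have mf : measurable_fun D f by apply/measurable_EFinP; exact: measurable_int fi.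
have [||||||_ +] := @Rdominated_cvg _ _ _ expo D (fun n x => f x * \1_(I_ n) x) f
  (fun x => `|f x|).
- exact: mD.
- by move=> n; apply: measurable_funM => //;
  apply: measurable_indic; exact: mI.
- exact: mf.
- move=> x; rewrite /D/= in_itv/= andbT => x0; rewrite -[X in _ --> X]mulr1.
  by apply: cvgM; [exact: cvg_cst|exact: cvg_indic_I].
- exact: integrable_norm fi.
- move=> n x _; rewrite normrM ler_piMr// indicE.
  by case: (_ \in _); rewrite ?normr1// normr0.
apply: near_cvg; near=> n.
rewrite [LHS]Rintegral_mkcond [RHS]Rintegral_mkcond; apply: eq_Rintegral => x _.
rewrite !patchE indicE; case: ifPn => xD; case: ifPn => xI; rewrite ?mulr1 ?mulr0//.
by case/negP: xD; apply/mem_set/(@I_sub n)/set_mem.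
Unshelve. all: by end_near. Qed.

(** Fatou along the exhaustion: uniform bounds on compact intervals give
integrability on the half-line. *)
Lemma expo_integrable_bound (f : R -> R) (C : R) :
  (forall x, 0 < x -> {for x, continuous f}) ->
  (forall x, 0 < x -> 0 <= f x) ->
  (forall n, expo.-integrable (I_ n) (EFin \o f)) ->
  (forall n, \int[expo]_(x in I_ n) f x <= C) ->
  expo.-integrable D (EFin \o f).
Proof.
move=> cf f0 fi fC; have mf := measurable_pos cf.
apply/integrableP; split; first exact/measurable_EFinP.
apply: (@le_lt_trans _ _ C%:E); last by rewrite ltry.
have -> : (\int[expo]_(x in D) `|(EFin \o f) x| =
   \int[expo]_(x in D) limn_einf (fun n => (f x * \1_(I_ n) x)%:E))%E.
  apply: eq_integral => x; rewrite inE /D/= in_itv/= andbT => x0.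
  have H : (f x * \1_(I_ n) x)%:E @[n --> \oo] --> `|(f x)%:E|%E.
    rewrite gee0_abs ?lee_fin ?f0//; apply: cvg_EFin; first exact: nearW.
    rewrite -[X in _ --> X]mulr1.
    by apply: cvgM; [exact: cvg_cst|exact: cvg_indic_I].
  by rewrite is_cvg_limn_einfE; [apply/esym/cvg_lim|apply/cvg_ex; eexists; exact: H].
apply: le_trans (fatou _ _ _ _) _ => //.
- move=> n; apply/measurable_EFinP/measurable_funM => //.
  by apply: measurable_indic; exact: mI.
- move=> n x; rewrite /D/= in_itv/= andbT => x0.
  by rewrite lee_fin mulr_ge0// f0.
apply: limn_einf_le => n.
rewrite (_ : (\int[expo]_(x in D) _)%E = (\int[expo]_(x in I_ n) f x)%:E).
  by rewrite lee_fin.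
rewrite /Rintegral fineK; last by apply: integrable_fin_num; [exact: mI|exact: fi].
rewrite [LHS]integral_mkcond [RHS]integral_mkcond; apply: eq_integral => x _.
rewrite !patchE indicE; case: ifPn => xD; case: ifPn => xI; rewrite ?mulr1 ?mulr0//.
by case/negP: xD; apply/mem_set/(@I_sub n)/set_mem.
Qed.

Lemma expo_FTC0y (f F : R -> R) (l0 l1 : R) :
  (forall x, 0 < x -> {for x, continuous f}) ->
  (forall x : R, 0 < x -> is_derive x 1 F (f x * expR (- x))) ->
  expo.-integrable D (EFin \o f) ->
  F n.+2%:R^-1 @[n --> \oo] --> l0 -> F n.+2%:R @[n --> \oo] --> l1 ->
  \int[expo]_(x in D) f x = l1 - l0.
Proof.
move=> cf dF fi F0 F1.
have := expo_cvg_I fi; move/cvg_lim => <-//; apply/cvg_lim => //.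
apply: near_cvg (cvgB F1 F0); near=> n.
have n0 : 0 < (n.+2%:R^-1 : R) by [].
have n1 := I_lt n.
have cf' x : n.+2%:R^-1 <= x <= n.+2%:R -> {for x, continuous f}.
  by move=> /andP[/(lt_le_trans n0)/cf].
have dF' (x : R) : n.+2%:R^-1 <= x <= n.+2%:R ->
    is_derive x 1 F (f x * expR (- x)).
  by move=> /andP[/(lt_le_trans n0)/dF].
by have [_ <-] := @expo_FTC f F _ _ (ltW n0) n1 cf' dF'.
Unshelve. all: by end_near. Qed.

Lemma expo_integrable_I n (f : R -> R) :
  (forall x, 0 < x -> {for x, continuous f}) ->
  expo.-integrable (I_ n) (EFin \o f).
Proof.
move=> cf; have wf : {within I_ n, continuous f}.
  apply: continuous_in_subspaceT => x; rewrite inE => /I_pos; exact: cf.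
apply: measurable_bounded_integrable.
- exact: mI.
- by apply: expo_lty; exact: mI.
- by apply: subspace_continuous_measurable_fun => //; exact: mI.
- have /compact_bounded[M [_ mrt]] :=
    continuous_compact wf (@segment_compact _ n.+2%:R^-1 n.+2%:R).
  by exists M; split; rewrite ?num_real// => ? ? ? ?; exact: mrt.
Qed.

Lemma expo_FTC_I n (f F : R -> R) :
  (forall x, 0 < x -> {for x, continuous f}) ->
  (forall x : R, 0 < x -> is_derive x 1 F (f x * expR (- x))) ->
  \int[expo]_(x in I_ n) f x = F n.+2%:R - F n.+2%:R^-1.
Proof.
move=> cf dF; have n0 : 0 < (n.+2%:R^-1 : R) by [].
have n1 := I_lt n.
have cf' x : n.+2%:R^-1 <= x <= n.+2%:R -> {for x, continuous f}.
  by move=> /andP[/(lt_le_trans n0)/cf].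
have dF' (x : R) : n.+2%:R^-1 <= x <= n.+2%:R ->
    is_derive x 1 F (f x * expR (- x)).
  by move=> /andP[/(lt_le_trans n0)/dF].
by have [_ <-] := @expo_FTC f F _ _ (ltW n0) n1 cf' dF'.
Qed.

Lemma expo_integrable_id : expo.-integrable D (EFin \o id).
Proof.
have cid (x : R) : 0 < x -> {for x, continuous (@id R)} by move=> _; exact: cvg_id.
apply: (@expo_integrable_bound _ 1) => //.
- by move=> x /ltW.
- by move=> n; exact: expo_integrable_I.
have dF (x : R) : 0 < x ->
    is_derive x 1 (fun x => - ((1 + x) * expR (- x))) (x * expR (- x)).
  have H0 : is_derive x 1 (fun y : R => 1 + y) 1.
    have H := is_deriveD (is_derive_cst (1:R) x 1) (is_derive_id x 1).
    by apply: (is_derive_eq H); rewrite add0r.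
  move=> _; have H := is_deriveN (is_deriveM H0 (is_derive_expRN x)).
  by apply: (is_derive_eq H); rewrite /GRing.scale/=; ring.
move=> n; rewrite (expo_FTC_I n cid dF).
rewrite opprK addrC; set a := n.+2%:R^-1; set b := n.+2%:R.
have b0 : 0 <= b by [].
have a0 : 0 <= a by rewrite invr_ge0.
have H1 : (1 + a) * expR (- a) <= 1.
  by rewrite expRN ler_pdivrMr ?expR_gt0// mul1r expR_ge1Dx.
have H2 : 0 <= (1 + b) * expR (- b) by apply: mulr_ge0; [exact: addr_ge0|exact: expR_ge0].
lra.
Qed.

Let powR_continuous (a x : R) : 0 < x -> {for x, continuous (fun y : R => y `^ a)}.
Proof. by move=> x0; exact: is_derive1_continuous (is_derive1_powR a x0). Qed.

Lemma expo_integrable_powR_le1 (b : R) : 0 <= b <= 1 ->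
  expo.-integrable D (EFin \o (fun x : R => x `^ b)).
Proof.
move=> /andP[b0 b1].
apply: (@le_integrable _ _ _ expo D mD _ (fun x => (1 + x)%:E)).
- apply/measurable_EFinP; apply: measurable_pos => x; exact: powR_continuous.
- move=> x; rewrite /D/= in_itv/= andbT => x0; rewrite lee_fin.
  rewrite !ger0_norm ?powR_ge0//; last by rewrite addr_ge0// ltW.
  have [x1|x1] := leP x 1.
    apply: (@le_trans _ _ 1); last by rewrite lerDl ltW.
    have -> : 1 = 1 `^ b :> R by rewrite powR1.
    by apply: ge0_ler_powR; rewrite ?nnegrE// ltW.
  by rewrite (le_trans (ler1_powR (ltW x1) b1))// lerDr.
- under eq_fun do rewrite EFinD.
  apply: integrableD => //; last exact: expo_integrable_id.
  apply: measurable_bounded_integrable => //.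
  by rewrite (le_lt_trans (probability_le1 _ _)) ?ltry.
  exact: bounded_cst.
Qed.

(** Integration by parts with x^b exp (- x) bounds the integral of x^(b-1) by that
of x^b, which has no singularity. *)
Lemma expo_integrable_powR (b : R) : 0 < b <= 1 ->
  expo.-integrable D (EFin \o (fun x : R => x `^ (b - 1))).
Proof.
move=> /andP[b0 b1].
have cp (x : R) : 0 < x -> {for x, continuous (fun y : R => y `^ (b - 1))}.
  exact: powR_continuous.
have cb (x : R) : 0 < x -> {for x, continuous (fun y : R => y `^ b)}.
  exact: powR_continuous.
have cbp (x : R) : 0 < x -> {for x, continuous (fun y : R => b * y `^ (b - 1) - y `^ b)}.
  move=> x0; apply: cvgB; last exact: cb.
  by apply: cvgM; [exact: cvg_cst|exact: cp].
have ib : expo.-integrable D (EFin \o (fun x : R => x `^ b)).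
  by apply: expo_integrable_powR_le1; rewrite ltW.
apply: (@expo_integrable_bound _ ((1 + \int[expo]_(x in D) (x `^ b)) / b)) => //.
- by move=> x _; exact: powR_ge0.
- by move=> n; exact: expo_integrable_I.
move=> n; rewrite ler_pdivlMr// mulrC -RintegralZl; [|exact: mI|exact: expo_integrable_I].
have -> : \int[expo]_(x in I_ n) (b * x `^ (b - 1)) =
  \int[expo]_(x in I_ n) (b * x `^ (b - 1) - x `^ b) + \int[expo]_(x in I_ n) (x `^ b).
  rewrite -RintegralD; [|exact: mI|exact: expo_integrable_I cbp
    |exact: expo_integrable_I cb].
  by apply: eq_Rintegral => x _; rewrite subrK.
apply: lerD.
  have dF (x : R) : 0 < x -> is_derive x 1 (fun x => x `^ b * expR (- x))
      ((b * x `^ (b - 1) - x `^ b) * expR (- x)).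
    move=> x0; have H := is_deriveM (is_derive1_powR b x0) (is_derive_expRN x).
    by apply: (is_derive_eq H); rewrite /GRing.scale/=; ring.
  rewrite (expo_FTC_I n cbp dF); set u := n.+2%:R^-1; set v := n.+2%:R.
  have v1 : 1 <= v :> R by rewrite ler1n.
  have H1 : v `^ b * expR (- v) <= 1.
    rewrite expRN ler_pdivrMr ?expR_gt0// mul1r.
    apply: le_trans (ler1_powR v1 b1) _.
    by apply: le_trans (expR_ge1Dx _); rewrite lerDr.
  have H2 : 0 <= u `^ b * expR (- u) by rewrite mulr_ge0 ?expR_ge0 ?powR_ge0.
  lra.
have iI : expo.-integrable D (EFin \o (fun x : R => x `^ b * \1_(I_ n) x)).
  apply: (@le_integrable _ _ _ expo D mD _ (EFin \o (fun x : R => x `^ b))) => //.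
    apply/measurable_EFinP/measurable_funM; first exact: measurable_pos.
    by apply: measurable_indic; exact: mI.
  move=> x _; rewrite lee_fin normrM ler_piMr// indicE.
  by case: (_ \in _); rewrite ?normr1// normr0.
have -> : \int[expo]_(x in I_ n) (x `^ b) = \int[expo]_(x in D) (x `^ b * \1_(I_ n) x).
  rewrite [LHS]Rintegral_mkcond [RHS]Rintegral_mkcond; apply: eq_Rintegral => x _.
  rewrite !patchE indicE; case: ifPn => xI; case: ifPn => xD; rewrite ?mulr1 ?mulr0//.
  by case/negP: xD; apply/mem_set/(@I_sub n)/set_mem.
apply: le_Rintegral => // x _.
by rewrite ler_piMr ?powR_ge0// indicE; case: (_ \in _).
Qed.

End expo.

(** * The gamma integral with a complex parameter *)

Section real_integrable.
Context d (T : measurableType d) (R : realType) (mu : {measure set T -> \bar R}).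
Variables (D : set T) (f g : T -> R).
Hypothesis mD : measurable D.
Hypotheses (fi : mu.-integrable D (EFin \o f)) (gi : mu.-integrable D (EFin \o g)).

Lemma RintegrableZl (c : R) : mu.-integrable D (EFin \o (fun x => c * f x)).
Proof.
rewrite (_ : _ \o _ = (fun x => c%:E * (EFin \o f) x)%E); first exact: integrableZl.
by apply/funext => x; rewrite /= EFinM.
Qed.

Lemma RintegrableD : mu.-integrable D (EFin \o (fun x => f x + g x)).
Proof.
rewrite (_ : _ \o _ = (fun x => (EFin \o f) x + (EFin \o g) x)%E); first exact: integrableD.
by apply/funext => x; rewrite /= EFinD.
Qed.

Lemma RintegrableB : mu.-integrable D (EFin \o (fun x => f x - g x)).
Proof.
rewrite (_ : _ \o _ = (fun x => (EFin \o f) x - (EFin \o g) x)%E); first exact: integrableB.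
by apply/funext => x; rewrite /= EFinB.
Qed.

End real_integrable.

Section derive_rules.
Variable R : realType.
Implicit Types (f g : R -> R) (x df dg c : R).

(** The rules of differentiation are restated with products in place of scalings,
so that [ring] and [field] apply to the derivatives they produce. *)
Lemma is_derive1M f g x df dg : is_derive x 1 f df -> is_derive x 1 g dg ->
  is_derive x 1 (fun y => f y * g y) (df * g x + f x * dg).
Proof.
move=> Hf Hg; apply: (is_derive_eq (is_deriveM Hf Hg)).
by rewrite /GRing.scale/=; ring.
Qed.

Lemma is_derive1D f g x df dg : is_derive x 1 f df -> is_derive x 1 g dg ->
  is_derive x 1 (fun y => f y + g y) (df + dg).
Proof. exact: is_deriveD. Qed.

Lemma is_derive1B f g x df dg : is_derive x 1 f df -> is_derive x 1 g dg ->
  is_derive x 1 (fun y => f y - g y) (df - dg).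
Proof. exact: is_deriveB. Qed.

Lemma is_derive1_compose f g x df dg : is_derive (g x) 1 f df -> is_derive x 1 g dg ->
  is_derive x 1 (fun y => f (g y)) (df * dg).
Proof.
move=> Hf Hg; apply: (is_derive_eq (is_derive1_comp Hf Hg)).
by rewrite /GRing.scale/=; ring.
Qed.

Lemma is_derive1Z f x df c : is_derive x 1 f df -> is_derive x 1 (fun y => c * f y) (c * df).
Proof.
by move=> Hf; apply: (is_derive_eq (is_deriveZ c Hf)).
Qed.

Lemma is_derive1_sqr x : is_derive x 1 (fun y : R => y ^+ 2) (2 * x).
Proof.
by apply: (is_derive_eq (is_derive1M (is_derive_id x 1) (is_derive_id x 1))); ring.
Qed.

End derive_rules.

Lemma cvg_dominated0 (R : realType) (T : Type) (F : set_system T)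
    (FF : Filter F) (u v : T -> R) :
  (forall x, `|u x| <= v x) -> v x @[x --> F] --> (0 : R) ->
  u x @[x --> F] --> (0 : R).
Proof.
move=> uv v0; apply: (@squeeze_cvgr _ _ _ _ (fun x => - v x) v) => //.
- by apply: nearW => x; rewrite -ler_norml.
- by rewrite -oppr0; exact: cvgN.
Qed.

Lemma cvg_harmonic_powR (R : realType) (b : R) : 0 < b ->
  (n.+2%:R^-1 : R) `^ b @[n --> \oo] --> (0 : R).
Proof.
move=> b0; move/cvg_at_rightP: (powR_cvg0 b0); apply; split=> [n|].
  by rewrite invr_gt0.
apply: (@cvg_dominated0 _ _ _ _ _ (fun n => n.+1%:R^-1)); last exact: cvg_harmonic.
by move=> n; rewrite ger0_norm// lef_pV2 ?posrE// ler_nat.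
Qed.

(** As b <= 1, the bound exp x >= x^2 / 4 suffices. *)
Lemma nat_expRN_cvg0 (R : realType) (b : R) : 0 <= b <= 1 ->
  (n.+2%:R : R) `^ b * expR (- n.+2%:R) @[n --> \oo] --> (0 : R).
Proof.
move=> /andP[b0 b1].
apply: (@squeeze_cvgr _ _ _ _ (fun=> 0) (fun n => 4 * n.+1%:R^-1)).
- apply: nearW => n; rewrite mulr_ge0 ?powR_ge0 ?expR_ge0//=.
  set x := n.+2%:R; have x1 : 1 <= x :> R by rewrite ler1n.
  apply: (@le_trans _ _ (x * expR (- x))).
    by rewrite ler_wpM2r ?expR_ge0// ler1_powR.
  have e1 : x ^+ 2 / 4 <= expR x.
    have -> : expR x = expR (x / 2) ^+ 2 by rewrite -expRM_natl; congr expR; field.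
    have := expR_ge1Dx (x / 2); have := expR_ge0 (x / 2).
    by nra.
  rewrite expRN ler_pdivrMr ?expR_gt0//.
  have n0 : 0 < (n.+1%:R : R) by [].
  have nx : n.+1%:R <= x by rewrite ler_nat.
  rewrite mulrAC ler_pdivlMr//.
  by nra.
- exact: cvg_cst.
- rewrite -[X in _ --> X](mulr0 4); apply: cvgM; first exact: cvg_cst.
  exact: cvg_harmonic.
Qed.

Lemma sub_add_eq0 (R : realType) (x y z : R) : x - y + z = 0 -> x = y - z.
Proof. lra. Qed.

Section gamma_kernel.
Variables (R : realType) (b : R).
Hypotheses (b_gt0 : 0 < b) (b_lt1 : b < 1).
Local Notation D := (`]0, +oo[%classic : set R).

(** [Kcos t - i Ksin t] is the integral of y^(b-1) exp (- (1 + i t) y) over the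
half-line, that is Gamma (b) (1 + i t)^-b. *)
Definition Kcos t : R := \int[expo R]_(y in D) (y `^ (b - 1) * cos (t * y)).
Definition Ksin t : R := \int[expo R]_(y in D) (y `^ (b - 1) * sin (t * y)).
Let Kcos1 t : R := \int[expo R]_(y in D) (y `^ b * cos (t * y)).
Let Ksin1 t : R := \int[expo R]_(y in D) (y `^ b * sin (t * y)).

Let powR_continuous (a x : R) : 0 < x -> {for x, continuous (fun y : R => y `^ a)}.
Proof. by move=> x0; exact: is_derive1_continuous (is_derive1_powR a x0). Qed.

Let mD : measurable D. Proof. exact: measurable_itv. Qed.

Let Dpos x : D x -> 0 < x. Proof. by rewrite /= in_itv/= andbT. Qed.

Let ib1 : (expo R).-integrable D (EFin \o (fun x : R => x `^ (b - 1))).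
Proof. by apply: expo_integrable_powR; rewrite b_gt0 ltW. Qed.

Let ib : (expo R).-integrable D (EFin \o (fun x : R => x `^ b)).
Proof. by apply: expo_integrable_powR_le1; rewrite !ltW. Qed.

Let integrable_mul (f g : R -> R) : (expo R).-integrable D (EFin \o f) ->
  continuous g -> (forall x, `|g x| <= 1) ->
  (expo R).-integrable D (EFin \o (fun x : R => f x * g x)).
Proof.
move=> fi cg g1; apply: (@le_integrable _ _ _ (expo R) D mD _ (EFin \o f)) => //.
  apply/measurable_EFinP/measurable_funM.
    by apply/measurable_EFinP; exact: measurable_int fi.
  by apply: measurable_funTS; exact: continuous_measurable_fun.
by move=> x _; rewrite lee_fin normrM ler_piMr.
Qed.

Let cosM1 t (x : R) : `|cos (t * x)| <= 1. Proof. exact: norm_cos_le1. Qed.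
Let sinM1 t (x : R) : `|sin (t * x)| <= 1. Proof. exact: norm_sin_le1. Qed.
Let ccosM t := @continuous_cosM R t.
Let csinM t := @continuous_sinM R t.

(** Integration by parts on the half-line; the boundary terms vanish. *)
Let ibp (t : R) (g k : R -> R) :
  (forall x : R, is_derive x 1 g (t * k x)) -> continuous g -> continuous k ->
  (forall x, `|g x| <= 1) -> (forall x, `|k x| <= 1) ->
  b * (\int[expo R]_(x in D) (x `^ (b - 1) * g x)) =
  \int[expo R]_(x in D) (x `^ b * g x) - t * \int[expo R]_(x in D) (x `^ b * k x).
Proof.
move=> dgx cg ck g1 k1.
have i1 := integrable_mul ib1 cg g1.
have i2 := integrable_mul ib cg g1.
have i3 := integrable_mul ib ck k1.
have iB : (expo R).-integrable D
    (EFin \o (fun x : R => b * (x `^ (b - 1) * g x) - x `^ b * g x)).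
  by apply: RintegrableB => //; exact: RintegrableZl.
have iD : (expo R).-integrable D
    (EFin \o (fun x : R => b * (x `^ (b - 1) * g x) - x `^ b * g x + t * (x `^ b * k x))).
  by apply: RintegrableD => //; exact: RintegrableZl.
suff : \int[expo R]_(x in D)
    (b * (x `^ (b - 1) * g x) - x `^ b * g x + t * (x `^ b * k x)) = 0.
  rewrite RintegralD//; last exact: RintegrableZl.
  rewrite RintegralB//; last exact: RintegrableZl.
  by rewrite !RintegralZl//; exact: sub_add_eq0.
pose f x : R := b * (x `^ (b - 1) * g x) - x `^ b * g x + t * (x `^ b * k x).
pose F x : R := x `^ b * expR (- x) * g x.
have cf x : 0 < x -> {for x, continuous f}.
  move=> x0; apply: cvgD.
    apply: cvgB.
      apply: cvgM; first exact: cvg_cst.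
      by apply: cvgM; [exact: powR_continuous|exact: cg].
    by apply: cvgM; [exact: powR_continuous|exact: cg].
  apply: cvgM; first exact: cvg_cst.
  by apply: cvgM; [exact: powR_continuous|exact: ck].
have dF (x : R) : 0 < x -> is_derive x 1 F (f x * expR (- x)).
  move=> x0.
  have H := is_derive1M (is_derive1M (is_derive1_powR b x0) (is_derive_expRN x)) (dgx x).
  by apply: (is_derive_eq H); rewrite /f; ring.
have F0 : F n.+2%:R^-1 @[n --> \oo] --> (0 : R).
  apply: (@cvg_dominated0 _ _ _ _ _ (fun n => n.+2%:R^-1 `^ b)); last exact: cvg_harmonic_powR.
  move=> n; rewrite !normrM -[leRHS]mulr1 ler_pM//.
  rewrite -[leRHS]mulr1 ger0_norm ?powR_ge0// ler_wpM2l ?powR_ge0//.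
  by rewrite ger0_norm ?expR_ge0// -expR0 ler_expR oppr_le0 invr_ge0.
have F1 : F n.+2%:R @[n --> \oo] --> (0 : R).
  apply: (@cvg_dominated0 _ _ _ _ _ (fun n => n.+2%:R `^ b * expR (- n.+2%:R))).
    move=> n; rewrite normrM -[leRHS]mulr1 ler_pM// ger0_norm// mulr_ge0 ?powR_ge0 ?expR_ge0.
  by apply: nat_expRN_cvg0; rewrite !ltW.
by rewrite (expo_FTC0y cf dF iD F0 F1) subrr.
Qed.

Let ibp_cos t : b * Kcos t = Kcos1 t + t * Ksin1 t.
Proof.
have H (x : R) : is_derive x 1 (fun y => cos (t * y)) (- t * sin (t * x)).
  by rewrite mulNr; exact: is_derive_cosM.
rewrite /Kcos (@ibp (- t) _ (fun y => sin (t * y)) H) ?mulNr ?opprK//.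
Qed.

Let ibp_sin t : b * Ksin t = Ksin1 t - t * Kcos1 t.
Proof.
rewrite /Ksin (@ibp t _ (fun y => cos (t * y)) (is_derive_sinM t))//.
Qed.

(** Differentiation in t costs a factor y, and y^b is integrable. *)
Let derive_under (g dg : R -> R) (t : R) :
  (forall x : R, is_derive x 1 g (dg x)) -> continuous g -> continuous dg ->
  (forall x, `|g x| <= 1) -> (forall x, `|dg x| <= 1) ->
  is_derive t 1 (fun t => \int[expo R]_(y in D) (y `^ (b - 1) * g (t * y)))
    (\int[expo R]_(y in D) (y `^ b * dg (t * y))).
Proof.
move=> dgx cg cdg g1 dg1.
have cM (f : R -> R) (x : R) : continuous f -> continuous (fun y => f (x * y)).
  move=> cf y; apply: continuous_comp (cf _).
  by apply: (is_derive1_continuous (is_derive_mulr x y)).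
have Ia : `]t - 1, t + 1[%classic t by rewrite /= in_itv/= ltrBlDr ltrDl ltr01.
have intf x : `]t - 1, t + 1[%classic x ->
    (expo R).-integrable D (EFin \o (fun y : R => y `^ (b - 1) * g (x * y))).
  by move=> _; apply: integrable_mul => //; exact: cM.
have dc (x y : R) : is_derive x 1 (fun x : R => y `^ (b - 1) * g (x * y))
    (y `^ (b - 1) * (y * dg (x * y))).
  have Hy : is_derive x 1 (fun x : R => x * y) y.
    by apply: (is_derive_eq (is_derive1M (is_derive_id x 1) (is_derive_cst y x 1))); rewrite mulr0 addr0 mul1r.
  by apply: (is_derive_eq (is_derive1Z _ (@is_derive1_compose R g (fun x => x * y) x _ _ (dgx (x * y)) Hy))); ring.
have derf (x y : R) : `]t - 1, t + 1[%classic x -> D y ->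
    derivable (fun x : R => y `^ (b - 1) * g (x * y)) x 1.
  by move=> _ _; have ? := dc x y; exact: ex_derive.
have powb y : 0 < y -> y `^ (b - 1) * y = y `^ b.
  by move=> y0; rewrite mulrC mulr_powRB1// ltW.
have G_ub (x y : R) : `]t - 1, t + 1[%classic x -> D y ->
    `|partial1of2 (fun x y : R => y `^ (b - 1) * g (x * y)) x y| <= y `^ b.
  move=> _ /Dpos y0; rewrite partial1of2E; have ? := dc x y; rewrite derive_val.
  by rewrite mulrA powb// normrM (ger0_norm (powR_ge0 _ _)) ler_piMr// powR_ge0.
have G0 (y : R) : 0 <= y `^ b by exact: powR_ge0.
have mD' : @measurable _ (measurableTypeR R) D by exact: mD.
have D1 := derivable_under_integral mD' Ia intf derf G0 ib G_ub.
have E1 := differentiation_under_integral mD' Ia intf derf G0 ib G_ub.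
split; first exact: D1.
rewrite -derive1E E1; apply: eq_Rintegral => y; rewrite inE => /Dpos y0.
rewrite partial1of2E; have ? := dc t y; rewrite derive_val.
by rewrite mulrA powb.
Qed.

Let derive_Kcos (t : R) : is_derive t 1 Kcos (- Ksin1 t).
Proof.
have := @derive_under (@cos R) (fun x => - sin x) t (@is_derive_cos R).
have cs : continuous (fun x : R => - sin x).
  by move=> x; apply: cvgN; exact: continuous_sin.
move=> /(_ (@continuous_cos R) cs (@norm_cos_le1 R)).
have s1 (x : R) : `|- sin x| <= 1 by rewrite normrN norm_sin_le1.
move=> /(_ s1) H; apply: (is_derive_eq H).
rewrite -mulN1r -RintegralZl//; last exact: integrable_mul.
by apply: eq_Rintegral => y _; rewrite mulN1r mulrN.
Qed.

Let derive_Ksin (t : R) : is_derive t 1 Ksin (Kcos1 t).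
Proof.
exact: (@derive_under (@sin R) (@cos R) t (@is_derive_sin R)
  (@continuous_sin R) (@continuous_cos R) (@norm_sin_le1 R) (@norm_cos_le1 R)).
Qed.

(** [p + i q] is (1 + i t)^b in polar form.  Its product with the kernel has
derivative 0, which is the pair of identities [first] and [second]. *)
Let u t := expR (b / 2 * ln (1 + t ^+ 2)).
Let p t := u t * cos (b * atan t).
Let q t := u t * sin (b * atan t).

Let t2 t : 0 < 1 + t ^+ 2 :> R. Proof. by rewrite ltr_pwDl// sqr_ge0. Qed.

Let derive_u (t : R) : is_derive t 1 u (b / (1 + t ^+ 2) * t * u t).
Proof.
have H0 := is_derive1D (is_derive_cst (1:R) t 1) (is_derive1_sqr t).
have H2 := is_derive1Z (b / 2) (@is_derive1_compose R (@ln R) (fun t => 1 + t ^+ 2) t _ _ (is_derive1_ln (t2 t)) H0).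
apply: (is_derive_eq (@is_derive1_compose R (@expR R) (fun t => b / 2 * ln (1 + t ^+ 2)) t _ _ (is_derive_expR _) H2)); rewrite /u.
by field; rewrite gt_eqF.
Qed.

Let derive_p (t : R) : is_derive t 1 p (b / (1 + t ^+ 2) * (t * p t - q t)).
Proof.
have H1 := is_derive1Z b (is_derive1_atan t).
have H2 := is_derive1M (derive_u t) (@is_derive1_compose R (@cos R) (fun t => b * atan t) t _ _ (is_derive_cos (b * atan t)) H1).
apply: (is_derive_eq H2); rewrite /p /q.
by field; rewrite gt_eqF.
Qed.

Let derive_q (t : R) : is_derive t 1 q (b / (1 + t ^+ 2) * (t * q t + p t)).
Proof.
have H1 := is_derive1Z b (is_derive1_atan t).
have H2 := is_derive1M (derive_u t) (@is_derive1_compose R (@sin R) (fun t => b * atan t) t _ _ (is_derive_sin (b * atan t)) H1).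
apply: (is_derive_eq H2); rewrite /p /q.
by field; rewrite gt_eqF.
Qed.

(** Solving the two integrations by parts for the derivatives of the kernel: they
become the linear system satisfied by (1 + i t)^-b. *)
Let K1 t : Kcos1 t = b / (1 + t ^+ 2) * (Kcos t - t * Ksin t) /\
           Ksin1 t = b / (1 + t ^+ 2) * (Ksin t + t * Kcos t).
Proof.
have n0 : 1 + t ^+ 2 != 0 by rewrite gt_eqF.
have h1 := ibp_cos t; have h2 := ibp_sin t.
have e1 : Kcos1 t = (b * Kcos t - t * (b * Ksin t)) / (1 + t ^+ 2).
  by rewrite h1 h2; field.
have e2 : Ksin1 t = (b * Ksin t + t * (b * Kcos t)) / (1 + t ^+ 2).
  by rewrite h1 h2; field.
by rewrite e1 e2; split; field.
Qed.

(** This is Gamma (b). *)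
Definition gamma_const : R := \int[expo R]_(y in D) (y `^ (b - 1)).
Local Notation c := gamma_const.

Let first t : Kcos t * p t + Ksin t * q t = c.
Proof.
have Hd (x : R) : is_derive x 1 (fun t => Kcos t * p t + Ksin t * q t) 0.
  have H := is_derive1D (is_derive1M (derive_Kcos x) (derive_p x))
    (is_derive1M (derive_Ksin x) (derive_q x)).
  apply: (is_derive_eq H).
  by have [-> ->] := K1 x; ring.
rewrite (is_derive_0_is_cst t 0 Hd).
have -> : Kcos 0 = c by apply: eq_Rintegral => y _; rewrite mul0r cos0 mulr1.
rewrite /p /q /u atan0 mulr0 cos0 sin0 expr0n/= addr0 ln1 mulr0 expR0.
by ring.
Qed.

Let second t : Kcos t * q t - Ksin t * p t = 0.
Proof.
have Hd (x : R) : is_derive x 1 (fun t => Kcos t * q t - Ksin t * p t) 0.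
  have H := is_derive1B (is_derive1M (derive_Kcos x) (derive_q x))
    (is_derive1M (derive_Ksin x) (derive_p x)).
  apply: (is_derive_eq H).
  by have [-> ->] := K1 x; ring.
rewrite (is_derive_0_is_cst t 0 Hd).
have -> : Ksin 0 = 0.
  rewrite -[RHS](mul0r c) -RintegralZl//.
  by apply: eq_Rintegral => y _; rewrite !mul0r sin0 mulr0.
by rewrite /q atan0 mulr0 sin0 !mulr0 mul0r subrr.
Qed.

Let upow t : u t = (1 + t ^+ 2) `^ (b / 2).
Proof. by rewrite /powR gt_eqF. Qed.

Let sincos (t : R) : cos (atan t) = (1 + t ^+ 2) `^ (- 2^-1) /\
               t * cos (atan t) = sin (atan t).
Proof.
have e : cos (atan t) = (1 + t ^+ 2) `^ (- 2^-1).
  by rewrite cos_atan powRN powR12_sqrt// ltW.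
split=> //; have ct : cos (atan t) != 0 by rewrite e gt_eqF// powR_gt0.
by rewrite -{1}[t]atanK /tan -mulrA mulVf ?mulr1.
Qed.

(** In complex form (1 + i t) K(t) = c (1 + i t)^(1 - b), with
K(t) = Kcos t - i Ksin t.  For b = 1 - alpha the right-hand side is
c (1 + i t)^alpha, the shape of a stable exponent. *)
Lemma gamma_kernel_cos t :
  Kcos t + t * Ksin t = c * (1 + t ^+ 2) `^ ((1 - b) / 2) * cos ((1 - b) * atan t) /\
  t * Kcos t - Ksin t = c * (1 + t ^+ 2) `^ ((1 - b) / 2) * sin ((1 - b) * atan t).
Proof.
have := first t; have := second t; rewrite /p /q.
have u0 : u t != 0 by rewrite gt_eqF// expR_gt0.
set C := cos (b * atan t); set S := sin (b * atan t) => h2 h1.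
have CS : C ^+ 2 + S ^+ 2 = 1 by exact: cos2Dsin2.
have E1 : Kcos t = c / u t * C.
  apply: (mulfI u0); transitivity (c * C); last by field.
  by rewrite -h1 -[LHS]mulr1 -CS -[RHS]addr0 -(mul0r S) -h2; ring.
have E2 : Ksin t = c / u t * S.
  apply: (mulfI u0); transitivity (c * S); last by field.
  by rewrite -h1 -[LHS]mulr1 -CS -[RHS]subr0 -(mul0r C) -h2; ring.
have [cE sE] := sincos t.
have r0 : (1 + t ^+ 2) `^ (2^-1) != 0 by rewrite gt_eqF// powR_gt0.
have rE : (1 + t ^+ 2) `^ (2^-1) * cos (atan t) = 1.
  by rewrite cE powRN mulfV.
have -> : (1 + t ^+ 2) `^ ((1 - b) / 2) = (1 + t ^+ 2) `^ (2^-1) / u t.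
  rewrite upow -powRB; first by congr (_ `^ _); lra.
  by apply/implyP => _; rewrite gt_eqF.
rewrite !mulrBl !mul1r cosB sinB -/C -/S -sE.
by split; rewrite E1 E2; field: rE.
Qed.

End gamma_kernel.

(** * Transforms as integrals of tails, and the Abelian theorem *)

(** On [0, 1] the integrand is at least 1, and the exponential law charges that
interval. *)
Lemma gamma_const_gt0 (R : realType) (b : R) : 0 < b < 1 -> 0 < gamma_const b.
Proof.
move=> /andP[b0 b1]; set D := `]0, +oo[%classic : set R.
have mD : measurable D by exact: measurable_itv.
have e1 : expR (- 1) < 1 :> R by rewrite expR_lt1 ltrN10.
apply: (@lt_le_trans _ _ (1 - expR (- 1))); first by rewrite subr_gt0.
have := expo_kcos 0 (ler01 : 0 <= (1 : R)).
rewrite mul0r cos0 mulr1 => <-.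
have ib : (expo R).-integrable D (EFin \o (fun x : R => x `^ (b - 1))).
  by apply: expo_integrable_powR; rewrite b0 ltW.
rewrite /gamma_const [leRHS]Rintegral_mkcond.
apply: le_Rintegral => //.
- apply: (@bounded_integrable _ _ _ _ _ 1).
    by apply: measurable_funM; [exact: measurable_kcos|exact: measurable_indic].
  move=> x; rewrite /kcos !mul0r cos0 addr0 mul1r indicE.
  by case: (_ \in _); rewrite ?normr1// normr0.
- by rewrite -restrict_EFin; apply/integrable_restrict => //; rewrite setTI.
- move=> x _; rewrite /kcos !mul0r cos0 addr0 mul1r patchE indicE.
  have [xD|xD] := boolP (x \in D); last first.
    rewrite memNset//= in_itv/= => /andP[x0 _].
    by case/negP: xD; rewrite inE /D/= in_itv/= andbT.
  have [|] := boolP (x \in `]0, 1[%classic); last by rewrite powR_ge0.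
  rewrite inE/= in_itv/= => /andP[x0 x1].
  apply: (@le_trans _ _ (x `^ 0)); first by rewrite powRr0.
  by apply: ger_powR; [rewrite x0 ltW|rewrite subr_le0 ltW].
Qed.

Section transform.
Context d (T : measurableType d) (R : realType) (P : probability T R).
Variable V : T -> R.
Hypotheses (mV : measurable_fun setT V) (V0 : forall w, 0 <= V w).
Local Notation D := (`]0, +oo[%classic : set R).

Let mD : measurable D. Proof. exact: measurable_itv. Qed.

Let indE w y : \1_(`]0, V w[) y = \1_D y * \1_D (V w - y) :> R.
Proof.
rewrite !indicE !mem_setE /= !in_itv/= !andbT subr_gt0.
by case: (0 < y); case: (y < V w); rewrite ?mulr1 ?mulr0.
Qed.

(** The layer-cake formula: integrate the indicator of [y < V w] in the other
order. *)
Lemma tail_transform (k : R -> R) (M : R) : measurable_fun setT k ->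
  (forall y, `|k y| <= M) ->
  \int[P]_w \int[expo R]_y (k y * \1_(`]0, V w[) y) =
  \int[expo R]_(y in D) (k y * fine (P [set w | y < V w])).
Proof.
move=> mk kM.
pose h (z : T * measurableTypeR R) : R := k z.2 * (\1_D z.2 * \1_D (V z.1 - z.2)).
have mind : measurable_fun setT (\1_D : R -> R) by apply: measurable_indic; exact: mD.
have mh : measurable_fun setT h.
  apply: measurable_funM; first exact: measurableT_comp.
  apply: measurable_funM; first exact: measurableT_comp.
  apply: measurableT_comp => //; apply: measurable_funB => //.
  exact: measurableT_comp.
have h0M : forall z, `|h z| <= M.
  move=> z; apply: le_trans (kM z.2); rewrite /h normrM ler_piMr//.
  by rewrite !indicE; do 2 case: (_ \in _); rewrite ?mulr1 ?mulr0 ?normr1 ?normr0.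
transitivity (\int[P]_w \int[expo R]_y h (w, y)).
  by apply: eq_Rintegral => w _; apply: eq_Rintegral => y _; rewrite /h indE.
rewrite (Rintegral_swap P (expo R) mh h0M) [RHS]Rintegral_mkcond.
apply: eq_Rintegral => y _; rewrite patchE.
have [yD|yD] := boolP (y \in D); last first.
  rewrite (@eq_Rintegral _ _ _ P setT (fun=> 0)) ?Rintegral_prob_cst//.
  by move=> w _; rewrite /h/= indicE (negbTE yD) mul0r mulr0.
have mS : measurable [set w | y < V w] by exact: measurable_above.
rewrite -Rintegral_indic// -RintegralZl//; last first.
  apply: (@bounded_integrable _ _ _ _ _ 1); first exact: measurable_indic.
  by move=> w; rewrite indicE; case: (_ \in _); rewrite ?normr1 ?normr0.
apply: eq_Rintegral => w _; rewrite /h/= indicE yD mul1r; congr (_ * _).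
rewrite !indicE; congr (_%:R); congr (nat_of_bool _).
by apply/idP/idP; rewrite !inE/= in_itv/= andbT subr_gt0.
Qed.

Lemma cos_transform t :
  \int[P]_w (1 - expR (- V w) * cos (t * V w)) =
  \int[expo R]_(y in D) (kcos t y * fine (P [set w | y < V w])).
Proof.
rewrite -(@tail_transform (kcos t) (1 + `|t|)); first last.
  - exact: kcos_bound.
  - exact: measurable_kcos.
by apply: eq_Rintegral => w _; rewrite expo_kcos.
Qed.

Lemma sin_transform t :
  \int[P]_w (expR (- V w) * sin (t * V w)) =
  \int[expo R]_(y in D) (ksin t y * fine (P [set w | y < V w])).
Proof.
rewrite -(@tail_transform (ksin t) (1 + `|t|)); first last.
  - exact: ksin_bound.
  - exact: measurable_ksin.
by apply: eq_Rintegral => w _; rewrite expo_ksin.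
Qed.

End transform.

Section abelian.
Context d (T : measurableType d) (R : realType) (P : probability T R).
Variables (Y : T -> R) (a : nat -> R) (alpha beta C : R).
Hypotheses (mY : measurable_fun setT Y) (Y0 : forall w, 0 <= Y w).
Hypothesis alpha01 : 0 < alpha < 1.
Hypothesis beta1 : alpha < beta < 1.
Hypothesis a_gt0 : \forall n \near \oo, 0 < a n.
Local Notation U := (fun t : R => fine (P [set w | t < Y w])).
Hypothesis tail_cvg : forall x, 0 < x ->
  n%:R * U (x * a n) @[n --> \oo] --> x `^ (- alpha).
Hypothesis tail_bound : \forall n \near \oo, forall x, 0 < x ->
  n%:R * U (x * a n) <= C * (1 + x `^ (- beta)).
Local Notation D := (`]0, +oo[%classic : set R).

Let mD : measurable D. Proof. exact: measurable_itv. Qed.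

Let mS t : measurable [set w | t < Y w]. Proof. exact: measurable_above. Qed.

Let mtail : measurable_fun (setT : set R) U. Proof. exact: measurable_tail. Qed.

Let powR_div (y s c : R) : 0 < y -> 0 < s -> (y / s) `^ (- c) = s `^ c * y `^ (- c).
Proof.
move=> y0 s0; rewrite powRM ?invr_ge0 ?ltW// mulrC; congr (_ * _).
by rewrite -powR_inv1 ?ltW// -powRrM mulN1r opprK.
Qed.

(** After the change of scale y |-> y / s the tail in the integrand converges
pointwise to (y / s)^-alpha, and the Potter bound dominates it.  One statement
serves all kernels: k = 1 gives the Laplace transform, [kcos t] and [ksin t] the
real and imaginary parts of its complex version. *)
Lemma abelian (k : R -> R) (M s : R) : measurable_fun setT k ->
  (forall y, `|k y| <= M) -> 0 < s ->
  n%:R * \int[expo R]_(y in D) (k y * fine (P [set w | y < s * Y w / a n]))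
    @[n --> \oo] --> s `^ alpha * \int[expo R]_(y in D) (y `^ (- alpha) * k y).
Proof.
move=> mk kM s0; have /andP[al0 al1] := alpha01; have /andP[be0 be1] := beta1.
have : \forall n \near \oo, 0 < a n /\ forall x, 0 < x ->
    n%:R * U (x * a n) <= C * (1 + x `^ (- beta)).
  by near=> n; split; near: n.
move=> [N _ HN].
rewrite -(cvg_shiftn N).
have M0 : 0 <= M by exact: le_trans (normr_ge0 _) (kM 0).
have Dpos y : D y -> 0 < y by rewrite /= in_itv/= andbT.
have iD : (expo R).-integrable D (EFin \o (fun y : R => y `^ (- alpha))).
  have := @expo_integrable_powR R (1 - alpha).
  by rewrite addrAC subrr add0r; apply; rewrite subr_gt0 al1/= gerBl ltW.
have ib : (expo R).-integrable D (EFin \o (fun y : R => y `^ (- beta))).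
  have := @expo_integrable_powR R (1 - beta).
  rewrite addrAC subrr add0r; apply; rewrite subr_gt0 be1/= gerBl.
  by rewrite ltW// (lt_trans al0).
pose f n y := k y * ((n + N)%:R * U (y / s * a (n + N)%N)).
pose g y := M * (C * (1 + s `^ beta * y `^ (- beta))).
have [||||||_] := @Rdominated_cvg _ _ _ (expo R) D f
  (fun y => k y * (y / s) `^ (- alpha)) g.
- exact: mD.
- move=> n; apply: measurable_funM; first exact: measurable_funTS.
  apply: measurable_funM => //; apply: measurable_funTS.
  by apply: (measurableT_comp mtail); apply: measurable_funM => //; apply: measurable_funM.
- apply: measurable_funM; first exact: measurable_funTS.
  apply: measurable_funTS; apply: (measurableT_comp (@measurable_powR R (- alpha))).
  by apply: measurable_funM.
- move=> y /Dpos y0; apply: cvgM; first exact: cvg_cst.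
  have := tail_cvg (divr_gt0 y0 s0).
  by rewrite -(cvg_shiftn N).
- apply: RintegrableZl => //; apply: RintegrableZl => //.
  apply: RintegrableD => //; last exact: RintegrableZl.
  apply: measurable_bounded_integrable => //.
    by rewrite (le_lt_trans (probability_le1 _ _)) ?ltry.
  exact: bounded_cst.
- move=> n y /Dpos y0; rewrite /f /g normrM ler_pM//.
  rewrite ger0_norm; last by rewrite mulr_ge0// fine_ge0.
  have [_ H] := HN (n + N)%N (leq_addl _ _).
  by rewrite -powR_div//; apply: H; rewrite divr_gt0.
have -> : s `^ alpha * \int[expo R]_(y in D) (y `^ (- alpha) * k y) =
    \int[expo R]_(y in D) (k y * (y / s) `^ (- alpha)).
  rewrite -RintegralZl//.
    by apply: eq_Rintegral => y; rewrite inE => /Dpos y0; rewrite powR_div//; ring.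
  apply: (@le_integrable _ _ _ (expo R) D mD _ (EFin \o (fun y => M * y `^ (- alpha)))).
  - apply/measurable_EFinP/measurable_funM; last exact: measurable_funTS.
    by apply: measurable_funTS; exact: measurable_powR.
  - move=> y _; rewrite lee_fin normrM mulrC [leRHS]ger0_norm ?mulr_ge0 ?powR_ge0//.
    by rewrite ler_pM// ger0_norm ?powR_ge0.
  - exact: RintegrableZl.
apply: near_cvg; near=> n.
have [an _] := HN (n + N)%N (leq_addl _ _).
have setE y : [set w | y < s * Y w / a (n + N)%N] = [set w | y / s * a (n + N)%N < Y w].
  apply/seteqP; split => w /=;
    by rewrite ltr_pdivlMr// [s * _]mulrC -ltr_pdivrMr// mulrAC.
rewrite -RintegralZl//; last first.
  apply: (@le_integrable _ _ _ (expo R) D mD _ (EFin \o (fun=> M))) => //.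
  - apply/measurable_EFinP/measurable_funM; first exact: measurable_funTS.
    apply: measurable_funTS; rewrite (_ : (fun y => _) =
      (fun y => U (y / s * a (n + N)%N))); last first.
      by apply/funext => y; congr (fine (P _)); exact: setE.
    by apply: (measurableT_comp mtail); apply: measurable_funM => //; apply: measurable_funM.
  - move=> y _; rewrite lee_fin normrM -[leRHS]mulr1 ler_pM//.
      by rewrite [leRHS]ger0_norm.
    rewrite setE ger0_norm ?fine_ge0// -lee_fin fineK ?fin_num_measure//.
    exact: probability_le1.
  - apply: measurable_bounded_integrable => //.
      by rewrite (le_lt_trans (probability_le1 _ _)) ?ltry.
    exact: bounded_cst.
apply: eq_Rintegral => y _; rewrite /f mulrCA; congr (_ * (_ * fine (P _))).
by rewrite setE.
Unshelve. all: by end_near. Qed.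

End abelian.

(** * Bernstein polynomials and uniform approximation *)

Section weierstrass.
Context (R : realType).
Implicit Types (g : R -> R) (x y e : R).

(** Either x and y are close and uniform continuity applies, or (x - y)^2 is
bounded below and a crude bound on [g] is absorbed in the constant.  This form
of uniform continuity is what the variance estimate needs. *)
Lemma quadratic_modulus g e : continuous g -> 0 < e ->
  exists2 C : R, 0 <= C & forall x y, 0 <= x <= 1 -> 0 <= y <= 1 ->
    `|g x - g y| <= e + C * (x - y) ^+ 2.
Proof.
move=> cg e0.
have cI : compact (`[0, 1]%classic : set R) by exact: segment_compact.
have [M M0 gM] : exists2 M : R, 0 <= M & forall x, 0 <= x <= 1 -> `|g x| <= M.
  have [B [_ gB]] : bounded_set (g @` `[0, 1]%classic).
    apply/compact_bounded/continuous_compact => //.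
    exact: continuous_subspaceT.
  exists (`|B| + 1) => [|x x01]; first by rewrite addr_ge0.
  by apply: (gB (`|B| + 1)); [rewrite ltr_pwDr// ler_norm|exists x].
have [d0 d0_gt0 gd] : exists2 d : R, 0 < d & forall x, 0 <= x <= 1 ->
    forall y, `|x - y| < d -> `|g x - g y| < e.
  have := (@compact_near_coveringP R `[0, 1]%classic).1 cI _ (0 : R)^'+
    (fun d x => forall y, `|x - y| < d -> `|g x - g y| < e).
  move=> /(_ _) [x _|r/= r0 rP].
  - have e2 : 0 < e / 2 by rewrite divr_gt0.
    have /cvgrPdist_lt/(_ _ e2) /nbhs_ballP[r/= r0 rP] := cg x.
    exists (ball x (r / 2), [set d | d < r / 2]).
      split => /=; first exact: nbhsx_ballx (divr_gt0 r0 _).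
      by apply: nbhs_right_lt; rewrite divr_gt0.
    case=> x' d/= [xx' dr] y x'y.
    have h1 : `|g x - g x'| < e / 2.
      by apply: rP; rewrite /ball/=; apply: lt_trans xx' _; lra.
    have h2 : `|g x - g y| < e / 2.
      apply: rP; rewrite /ball/=.
      rewrite -(subrK x' x) -addrA; apply: le_lt_trans (ler_normD _ _) _.
      have : `|x - x'| < r / 2 by [].
      by move: x'y dr; lra.
    rewrite -(subrK (g x) (g x')) -addrA; apply: le_lt_trans (ler_normD _ _) _.
    by rewrite distrC; move: h1 h2; lra.
  - exists (r / 2); first by rewrite divr_gt0.
    move=> x x01; apply: (rP (r / 2)) => //=.
      by rewrite sub0r normrN gtr0_norm ?divr_gt0// ltr_pdivrMr// mulr_natr mulr2n ltrDl.
    by rewrite divr_gt0.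
exists (2 * M / d0 ^+ 2); first by apply: divr_ge0; [exact: mulr_ge0|exact: sqr_ge0].
move=> x y x01 y01; have [xy|xy] := ltP `|x - y| d0.
  apply: le_trans (ltW (gd x x01 y xy)) _; rewrite lerDl mulr_ge0 ?sqr_ge0//.
  by apply: divr_ge0; [exact: mulr_ge0|exact: sqr_ge0].
apply: (@le_trans _ _ (2 * M)).
  apply: le_trans (ler_normB _ _) _; rewrite mulr_natl mulr2n.
  by rewrite lerD// gM.
apply: (@le_trans _ _ (2 * M / d0 ^+ 2 * (x - y) ^+ 2)); last first.
  by rewrite lerDr ltW.
rewrite mulrAC ler_pdivlMr ?exprn_gt0// ler_wpM2l ?mulr_ge0//.
by rewrite -[leRHS]real_normK ?num_real// lerXn2r ?nnegrE// ltW.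
Qed.

(** Value of E u(S_N) for S_N binomial (N, x), as a polynomial in x: condition on
the first trial.  The recursion makes the mean and variance immediate. *)
Fixpoint bernstein N (u : nat -> R) : {poly R} :=
  if N is N'.+1 then
    (1 - 'X) * bernstein N' u + 'X * bernstein N' (u \o succn)
  else (u 0%N)%:P.

Lemma bernsteinS N u x : (bernstein N.+1 u).[x] =
  (1 - x) * (bernstein N u).[x] + x * (bernstein N (u \o succn)).[x].
Proof. by rewrite /= !hornerE. Qed.

Lemma bernstein_affine N (a b : R) (u : nat -> R) x :
  (bernstein N (fun k => a + b * u k)).[x] = a + b * (bernstein N u).[x].
Proof.
elim: N u => [|N IH] u; first by rewrite /= !hornerE.
by rewrite !bernsteinS IH (IH (u \o succn)); ring.
Qed.

Lemma bernstein_le N (u v : nat -> R) x : 0 <= x <= 1 ->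
  (forall k, (k <= N)%N -> u k <= v k) ->
  (bernstein N u).[x] <= (bernstein N v).[x].
Proof.
move=> /andP[x0 x1]; elim: N u v => [|N IH] u v uv.
  by rewrite /= !hornerE uv.
rewrite !bernsteinS lerD// ler_wpM2l ?subr_ge0//.
  by apply: IH => k kN; apply: uv; rewrite (leq_trans kN).
by apply: IH => k kN; exact: uv.
Qed.

Lemma bernstein_variance N (a : R) x :
  (bernstein N (fun k => (k%:R - a) ^+ 2)).[x] =
  (N%:R * x - a) ^+ 2 + N%:R * x * (1 - x).
Proof.
elim: N a => [|N IH] a; first by rewrite /= !hornerE; ring.
rewrite bernsteinS IH.
have -> : (fun k => (k%:R - a) ^+ 2) \o succn = (fun k => (k%:R - (a - 1)) ^+ 2).
  by apply/funext => k /=; rewrite -natr1; ring.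
by rewrite IH -natr1; ring.
Qed.

Lemma weierstrass g e : continuous g -> 0 < e ->
  exists p : {poly R}, forall x, 0 <= x <= 1 -> `|g x - p.[x]| <= e.
Proof.
move=> cg e0; have e2 : 0 < e / 2 by rewrite divr_gt0.
have [C C0 gC] := quadratic_modulus cg e2.
pose N := (Num.truncn (C / (e / 2))).+1.
have N0 : 0 < N%:R :> R by rewrite ltr0n.
have CN : C / N%:R <= e / 2.
  rewrite ler_pdivrMr// mulrC -ler_pdivrMr//.
  by apply/ltW; rewrite /N; exact: truncnS_gt.
exists (bernstein N (fun k => g (k%:R / N%:R))) => x x01.
have /andP[x0 x1] := x01.
pose q k : R := (k%:R - N%:R * x) ^+ 2.
have mod k : (k <= N)%N ->
    `|g x - g (k%:R / N%:R)| <= e / 2 + C / N%:R ^+ 2 * q k.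
  move=> kN; apply: le_trans (gC _ _ x01 _) _.
    by rewrite divr_ge0//= ler_pdivrMr// mul1r ler_nat.
  rewrite lerD2l -mulrA ler_wpM2l// /q.
  rewrite (_ : (x - _) ^+ 2 = N%:R ^- 2 * (k%:R - N%:R * x) ^+ 2)//.
  by field; rewrite gt_eqF.
have val : (bernstein N (fun k => (C / N%:R ^+ 2) * q k)).[x] <= e / 2.
  have := bernstein_affine N 0 (C / N%:R ^+ 2) q x.
  rewrite (_ : (fun k => 0 + _) = fun k => C / N%:R ^+ 2 * q k); last first.
    by apply/funext => k; rewrite add0r.
  move=> ->; rewrite add0r bernstein_variance subrr expr0n/= add0r.
  apply: le_trans CN; rewrite (_ : C / N%:R ^+ 2 * _ = C / N%:R * (x * (1 - x))).
    rewrite ler_piMr ?divr_ge0//.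
    by rewrite mulr_ile1// ?subr_ge0// gerBl.
  by field; rewrite gt_eqF.
have cst (a : R) u : (bernstein N (fun k => a + u k)).[x] = a + (bernstein N u).[x].
  have := bernstein_affine N a 1 u x; rewrite mul1r => <-.
  by congr (bernstein N _).[x]; apply/funext => k; rewrite mul1r.
rewrite ler_norml; apply/andP; split.
  rewrite lerBrDl -lerBrDr opprK.
  apply: (@le_trans _ _ (bernstein N (fun k => (g x + e / 2) + C / N%:R ^+ 2 * q k)).[x]).
    apply: bernstein_le => // k /mod; rewrite ler_norml => /andP[+ _].
    lra.
  by rewrite cst -addrA; lra.
rewrite lerBlDl -lerBlDr.
apply: (@le_trans _ _ (bernstein N (fun k => (g x - e / 2) + (- 1) * (C / N%:R ^+ 2 * q k))).[x]); last first.
  apply: bernstein_le => // k /mod; rewrite ler_norml => /andP[_ +].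
  lra.
by rewrite bernstein_affine; lra.
Qed.

End weierstrass.

(** * Limits of expectations from limits of Laplace transforms *)

Lemma poly_bounded (R : realType) (p : {poly R}) :
  exists M : R, forall u, 0 <= u <= 1 -> `|p.[u]| <= M.
Proof.
elim/poly_ind: p => [|p c [M pM]].
  by exists 0 => u _; rewrite horner0 normr0.
exists (M + `|c|) => u u01; have /andP[u0 u1] := u01.
rewrite !hornerE; apply: le_trans (ler_normD _ _) _; rewrite lerD2r.
by rewrite normrM (ger0_norm u0); apply: le_trans (pM u u01); rewrite ler_piMr.
Qed.

Lemma measurable_horner (R : realType) (p : {poly R}) :
  measurable_fun setT (fun u : R => p.[u]).
Proof. by apply: continuous_measurable_fun; exact: continuous_horner. Qed.

Section laplace_method.
Context (R : realType).

Definition laplace d (T : measurableType d) (P : probability T R) (V : T -> R)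
  (s : R) : R := \int[P]_w expR (- (s * V w)).

(** Pointwise convergence of the Laplace transforms of nonnegative variables,
on the open half-line only; tightness is expressed separately by [L] tending
to 1 at 0. *)
Definition laplace_cvg (L : R -> R) d (T : measurableType d)
    (P : probability T R) (Y : nat -> T -> R) :=
  [/\ forall n, measurable_fun setT (Y n), forall n w, 0 <= Y n w &
      forall s : R, 0 < s -> laplace P (Y n) s @[n --> \oo] --> L s].

Lemma expRN_01 (y : R) : 0 <= y -> 0 <= expR (- y) <= 1.
Proof. by move=> y0; rewrite expR_ge0 -expR0 ler_expR oppr_le0. Qed.

Lemma measurable_expRN d (T : measurableType d) (f : T -> R) :
  measurable_fun setT f -> measurable_fun setT (fun w => expR (- f w)).
Proof.
move=> mf; apply: measurableT_comp; first exact: measurable_expR.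
by apply: measurableT_comp => //; exact: oppr_measurable.
Qed.

Lemma laplace_integrable d (T : measurableType d) (P : probability T R)
    (V : T -> R) s : measurable_fun setT V -> (forall w, 0 <= V w) -> 0 <= s ->
  P.-integrable setT (EFin \o (fun w => expR (- (s * V w)))).
Proof.
move=> mV V0 s0; apply: (@bounded_integrable _ _ _ _ _ 1).
  by apply: measurable_expRN; exact: measurable_funM.
by move=> w; have /andP[h1 h2] := expRN_01 (mulr_ge0 s0 (V0 w)); rewrite ger0_norm.
Qed.

(** The limit [A] is chosen before the probability space and the variables: it is
determined by [L].  This uniformity is what later allows two unrelated
sequences with the same limiting transform to be compared. *)
Lemma cvg_poly_laplace (L : R -> R) (p : {poly R}) (k : nat) :
  exists A : R, forall d (T : measurableType d) (P : probability T R) Y,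
    laplace_cvg L P Y ->
    \int[P]_w (p.[expR (- Y n w)] * expR (- (k%:R * Y n w))) @[n --> \oo] --> A.
Proof.
elim/poly_ind: p k => [|p c IH] k.
  exists 0 => d T P Y _; apply: (@near_cvg _ _ \oo _ (fun=> 0)); last exact: cvg_cst.
  near=> n; rewrite -[LHS](Rintegral_prob_cst P).
  by apply: eq_Rintegral => w _; rewrite horner0 mul0r.
have [A hA] := IH k.+1.
exists (A + c * (if k is 0%N then 1 else L k%:R)) => d T P Y LY.
have [mY Y0 cY] := LY.
have [M pM] := poly_bounded p.
apply: (@near_cvg _ _ \oo _ (fun n =>
    \int[P]_w (p.[expR (- Y n w)] * expR (- (k.+1%:R * Y n w)))
  + c * laplace P (Y n) k%:R)).
  near=> n; rewrite /laplace -RintegralZl//; last exact: laplace_integrable.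
  rewrite -RintegralD//.
  - apply: eq_Rintegral => w _; rewrite !hornerE mulrDl -mulrA -expRD.
    by congr (_ * expR _ + _); rewrite -natr1; ring.
  - apply: (@bounded_integrable _ _ _ _ _ M).
      apply: measurable_funM.
        apply: (measurableT_comp (measurable_horner p)).
        exact: measurable_expRN.
      by apply: measurable_expRN; exact: measurable_funM.
    move=> w; rewrite normrM.
    have /andP[h1 h2] := expRN_01 (mulr_ge0 (ler0n R k.+1) (Y0 n w)).
    rewrite (ger0_norm h1); apply: le_trans (pM _ (expRN_01 (Y0 n w))).
    by rewrite ler_piMr.
  - exact: integrableZl (laplace_integrable P (mY n) (Y0 n) (ler0n R k)).
apply: cvgD; first exact: hA.
apply: cvgMr; case: k {IH A hA} => [|k]; last by apply: cY; rewrite ltr0n.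
apply: (@near_cvg _ _ \oo _ (fun=> 1)); last exact: cvg_cst.
near=> n; rewrite /laplace -[LHS](Rintegral_prob_cst P).
by apply: eq_Rintegral => w _; rewrite mul0r oppr0 expR0.
Unshelve. all: by end_near. Qed.

(** In the variable u = exp (- y) the half-line becomes (0, 1].  Multiplying [f]
by exp (- eta y) makes it extend continuously by 0 at u = 0, so Weierstrass
applies; the price is the last term, which is small in mean when eta is
small. *)
Lemma bounded_poly_expRN (f : R -> R) (M eta e : R) : continuous f ->
  (forall y, `|f y| <= M) -> 0 < eta -> 0 < e ->
  exists p : {poly R}, forall y, 0 <= y ->
    `|f y - p.[expR (- y)]| <= e + M * (1 - expR (- (eta * y))).
Proof.
move=> cf fM eta0 e0.
have M0 : 0 <= M by apply: le_trans (fM 0).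
(* The value 0 for u <= 0 is the limit at infinity of f y exp (- eta y). *)
pose g u : R := if 0 < u then f (- ln u) * expR (eta * ln u) else 0.
have cg : continuous g.
  move=> u; have [u0|u0|->] := ltgtP u 0.
  - apply: (@near_cvg _ _ (nbhs u) _ (fun=> 0)); last first.
      by rewrite /g ltNge ltW//=; exact: cvg_cst.
    near=> v; rewrite /g ltNge ltW//.
    by near: v; exact: lt_nbhsl.
  - apply: (@near_cvg _ _ (nbhs u) _ (fun u => f (- ln u) * expR (eta * ln u))).
      near=> v; rewrite /g ifT//.
      by near: v; exact: lt_nbhsr.
    rewrite /g u0; have cl : ln v @[v --> u] --> ln u by exact: continuous_ln.
    apply: cvgM.
      apply: (cvg_comp (fun v => - ln v)); last exact: cf.
      exact: cvgN.
    apply: (cvg_comp (fun v => eta * ln v)); last exact: continuous_expR.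
    exact: cvgMr.
  - rewrite /continuous_at /g ltxx; apply/cvgrPdist_lt => r r0.
    pose a := r / (M + 1).
    have a0 : 0 < a by rewrite divr_gt0// ltr_pwDr.
    near=> v; rewrite sub0r normrN; case: ifP => [v0|]; last by rewrite normr0.
    rewrite normrM (ger0_norm (expR_ge0 _)).
    have : expR (eta * ln v) < a.
      rewrite -[ltRHS](lnK a0)//; rewrite ltr_expR mulrC -ltr_pdivlMr//.
      rewrite -ltr_expR lnK ?posrE//.
      near: v; apply: lt_nbhsl; exact: expR_gt0.
    rewrite /a ltr_pdivlMr ?ltr_pwDr//; apply: le_lt_trans.
    rewrite mulrC ler_wpM2l ?expR_ge0//.
    by apply: le_trans (fM _) _; rewrite lerDl.
have [p gp] := weierstrass cg e0.
exists p => y y0; rewrite (_ : _ - _ = (g (expR (- y)) - p.[expR (- y)]) +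
    f y * (1 - expR (- (eta * y)))); last first.
  by rewrite /g expR_gt0 expRK opprK mulrN; ring.
apply: le_trans (ler_normD _ _) _; rewrite lerD//; first exact/gp/expRN_01.
have /andP[h1 h2] := expRN_01 (mulr_ge0 (ltW eta0) y0).
by rewrite normrM [X in _ * X]ger0_norm ?subr_ge0// ler_wpM2r// subr_ge0.
Unshelve. all: by end_near. Qed.

Lemma laplace_approx (L : R -> R) (f : R -> R) (M e : R) : continuous f ->
  (forall y, `|f y| <= M) -> L s @[s --> 0^'+] --> (1 : R) -> 0 < e ->
  exists c : R, forall d (T : measurableType d) (P : probability T R) Y,
    laplace_cvg L P Y -> \forall n \near \oo, `|\int[P]_w f (Y n w) - c| < e.
Proof.
move=> cf fM L1 e0.
have M0 : 0 <= M by apply: le_trans (fM 0).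
have e4 : 0 < e / 4 by rewrite divr_gt0.
pose r := e / 4 / (M + 1).
have r0 : 0 < r by rewrite divr_gt0// ltr_pwDr.
have [eta eta0 Leta] : exists2 eta : R, 0 < eta & 1 - r < L eta.
  have /cvgrPdist_lt/(_ _ r0) H := L1.
  near (0 : R)^'+ => eta; exists eta => //.
  have : `|1 - L eta| < r by near: eta.
  by rewrite ltr_norml => /andP[_]; rewrite ltrBlDr -ltrBlDl.
have [p fp] := bounded_poly_expRN cf fM eta0 e4.
have [A hA] := cvg_poly_laplace L p 0.
have [K pK] := poly_bounded p.
exists A => d T P Y LY; have [mY Y0 cY] := LY.
have /cvgrPdist_lt/(_ _ e4) hA' := hA _ _ P Y LY.
have hL : \forall n \near \oo, 1 - r < laplace P (Y n) eta.
  by have /cvgr_gt := cY _ eta0; apply.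
near=> n.
have h1 : `|A - \int[P]_w (p.[expR (- Y n w)] * expR (- (0%:R * Y n w)))| < e / 4.
  by near: n.
have h2 : 1 - r < laplace P (Y n) eta by near: n.
have mf : measurable_fun setT (fun w => f (Y n w)).
  by apply: (measurableT_comp (continuous_measurable_fun cf)).
have mp : measurable_fun setT (fun w => p.[expR (- Y n w)]).
  by apply: (measurableT_comp (measurable_horner p)); exact: measurable_expRN.
have if_ : P.-integrable setT (EFin \o (fun w => f (Y n w))).
  exact: (@bounded_integrable _ _ _ _ _ M).
have ip : P.-integrable setT (EFin \o (fun w => p.[expR (- Y n w)])).
  apply: (@bounded_integrable _ _ _ _ _ K) => // w.
  exact/pK/expRN_01.
have iL := laplace_integrable P (mY n) (Y0 n) (ltW eta0).
have h3 : `|\int[P]_w (f (Y n w) - p.[expR (- Y n w)])| <= e / 4 + M * (1 - laplace P (Y n) eta).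
  apply: le_trans (le_normr_Rintegral _ _) _ => //.
    exact: RintegrableB.
  have i1 : P.-integrable setT (EFin \o (fun w => 1 - expR (- (eta * Y n w)))).
    by apply: RintegrableB => //; apply: (@bounded_integrable _ _ _ _ _ 1) => // w;
      rewrite normr1.
  have i2 : P.-integrable setT (EFin \o (fun=> e / 4)).
    by apply: (@bounded_integrable _ _ _ _ _ (e / 4)) => // w; rewrite gtr0_norm.
  have i3 := RintegrableZl measurableT i1 M.
  rewrite (_ : _ + _ = \int[P]_w (e / 4 + M * (1 - expR (- (eta * Y n w))))).
    apply: le_Rintegral => //.
    - apply: (@bounded_integrable _ _ _ _ _ (M + K)).
        by apply: measurableT_comp; [exact: normr_measurable|exact: measurable_funB].
      move=> w; rewrite normr_id; apply: le_trans (ler_normB _ _) _.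
      by rewrite lerD//; exact/pK/expRN_01.
    - exact: RintegrableD.
    - by move=> w _; exact: fp.
  rewrite RintegralD ?Rintegral_prob_cst// RintegralZl// RintegralB//.
    by rewrite Rintegral_prob_cst.
  by apply: (@bounded_integrable _ _ _ _ _ 1) => // w; rewrite normr1.
rewrite RintegralB// in h3.
rewrite (@eq_Rintegral _ _ _ P setT (fun w => p.[expR (- Y n w)])) in h1; last first.
  by move=> w _; rewrite mul0r oppr0 expR0 mulr1.
have h4 : M * (1 - laplace P (Y n) eta) <= e / 4.
  apply: (@le_trans _ _ (M * r)).
    by rewrite ler_wpM2l//; move: h2; lra.
  by rewrite /r mulrCA ler_piMr ?(ltW e4)// ler_pdivrMr ?ltr_pwDr// mul1r lerDl.
rewrite -[_ - A](subrKA (\int[P]_w p.[expR (- Y n w)])).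
apply: le_lt_trans (ler_normD _ _) _.
rewrite distrC in h1.
by move: h1 h3 h4; lra.
Unshelve. all: by end_near. Qed.

(** The limit of the expectations exists and depends on [L] alone, not on the
variables that realise it. *)
Lemma laplace_method (L : R -> R) (f : R -> R) (M : R) : continuous f ->
  (forall y, `|f y| <= M) -> L s @[s --> 0^'+] --> (1 : R) ->
  exists c : R, forall d (T : measurableType d) (P : probability T R) Y,
    laplace_cvg L P Y -> \int[P]_w f (Y n w) @[n --> \oo] --> c.
Proof.
move=> cf fM L1.
have [[d0 [T0 [P0 [Y0 H0]]]]|none] := pselect (exists d (T : measurableType d)
    (P : probability T R) (Y : nat -> T -> R), laplace_cvg L P Y); last first.
  exists 0 => d T P Y H; exfalso; apply: none.
  by exists d, T, P, Y.
have cv : cvg (\int[P0]_w f (Y0 n w) @[n --> \oo]).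
  apply/cauchy_cvgP/cauchy_exP => e e0.
  have [c hc] := laplace_approx cf fM L1 e0.
  exists c; have := hc _ _ _ _ H0; apply: filterS => n.
  by rewrite /ball/= distrC.
exists (lim (\int[P0]_w f (Y0 n w) @[n --> \oo])) => d T P Y H.
apply/cvgrPdist_lt => e e0; have e3 : 0 < e / 3 by rewrite divr_gt0.
have [c hc] := laplace_approx cf fM L1 e3.
have h1 := hc _ _ _ _ H0; have h2 := hc _ _ _ _ H.
have /cvgrPdist_lt/(_ _ e3) h3 := cv.
near=> n.
have k1 : `|\int[P0]_w f (Y0 n w) - c| < e / 3 by near: n.
have k2 : `|\int[P]_w f (Y n w) - c| < e / 3 by near: n.
have k3 : `|lim (\int[P0]_w f (Y0 n w) @[n --> \oo]) - \int[P0]_w f (Y0 n w)| < e / 3 by near: n.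
move: k1 k2 k3; rewrite !ltr_norml => /andP[? ?] /andP[? ?] /andP[? ?].
by apply/andP; split; lra.
Unshelve. all: by end_near. Qed.

Lemma laplace_cvg_cst (L : R -> R) d (T : measurableType d)
    (P : probability T R) (V : T -> R) : measurable_fun setT V ->
  (forall w, 0 <= V w) ->
  (forall s : R, 0 < s -> laplace P V s = L s) -> laplace_cvg L P (fun=> V).
Proof.
by move=> mV V0 LV; split=> // s s0; rewrite LV//; exact: cvg_cst.
Qed.

End laplace_method.

(** * The continuity theorem for Laplace transforms *)

(** The hypotheses say that 1 - G is the distribution function of a nonnegative
variable, right continuity being stated in the monotone form that is convenient
for suprema. *)
Lemma law_of_tail (R : realType) (G : R -> R) :
  (forall x y : R, x <= y -> G y <= G x) ->
  (forall (x e : R), 0 < e -> exists2 y, x < y & G x < G y + e) ->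
  (forall x, x < 0 -> G x = 1) -> G x @[x --> +oo] --> (0 : R) ->
  exists mu : probability R R,
    forall x, mu `]x, +oo[%classic = (G x)%:E.
Proof.
move=> G_ni G_rc G_neg G_y.
pose F x := 1 - G x.
have F_nd : nondecreasing F by move=> x y xy; rewrite lerD2l lerN2; exact: G_ni.
have F_rc : right_continuous F.
  move=> x; apply/cvgrPdist_lt => e e0.
  have [y xy Gy] := G_rc x e e0.
  near=> z; have xz : x < z by near: z; exact: nbhs_right_gt.
  have zy : z < y by near: z; exact: nbhs_right_lt.
  rewrite /F ltr_norml; apply/andP; split.
    by have := G_ni _ _ (ltW zy); have := e0; lra.
  by have := G_ni _ _ (ltW xz); have := e0; lra.
have F_Ny : F x @[x --> -oo] --> (0 : R).
  apply/cvgrPdist_lt => e e0; near=> x.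
  rewrite /F G_neg ?subrr ?subr0 ?normr0//.
have F_y : F x @[x --> +oo] --> (1 : R).
  rewrite -[X in _ --> X]subr0; apply: cvgB => //; exact: cvg_cst.
pose m1 := isCumulative.Build R _ R F F_nd F_rc.
pose m2 := isCumulativeBounded.Build R 0 1 F F_Ny F_y.
pose f : cumulativeBounded (0 : R) (1 : R) :=
  CumulativeBounded.Pack (CumulativeBounded.Class m2 m1).
pose mu0 : probability (measurableTypeR R) R := lebesgue_stieltjes_measure f.
have mid : measurable_fun setT (idfun : measurableTypeR R -> R).
  exact: measurable_id.
exists (distribution mu0 (mfun_of mid)) => x.
have -> : `]x, +oo[%classic = ~` `]-oo, x]%classic :> set R by rewrite setCitvl.
rewrite probability_setC; last exact: measurable_itv.
have := cdf_lebesgue_stieltjes_id f x.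
rewrite /cdf/= => ->.
by rewrite -EFinB /F subKr.
Unshelve. all: by end_near. Qed.

(** The case t = 0 of the cosine transform. *)
Lemma laplace_tail (R : realType) d (T : measurableType d) (P : probability T R)
    (V : T -> R) : measurable_fun setT V -> (forall w, 0 <= V w) ->
  1 - laplace P V 1 = \int[expo R]_(y in `]0, +oo[) fine (P [set w | y < V w]).
Proof.
move=> mV V0; have := cos_transform P mV V0 0.
have iL := laplace_integrable P mV V0 ler01.
have i1 : P.-integrable setT (EFin \o (fun=> 1 : R)).
  by apply: (@bounded_integrable _ _ _ _ _ 1) => // w; rewrite normr1.
rewrite (_ : \int[P]_w _ = 1 - laplace P V 1).
  move=> ->; apply: eq_Rintegral => y _.
  by rewrite /kcos mul0r cos0 mul0r addr0 mul1r.
rewrite [RHS](_ : _ = \int[P]_w (1 - expR (- (1 * V w)))); last first.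
  by rewrite RintegralB// Rintegral_prob_cst.
by apply: eq_Rintegral => w _; rewrite mul0r cos0 mulr1 mul1r.
Qed.

Section limit_law.
Context (R : realType) (L : R -> R).
Context d (T : measurableType d) (P : probability T R) (Y : nat -> T -> R).
Hypothesis LY : laplace_cvg L P Y.
Hypothesis L1 : L s @[s --> 0^'+] --> (1 : R).
Local Notation D := (`]0, +oo[%classic : set R).

Let mD : measurable D. Proof. exact: measurable_itv. Qed.

Let tail n (t : R) : R := fine (P [set w | t < Y n w]).

Let mY n : measurable_fun setT (Y n). Proof. by case: LY. Qed.

Let mS n t : measurable [set w | t < Y n w]. Proof. exact: measurable_above. Qed.

Let tail_ni n (x y : R) : x <= y -> tail n y <= tail n x.
Proof. exact: tail_nonincreasing. Qed.

Let tail_ge0 n x : 0 <= tail n x. Proof. exact: fine_ge0. Qed.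

Let tail_le1 n x : tail n x <= 1. Proof. exact: tail_le1. Qed.

Let mtail n : measurable_fun (setT : set R) (tail n).
Proof. exact: measurable_tail. Qed.

(** A continuous ramp between [x] and [y] separates the two indicators, and its
expectations converge. *)
Let tail_separation (x y : R) : x < y -> exists l : R, forall e, 0 < e ->
  \forall n \near \oo, tail n y <= l + e /\ l - e <= tail n x.
Proof.
move=> xy; have [_ Y0 cY] := LY.
pose f z : R := Num.min 1 (Num.max 0 ((z - x) / (y - x))).
have cf : continuous f.
  move=> z; apply: (@continuous_min R R (fun=> 1)
    (fun z => Num.max 0 ((z - x) / (y - x)))); first exact: cvg_cst.
  apply: (@continuous_max R R (fun=> 0)
    (fun z => (z - x) / (y - x))); first exact: cvg_cst.
  by apply: cvgMl; apply: cvgB; [exact: cvg_id|exact: cvg_cst].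
have f01 z : 0 <= f z <= 1.
  by rewrite /f le_min ler01 le_max lexx/= ge_min lexx.
have fM z : `|f z| <= 1 by have /andP[h1 h2] := f01 z; rewrite ger0_norm.
have [l hl] := laplace_method cf fM L1.
exists l => e e0; have /cvgrPdist_lt/(_ _ e0) H := hl _ _ _ _ LY.
have mf n : measurable_fun setT (fun w => f (Y n w)).
  by apply: (measurableT_comp (continuous_measurable_fun cf)).
have if_ n : P.-integrable setT (EFin \o (fun w => f (Y n w))).
  by apply: (@bounded_integrable _ _ _ _ _ 1).
have it n t : P.-integrable setT (EFin \o (\1_[set w | t < Y n w] : T -> R)).
  apply: (@bounded_integrable _ _ _ _ _ 1); first exact: measurable_indic.
  by move=> w; rewrite indicE; case: (_ \in _); rewrite ?normr1 ?normr0.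
have yx : 0 < y - x by rewrite subr_gt0.
near=> n.
have h : `|l - \int[P]_w f (Y n w)| < e by near: n.
have h1 : tail n y <= \int[P]_w f (Y n w).
  rewrite /tail -Rintegral_indic//; apply: le_Rintegral => // w _.
  rewrite indicE; have [|_] := boolP (w \in _); last by have /andP[] := f01 (Y n w).
  rewrite inE/= => yw; rewrite /f le_min lexx/= le_max; apply/orP; right.
  by rewrite ler_pdivlMr// mul1r lerD2r ltW.
have h2 : \int[P]_w f (Y n w) <= tail n x.
  rewrite /tail -Rintegral_indic//; apply: le_Rintegral => // w _.
  rewrite indicE; have [_|] := boolP (w \in _); first by have /andP[] := f01 (Y n w).
  rewrite notin_setE/= => /negP; rewrite -leNgt => yw.
  rewrite /f ge_min; apply/orP; right; rewrite ge_max lexx/=.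
  by rewrite ler_pdivrMr// mul0r subr_le0.
by move: h h1 h2; rewrite ltr_norml => /andP[? ?] ? ?; split; lra.
Unshelve. all: by end_near. Qed.

(** The limit tail at [y] is the supremum of the eventual lower bounds of the
tails strictly to the right of [y]; looking to the right makes it right
continuous, as a tail must be. *)
Let S (y : R) : set R :=
  [set v | exists2 z, y < z & \forall n \near \oo, v <= tail n z].
Let G y := sup (S y).

Let S0 y : S y 0.
Proof. by exists (y + 1); [rewrite ltrDl|near=> n]. Unshelve. all: by end_near. Qed.

Let S_ub y : ubound (S y) 1.
Proof.
by move=> v [z _ [N _ H]]; apply: le_trans (H N _) (tail_le1 _ _) => /=.
Qed.

Let S_sup y : has_sup (S y).
Proof. by split; [exists 0; exact: S0|exists 1; exact: S_ub]. Qed.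

Let G01 y : 0 <= G y <= 1.
Proof.
apply/andP; split; first by apply: sup_upper_bound (S0 y); exact: S_sup.
by apply: ge_sup; [exists 0; exact: S0|exact: S_ub].
Qed.

Let G_ni (x y : R) : x <= y -> G y <= G x.
Proof.
move=> xy; apply: le_sup; [|by exists 0; exact: S0|exact: S_sup].
move=> v [z yz H]; exists v => //; split => //.
by exists z => //; exact: le_lt_trans yz.
Qed.

Let G_rc (x e : R) : 0 < e -> exists2 y, x < y & G x < G y + e.
Proof.
move=> e0; have [v [z xz H] Gv] := sup_adherent e0 (S_sup x).
exists ((x + z) / 2); first by move: xz; lra.
have : v <= G ((x + z) / 2).
  apply: sup_upper_bound; first exact: S_sup.
  by exists z => //; move: xz; lra.
by move: Gv; rewrite -/(G x); lra.
Qed.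

Let G_le_tail (y e : R) : 0 < e -> \forall n \near \oo, G y <= tail n y + e.
Proof.
move=> e0; have [v [z yz H] Gv] := sup_adherent e0 (S_sup y).
near=> n; have h1 : v <= tail n z by near: n.
have h2 := tail_ni n (ltW yz).
by move: Gv; rewrite -/(G y); lra.
Unshelve. all: by end_near. Qed.

Let tail_le_G (y z e : R) : y < z -> 0 < e -> \forall n \near \oo, tail n z <= G y + e.
Proof.
move=> yz e0; have e2 : 0 < e / 2 by rewrite divr_gt0.
have [l hl] : exists l : R, forall e, 0 < e -> \forall n \near \oo,
    tail n z <= l + e /\ l - e <= tail n ((y + z) / 2).
  by apply: tail_separation; move: yz; lra.
have h1 : l - e / 2 <= G y.
  apply: sup_upper_bound; first exact: S_sup.
  exists ((y + z) / 2); first by move: yz; lra.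
  by have := hl _ e2; apply: filterS => n [].
near=> n; have h2 : tail n z <= l + e / 2.
  by near: n; have := hl _ e2; apply: filterS => n [].
by move: h1 h2; lra.
Unshelve. all: by end_near. Qed.

Let G_neg y : y < 0 -> G y = 1.
Proof.
move=> y0; have [_ Y0 cY] := LY.
apply/eqP; rewrite eq_le; have /andP[_ ->] /= := G01 y.
apply: sup_upper_bound; first exact: S_sup.
exists (y / 2); first by move: y0; lra.
near=> n; rewrite /tail (_ : [set w | _] = setT) ?probability_setT//.
by apply/seteqP; split => w //= _; apply: lt_le_trans (Y0 n w); move: y0; lra.
Unshelve. all: by end_near. Qed.

(** Tightness: exp (- eta y) is at most 1/2 beyond 1 / eta, so the mass there is at
most twice 1 - L(eta). *)
Let G_cvgy : G x @[x --> +oo] --> (0 : R).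
Proof.
have [_ Y0 cY] := LY.
apply/cvgrPdist_lt => e e0; pose r := e / 4.
have r0 : 0 < r by rewrite divr_gt0.
have [eta eta0 Leta] : exists2 eta : R, 0 < eta & 1 - r < L eta.
  have /cvgrPdist_lt/(_ _ r0) H := L1.
  near (0 : R)^'+ => eta; exists eta => //.
  have : `|1 - L eta| < r by near: eta.
  by rewrite ltr_norml => /andP[_]; rewrite ltrBlDr -ltrBlDl.
have hL : \forall n \near \oo, 1 - r < laplace P (Y n) eta.
  by have /cvgr_gt := cY _ eta0; apply.
near=> x; have xeta : 1 / eta < x by near: x; apply: nbhs_pinfty_gt; rewrite num_real.
have /andP[Gx0 _] := G01 x.
rewrite sub0r normrN ger0_norm//.
have hG := G_le_tail x r0.
near \oo => n.
have h1 : 1 - r < laplace P (Y n) eta by near: n.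
have h2 : G x <= tail n x + r by near: n.
suff h3 : tail n x / 2 <= 1 - laplace P (Y n) eta.
  by rewrite /r in h1 h2; lra.
have iL := laplace_integrable P (mY n) (Y0 n) (ltW eta0).
have i1 : P.-integrable setT (EFin \o (fun=> 1 : R)).
  by apply: (@bounded_integrable _ _ _ _ _ 1) => // w; rewrite normr1.
rewrite [leRHS](_ : _ = \int[P]_w (1 - expR (- (eta * Y n w)))); last first.
  by rewrite RintegralB// Rintegral_prob_cst.
rewrite /tail -Rintegral_indic// mulrC -RintegralZl//; last first.
  apply: (@bounded_integrable _ _ _ _ _ 1); first exact: measurable_indic.
  by move=> w; rewrite indicE; case: (_ \in _); rewrite ?normr1 ?normr0.
apply: le_Rintegral => //.
- apply: (@bounded_integrable _ _ _ _ _ 2^-1).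
    by apply: measurable_funM => //; exact: measurable_indic.
  move=> w; rewrite indicE; case: (_ \in _); rewrite ?mulr1 ?mulr0 ?normr0 ?invr_ge0//.
  by rewrite gtr0_norm ?invr_gt0.
- exact: RintegrableB.
move=> w _; have /andP[k1 k2] := expRN_01 (mulr_ge0 (ltW eta0) (Y0 n w)).
rewrite indicE; have [|_] := boolP (w \in _); last by rewrite mulr0 subr_ge0.
rewrite inE/= => xw; rewrite mulr1.
have : expR (- (eta * Y n w)) <= 2^-1; last by lra.
rewrite expRN lef_pV2 ?posrE ?expR_gt0//.
apply: le_trans (expR_ge1Dx _).
have : 1 <= eta * Y n w by rewrite mulrC -ler_pdivrMr// ltW// (lt_trans xeta).
lra.
Unshelve. all: by end_near. Qed.

(** The tails are only known to be asymptotically above [G], and asymptotically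
below it after a shift.  Taking minima and maxima turns these one-sided bounds
into limits to which dominated convergence applies. *)
Let min_cvg (g : R) (u : nat -> R) :
  (forall e, 0 < e -> \forall n \near \oo, g <= u n + e) ->
  Num.min g (u n) @[n --> \oo] --> g.
Proof.
move=> gu; apply/cvgrPdist_le => e e0; have := gu _ e0; apply: filterS => n h.
have e0' : 0 < e :> R by [].
rewrite ler_norml; case: (leP g (u n)) => gun.
  by rewrite subrr oppr_le0 ltW.
by apply/andP; split; lra.
Qed.

Let max_cvg (g : R) (u : nat -> R) :
  (forall e, 0 < e -> \forall n \near \oo, u n <= g + e) ->
  Num.max g (u n) @[n --> \oo] --> g.
Proof.
move=> gu; apply/cvgrPdist_le => e e0; have := gu _ e0; apply: filterS => n h.
have e0' : 0 < e :> R by [].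
rewrite ler_norml; case: (leP g (u n)) => gun; last first.
  by rewrite subrr oppr_le0 ltW.
by apply/andP; split; lra.
Qed.

Let mG : measurable_fun (setT : set R) G.
Proof. by apply: nonincreasing_measurable => // x y; exact: G_ni. Qed.

Let iD (f : R -> R) : measurable_fun setT f -> (forall y, 0 <= f y <= 1) ->
  (expo R).-integrable D (EFin \o f).
Proof.
move=> mf f01; apply: measurable_bounded_integrable => //.
- by rewrite (le_lt_trans (probability_le1 _ _)) ?ltry.
- exact: measurable_funTS.
exists 1; split => // M M1 y _; have /andP[h0 h1] := f01 y.
by rewrite /= ger0_norm// (le_trans h1)// ltW.
Qed.

Let mscale (s c : R) : measurable_fun setT (fun y : R => (y + c) / s).
Proof. by apply: measurable_funM => //; exact: measurable_funD. Qed.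

(** The Laplace transform of the limit tail, from both sides; the shift by [r]
in the second half costs a factor exp r, removed by letting r tend to 0. *)
Let G_integral s : 0 < s -> \int[expo R]_(y in D) G (y / s) = 1 - L s.
Proof.
move=> s0; have [_ Y0 cY] := LY; apply/eqP; rewrite eq_le.
have mGs : measurable_fun setT (fun y : R => G (y / s)).
  by apply: (measurableT_comp mG); exact: measurable_funM.
have mts n c : measurable_fun setT (fun y : R => tail n ((y + c) / s)).
  by apply: (measurableT_comp (mtail n)); exact: mscale.
have scaleE n y : tail n (y / s) = fine (P [set w | y < s * Y n w]).
  congr (fine (P _)).
  by apply/seteqP; split => w /=; rewrite ltr_pdivrMr// mulrC.
have tail01 n y : 0 <= tail n y <= 1 by rewrite tail_ge0 tail_le1.
apply/andP; split.
- have [||||||_ H] := @Rdominated_cvg _ _ _ (expo R) D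
    (fun n y => Num.min (G (y / s)) (tail n ((y + 0) / s))) (fun y => G (y / s))
    (fun=> 1).
  + exact: mD.
  + by move=> n; apply: measurable_funTS; apply: measurable_minr => //; exact: mts.
  + exact: measurable_funTS.
  + by move=> y _; apply: min_cvg => e e0; rewrite addr0; exact: G_le_tail.
  + by apply: iD => // y; rewrite ler01 lexx.
  + move=> n y _; rewrite ger0_norm ?le_min ?ge_min.
      by have /andP[_ ->] := G01 (y / s).
    by have /andP[-> _] := G01 (y / s); rewrite tail_ge0.
  apply: (ler_cvg_to H (cvgB (cvg_cst (1 : R)) (cY s s0))).
  near=> n; have mV : measurable_fun setT (fun w => s * Y n w) by exact: measurable_funM.
  have := @laplace_tail R _ T P _ mV (fun w => mulr_ge0 (ltW s0) (Y0 n w)).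
  rewrite {1}/laplace; under eq_Rintegral do rewrite mul1r.
  move=> H2; rewrite [leRHS]H2.
  apply: le_Rintegral; first exact: mD.
  + apply: iD; first exact: measurable_minr.
    move=> y; rewrite le_min ge_min; have /andP[-> ->] := G01 (y / s).
    by rewrite tail_ge0.
  + apply: iD; last first.
      by move=> y; rewrite -scaleE.
    rewrite (_ : (fun y => _) = (fun y => tail n ((y + 0) / s)))//.
    by apply/funext => y; rewrite addr0 scaleE.
  move=> y _; rewrite ge_min addr0; apply/orP; right.
  by rewrite scaleE.
- have lim_le r : 0 < r -> 1 - expR r * L s <= \int[expo R]_(y in D) G (y / s).
    move=> r0.
    have [||||||_ H] := @Rdominated_cvg _ _ _ (expo R) D
      (fun n y => Num.max (G (y / s)) (tail n ((y + r) / s))) (fun y => G (y / s))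
      (fun=> 1).
    + exact: mD.
    + by move=> n; apply: measurable_funTS; apply: measurable_maxr => //; exact: mts.
    + exact: measurable_funTS.
    + move=> y _; apply: max_cvg => e e0; apply: tail_le_G => //.
      by rewrite ltr_pM2r ?invr_gt0// ltrDl.
    + by apply: iD => // y; rewrite ler01 lexx.
    + move=> n y _; rewrite ger0_norm ?le_max ?ge_max.
        by have /andP[_ ->] := G01 (y / s); rewrite tail_le1.
      by rewrite tail_ge0 orbT.
    apply: (ler_cvg_to (cvgB (cvg_cst (1 : R)) (cvgMr (cY s s0))) H).
    near=> n; pose V w := Num.max 0 (s * Y n w - r).
    have mV : measurable_fun setT V.
      apply: measurable_maxr => //; apply: measurable_funB => //.
      exact: measurable_funM.
    have V0 w : 0 <= V w by rewrite le_max lexx.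
    have := @laplace_tail R _ T P _ mV V0.
    have VE y : D y -> fine (P [set w | y < V w]) = tail n ((y + r) / s).
      rewrite /D/= in_itv/= andbT => y0; congr (fine (P _)).
      apply/seteqP; split => w /=.
        by rewrite lt_max ltNge (ltW y0)/= ltr_pdivrMr// mulrC ltrBrDr.
      by rewrite ltr_pdivrMr// mulrC /V lt_max ltrBrDr => ->; rewrite orbT.
    rewrite (@eq_Rintegral _ _ _ (expo R) D (fun y => tail n ((y + r) / s))); last first.
      by move=> y; rewrite inE; exact: VE.
    move=> HV; apply: (@le_trans _ _ (1 - laplace P V 1)).
      rewrite lerD2l lerN2 /laplace -RintegralZl//; last first.
        exact: laplace_integrable (ltW s0).
      apply: le_Rintegral => //.
      + exact: (laplace_integrable P mV V0 ler01).
      + by apply: RintegrableZl => //; exact: laplace_integrable (ltW s0).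
      move=> w _; rewrite -expRD ler_expR mul1r.
      have : s * Y n w - r <= V w by rewrite le_max lexx orbT.
      by rewrite lerBlDr; move: (V w) (s * Y n w) => v y; lra.
    rewrite HV; apply: le_Rintegral; first exact: mD.
    + by apply: iD => //; exact: mts.
    + apply: iD.
        by apply: measurable_maxr => //; exact: mts.
      move=> y; rewrite le_max tail_ge0 orbT ge_max tail_le1 andbT/=.
      by have /andP[] := G01 (y / s).
    by move=> y _; rewrite le_max lexx orbT.
  have : (1 - expR r * L s) @[r --> (0 : R)^'+] --> 1 - L s.
    rewrite -[X in _ --> _ - X]mul1r -(@expR0 R).
    apply: cvgB; first exact: cvg_cst.
    apply: cvgMl; apply: cvg_at_right_filter.
    exact: continuous_expR.
  move=> /cvgr_to_le; apply.
  by near=> r; apply: lim_le.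
Unshelve. all: by end_near. Qed.

(** The law with tail [G] is pushed forward by the positive part so that it charges
only the nonnegative numbers; its Laplace transform is [L], and
[laplace_method], applied to the constant sequence, identifies the limits of
expectations with integrals against it. *)
Theorem laplace_continuity : exists mu : probability R R,
  [/\ mu `]-oo, 0[%classic = 0%E,
      forall s : R, 0 < s -> \int[mu]_x expR (- (s * Num.max 0 x)) = L s &
      forall f : R -> R, continuous f -> (exists M, forall y, `|f y| <= M) ->
        \int[P]_w f (Y n w) @[n --> \oo] --> \int[mu]_x f x].
Proof.
have [mu0 mu0E] := law_of_tail G_ni G_rc G_neg G_cvgy.
pose V (x : R) := Num.max 0 x.
have mV : measurable_fun setT V by exact: measurable_maxr.
have V0 x : 0 <= V x by rewrite le_max lexx.
pose mu : probability R R := distribution mu0 (mfun_of mV).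
have muE (h : R -> R) (M : R) : measurable_fun setT h -> (forall z, `|h z| <= M) ->
    \int[mu]_x h x = \int[mu0]_x h (V x).
  by move=> mh hM; rewrite (law_ext mV (Q := mu) (M := M)).
have LV s : 0 < s -> laplace mu0 V s = L s.
  move=> s0; apply: (@addrI _ (-1)); apply: oppr_inj.
  rewrite !opprD !opprK -(G_integral s0).
  have mVs : measurable_fun setT (fun x => s * V x) by exact: measurable_funM.
  have := @laplace_tail R _ _ mu0 _ mVs (fun x => mulr_ge0 (ltW s0) (V0 x)).
  rewrite {1}/laplace; under eq_Rintegral do rewrite mul1r.
  rewrite -/(laplace mu0 V s) => ->; apply: eq_Rintegral => y.
  rewrite inE/= in_itv/= andbT => y0.
  rewrite (_ : [set w | _] = `]y / s, +oo[%classic) ?mu0E//.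
  apply/seteqP; split => w /=; rewrite in_itv/= andbT ltr_pdivrMr// mulrC /V.
    by case: (leP 0 w) => // _; rewrite mul0r ltNge (ltW y0).
  by move=> h; apply: lt_le_trans h _; rewrite ler_wpM2l ?(ltW s0)// le_max lexx orbT.
have LmuV : laplace_cvg L mu0 (fun=> V) by exact: laplace_cvg_cst.
exists mu; split.
- rewrite -(measure0 mu0); congr (mu0 _).
  by apply/seteqP; split => x//=; rewrite in_itv/= ltNge V0.
- move=> s s0; rewrite -(LV s s0).
  apply: (@eq_trans _ _ (\int[mu0]_x expR (- (s * Num.max 0 (V x))))).
    apply: (muE _ 1).
      apply: measurable_expRN; apply: measurable_funM => //.
    move=> z; have /andP[h1 h2] := expRN_01 (mulr_ge0 (ltW s0) (V0 z)).
    by rewrite ger0_norm.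
  by apply: eq_Rintegral => x _; rewrite (max_r (V0 x)).
- move=> f cf [M fM].
  have [c hc] := laplace_method cf fM L1.
  have h1 := hc _ _ _ _ LY; have h2 := hc _ _ _ _ LmuV.
  rewrite (muE f M)//; last exact: continuous_measurable_fun.
  have -> : \int[mu0]_x f (V x) = c; last exact: h1.
  by apply: (cvg_unique _ _ h2) => //; exact: cvg_cst.
Qed.

End limit_law.

(** * The generating function of the partial sums *)

Section unit_functions.
Context d (T : measurableType d) (R : realType) (P : probability T R).
Implicit Types f g : T -> R.

(** Survival probabilities and generating functions all take values in the unit
interval; bundling this with measurability makes integrability automatic. *)
Definition unit_fun f := measurable_fun setT f /\ forall w, 0 <= f w <= 1.

Lemma unit_integrable f : unit_fun f -> P.-integrable setT (EFin \o f).
Proof.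
move=> [mf f01]; apply: (@bounded_integrable _ _ _ _ _ 1) => // w.
by have /andP[h0 h1] := f01 w; rewrite ger0_norm.
Qed.

Lemma unit_cst (a : R) : 0 <= a <= 1 -> unit_fun (fun=> a).
Proof. by move=> a01; split => //; exact: measurable_cst. Qed.

Lemma unit_mul f g : unit_fun f -> unit_fun g -> unit_fun (fun w => f w * g w).
Proof.
move=> [mf f01] [mg g01]; split; first exact: measurable_funM.
move=> w; have /andP[f0 f1] := f01 w; have /andP[g0 g1] := g01 w.
by rewrite mulr_ge0// mulr_ile1.
Qed.

Lemma unit_exp f k : unit_fun f -> unit_fun (fun w => f w ^+ k).
Proof.
move=> [mf f01]; split; first exact: measurable_funX.
by move=> w; have /andP[f0 f1] := f01 w; rewrite exprn_ge0// exprn_ile1.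
Qed.

Lemma unit_onem f : unit_fun f -> unit_fun (fun w => 1 - f w).
Proof.
move=> [mf f01]; split; first exact: measurable_funB.
by move=> w; have /andP[f0 f1] := f01 w; rewrite subr_ge0 f1 gerBl.
Qed.

Lemma unit_prod (I : Type) (s : seq I) (F : I -> T -> R) :
  (forall i, unit_fun (F i)) -> unit_fun (fun w => \prod_(i <- s) F i w).
Proof.
move=> uF; elim: s => [|i s IH].
  rewrite (_ : (fun w => _) = fun=> 1); first by apply: unit_cst; rewrite ler01 lexx.
  by apply/funext => w; rewrite big_nil.
rewrite (_ : (fun w => _) = (fun w => F i w * \prod_(j <- s) F j w)).
  exact: unit_mul.
by apply/funext => w; rewrite big_cons.
Qed.

Lemma unit_bool (A : T -> bool) : measurable [set w | A w] ->
  unit_fun (fun w => (A w)%:R).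
Proof.
move=> mA; split; last by move=> w; case: (A w); rewrite ?ler01 ?lexx.
rewrite (_ : (fun w => _) = \1_[set w | A w]); first exact: measurable_indic.
by apply/funext => w; rewrite indicE; congr (nat_of_bool _)%:R; apply/idP/idP; rewrite inE.
Qed.

Lemma measurable_select d' (T' : measurableType d') (N : T -> nat) (f : nat -> T -> T') :
  measurable_fun setT N -> (forall n, measurable_fun setT (f n)) ->
  measurable_fun setT (fun w => f (N w) w).
Proof.
move=> mN mf _ U mU; rewrite setTI.
rewrite (_ : _ @^-1` _ = \bigcup_n (N @^-1` [set n] `&` f n @^-1` U)).
  apply: bigcupT_measurable => n; apply: measurableI.
    by rewrite -[X in measurable X]setTI; exact: mN.
  by rewrite -[X in measurable X]setTI; exact: mf.
apply/seteqP; split => w /=; first by move=> h; exists (N w).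
by move=> [n _ [/= ->]].
Qed.

Lemma Rintegral_sum (I : Type) (s : seq I) (F : I -> T -> R) :
  (forall i, P.-integrable setT (EFin \o F i)) ->
  \int[P]_w (\sum_(i <- s) F i w) = \sum_(i <- s) \int[P]_w F i w.
Proof.
move=> iF; have is_ r : P.-integrable setT (EFin \o (fun w => \sum_(i <- r) F i w)).
  elim: r => [|i r IH].
    rewrite (_ : _ \o _ = EFin \o (fun=> 0)).
      by apply: unit_integrable; apply: unit_cst; rewrite lexx ler01.
    by apply/funext => w /=; rewrite big_nil.
  rewrite (_ : _ \o _ = EFin \o (fun w => F i w + \sum_(j <- r) F j w)).
    exact: RintegrableD.
  by apply/funext => w /=; rewrite big_cons.
elim: s => [|i s IH].
  rewrite big_nil -[RHS](Rintegral_prob_cst P).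
  by apply: eq_Rintegral => w _; rewrite big_nil.
rewrite big_cons -IH -RintegralD//.
by apply: eq_Rintegral => w _; rewrite big_cons.
Qed.

Lemma Rintegral_bool (A : T -> bool) : measurable [set w | A w] ->
  \int[P]_w (A w)%:R = fine (P [set w | A w]).
Proof.
move=> mA; rewrite -Rintegral_indic//; apply: eq_Rintegral => w _.
by rewrite indicE; congr (nat_of_bool _)%:R; apply/idP/idP; rewrite inE.
Qed.

Lemma measurable_all (I : Type) (s : seq I) (A : I -> T -> bool) :
  (forall i, measurable [set w | A i w]) ->
  measurable [set w | all (fun i => A i w) s].
Proof.
move=> mA; elim: s => [|i s IH] /=.
  by rewrite (_ : [set w | _] = setT)//; apply/seteqP.
rewrite (_ : [set w | _] = [set w | A i w] `&` [set w | all (fun i => A i w) s]).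
  exact: measurableI.
by apply/seteqP; split => w /= => [/andP[]|[-> ->]].
Qed.

Lemma measurable_val_eq d' (T' : measurableType d') (f : T -> T') (x : T') :
  measurable_fun setT f -> measurable [set x] -> measurable [set w | f w = x].
Proof.
move=> mf mx; rewrite (_ : [set w | _] = setT `&` f @^-1` [set x]).
  exact: (mf measurableT).
by rewrite setTI.
Qed.

Lemma measurable_nat_comp d' (T' : measurableType d') (g : nat -> T') (f : T -> nat) :
  measurable_fun setT f -> measurable_fun setT (g \o f).
Proof. by move=> mf; apply: measurableT_comp => // _ U _; rewrite setTI. Qed.

Lemma measurable_bool_nat (f : T -> bool) :
  measurable_fun setT f -> measurable_fun setT (fun w => f w : nat).
Proof.
by move=> mf; apply: (@measurableT_comp _ _ _ _ _ _ nat_of_bool) => // _ U _.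
Qed.

Lemma measurable_addn (f g : T -> nat) : measurable_fun setT f ->
  measurable_fun setT g -> measurable_fun setT (fun w => (f w + g w)%N).
Proof.
move=> mf mg; apply: (@measurable_select _ _ f (fun n w => (n + g w)%N)) => // n.
exact: (measurable_nat_comp (addn n)).
Qed.

Lemma measurable_sumn (I : Type) (s : seq I) (f : I -> T -> nat) :
  (forall i, measurable_fun setT (f i)) ->
  measurable_fun setT (fun w => \sum_(i <- s) f i w)%N.
Proof.
move=> mf; elim: s => [|i s IH].
  rewrite (_ : (fun w => _) = fun=> 0%N); first exact: measurable_cst.
  by apply/funext => w; rewrite big_nil.
rewrite (_ : (fun w => _) = fun w => (f i w + \sum_(i <- s) f i w)%N).
  exact: measurable_addn.
by apply/funext => w; rewrite big_cons.
Qed.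

Lemma unit_select (N : T -> nat) (f : nat -> T -> R) :
  measurable_fun setT N -> (forall n, unit_fun (f n)) ->
  unit_fun (fun w => f (N w) w).
Proof.
move=> mN uf; split; last by move=> w; case: (uf (N w)).
by apply: measurable_select => // n; case: (uf n).
Qed.

End unit_functions.

Lemma uniq_unzip1_inj (K V : eqType) (c : seq (K * V)) i b b' :
  uniq (unzip1 c) -> (i, b) \in c -> (i, b') \in c -> b = b'.
Proof.
elim: c => //= -[k v] c IH /andP[kc uc]; rewrite !inE.
move=> /orP[/eqP[ik bv]|ib] /orP[/eqP[ik' bv']|ib']; last exact: IH.
- by rewrite bv bv'.
- by case/negP: kc; apply/mapP; exists (i, b').
- by case/negP: kc; apply/mapP; exists (i, b).
Qed.

Section exact_formula.
Context (R : realType) d (T : measurableType d) (P : probability T R).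
Variables (phi : int -> {RV P >-> R}) (Z : int -> {RV P >-> nat})
  (B : int -> int -> {RV P >-> bool}).
Hypothesis model : rcinar_model phi Z B.

(** Cylinder events fixing finitely many of the [B] and of the [Z], given by lists
of indices and values; [wgt] is the conditional probability, given the
environment, of one prescribed value of [B]. *)
Let cylB (c : seq ((int * int) * bool)) w : bool :=
  all (fun x => B x.1.1 x.1.2 w == x.2) c.
Let cylZ (e : seq (int * nat)) w : bool := all (fun x => Z x.1 w == x.2) e.
Let wgt (x : (int * int) * bool) w : R :=
  if x.2 then phi x.1.1 w else 1 - phi x.1.1 w.
Let p i : R := fine (P (Z 0 @^-1` [set i])).

Let cylB_prob c : uniq (unzip1 c) ->
  fine (P [set w | cylB c w]) = \int[P]_w \prod_(x <- c) wgt x w.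
Proof.
move=> uc.
pose J : {fset (int * int)} := [fset i in unzip1 c]%fset.
pose U (i : int * int) : set bool := [set b | (i, b) \in c].
pose f (i : int * int) w : R := wgt (i, (i, true) \in c) w.
have val i b : (i, b) \in c -> ((i, true) \in c) = b.
  move=> ibc; case: b ibc => // ibc; apply/negP => itc.
  by have := uniq_unzip1_inj uc itc ibc.
have [||_ _ H] := B_cond_indep model (J := J) (U := U) (f := f).
- by move=> i; exact: I.
- move=> i; rewrite inE/= => /mapP[[i' b] ibc ->/=].
  rewrite /f (val _ _ ibc) /wgt/=.
  rewrite (_ : U i' = [set b]).
    by case: b {ibc}; [exact: (B_true model)|exact: (B_false model)].
  apply/seteqP; split => b' /=; last by move=> ->.
  by move=> /val h; rewrite -h (val _ _ ibc).
have mT : <<s \bigcup_i preimage_set_system setT (phi i) measurable >> setT.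
  exact: (@measurableT _ (g_sigma_algebraType _)).
have := H _ mT; rewrite setIT => HP.
have -> : [set w | cylB c w] = \bigcap_(i in [set` J]) (B i.1 i.2 @^-1` U i).
  apply/seteqP; split => w /=.
    move=> /allP cw i/=; rewrite inE/= => /mapP[[i' b] ibc ->/=].
    by have /eqP/= := cw _ ibc; rewrite /U/= => ->.
  move=> cw; apply/allP => -[i b] ibc /=.
  have /= := cw i; rewrite inE/= => /(_ (map_f fst ibc)).
  by rewrite /U/= => /(uniq_unzip1_inj uc ibc) ->.
rewrite -HP /Rintegral; congr fine; apply: eq_integral => w _; congr EFin.
rewrite (perm_big (unzip1 c)); last first.
  apply: uniq_perm => //; first exact: fset_uniq.
  by move=> i; rewrite !inE.
rewrite big_map big_seq [RHS]big_seq; apply: eq_bigr => -[i b] ibc.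
by rewrite /f (val _ _ ibc).
Qed.

Let cylZ_prob e : uniq (unzip1 e) ->
  fine (P [set w | cylZ e w]) = \prod_(x <- e) p x.2.
Proof.
move=> ue.
pose J : {fset int} := [fset i in unzip1 e]%fset.
pose U (i : int) : set nat := [set b | (i, b) \in e].
have [H Hid] := Z_iid model.
have := H J U (fun i => I).
have -> : \bigcap_(i in [set` J]) (Z i @^-1` U i) = [set w | cylZ e w].
  apply/seteqP; split => w /=; last first.
    move=> /allP cw i/=; rewrite inE/= => /mapP[[i' b] ibc ->/=].
    by have /eqP/= := cw _ ibc; rewrite /U/= => ->.
  move=> cw; apply/allP => -[i b] ibc /=.
  have /= := cw i; rewrite inE/= => /(_ (map_f fst ibc)).
  by rewrite /U/= => /(uniq_unzip1_inj ue ibc) ->.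
move=> ->; rewrite (perm_big (unzip1 e)); last first.
  apply: uniq_perm => //; first exact: fset_uniq.
  by move=> i; rewrite !inE.
have pE x : (P (Z 0 @^-1` [set x]) = (p x)%:E)%E.
  by rewrite fineK// fin_num_measure// -[X in measurable X]setTI; exact: measurable_funP.
rewrite big_map big_seq (eq_bigr (fun x => (p x.2)%:E)); last first.
  move=> -[i b] ibc/=; rewrite -pE -(Hid i 0 [set b] I); congr (P _).
  apply/seteqP; split => w /=; rewrite /U/=; last by move=> ->.
  by move=> /(uniq_unzip1_inj ue ibc) ->.
rewrite -big_seq; elim: e {ue J U H} => [|x e IH]; first by rewrite !big_nil.
by rewrite !big_cons fineM ?IH//; elim/big_rec: _ => // y z _; exact: fin_numM.
Qed.

Let cylB_sigma c : <<s sigma_family phi `|` sigma_family (fun nk => B nk.1 nk.2) >>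
  [set w | cylB c w].
Proof.
set F := (X in <<s X >>).
elim: c => [|x c IH].
  rewrite (_ : [set w | _] = setT); first exact: (@measurableT _ (g_sigma_algebraType F)).
  by apply/seteqP.
rewrite (_ : [set w | _] = B x.1.1 x.1.2 @^-1` [set x.2] `&` [set w | cylB c w]).
  apply: (@measurableI _ (g_sigma_algebraType F)) => //.
  apply: sub_sigma_algebra; right; apply: sub_sigma_algebra.
  by exists x.1 => //; exists [set x.2] => //; rewrite setTI.
apply/seteqP; split => w /=; first by move=> /andP[/eqP].
by move=> [-> ->]; rewrite eqxx.
Qed.

Let cylZ_sigma e : sigma_family Z [set w | cylZ e w].
Proof.
rewrite /sigma_family; set F := (X in <<s X >>).
elim: e => [|x e IH].
  rewrite (_ : [set w | _] = setT); first exact: (@measurableT _ (g_sigma_algebraType F)).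
  by apply/seteqP.
rewrite (_ : [set w | _] = Z x.1 @^-1` [set x.2] `&` [set w | cylZ e w]).
  apply: (@measurableI _ (g_sigma_algebraType F)) => //.
  apply: sub_sigma_algebra.
  by exists x.1 => //; exists [set x.2] => //; rewrite setTI.
apply/seteqP; split => w /=; first by move=> /andP[/eqP].
by move=> [-> ->]; rewrite eqxx.
Qed.

Let mB i k b : measurable [set w | B i k w == b].
Proof.
rewrite (_ : [set w | _] = [set w | B i k w = b]); first exact: (measurable_val_eq (measurable_funP _)).
by apply/seteqP; split => w /= => [/eqP|->].
Qed.

Let mZ i b : measurable [set w | Z i w == b].
Proof.
rewrite (_ : [set w | _] = [set w | Z i w = b]); first exact: (measurable_val_eq (measurable_funP _)).
by apply/seteqP; split => w /= => [/eqP|->].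
Qed.

Let mcylB c : measurable [set w | cylB c w].
Proof. by apply: measurable_all => x; exact: mB. Qed.

Let mcylZ e : measurable [set w | cylZ e w].
Proof. by apply: measurable_all => x; exact: mZ. Qed.

(** The elementary joint law of the model: the three independence hypotheses enter
the proof only through this formula. *)
Let cyl_prob c e : uniq (unzip1 c) -> uniq (unzip1 e) ->
  \int[P]_w ((cylB c w)%:R * (cylZ e w)%:R) =
  (\int[P]_w \prod_(x <- c) wgt x w) * \prod_(x <- e) p x.2.
Proof.
move=> uc ue; rewrite -cylB_prob// -cylZ_prob// -fineM ?fin_num_measure//.
rewrite -(Z_indep_phi_B model (cylB_sigma c) (cylZ_sigma e)).
rewrite -(_ : [set w | cylB c w && cylZ e w] = _ `&` _); last first.
  by apply/seteqP; split => w /= => [/andP[]|[-> ->]].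
rewrite -Rintegral_bool.
  by apply: eq_Rintegral => w _; case: (cylB c w); case: (cylZ e w); rewrite ?mulr0 ?mulr1.
rewrite (_ : [set w | _] = [set w | cylB c w] `&` [set w | cylZ e w]).
  by apply: measurableI; [exact: mcylB|exact: mcylZ].
by apply/seteqP; split => w /= => [/andP[]|[-> ->]].
Qed.

Variables (q : R) (q01 : 0 <= q <= 1).

(** q^(X_(j+1) + ... + X_(j+m)) for the process started from [x] at time [j],
on the event that the [m] arrivals are less than [M].  The truncation makes the
sum over the possible values of the arrivals finite. *)
Fixpoint trunc_gf (M m j x : nat) (w : T) : R :=
  if m is m'.+1 then
    (Z j.+1 w < M)%N%:R * q ^+ (\sum_(1 <= k < x.+1) B j.+1 k w + Z j.+1 w) *
    trunc_gf M m' j.+1 (\sum_(1 <= k < x.+1) B j.+1 k w + Z j.+1 w)%N w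
  else 1.

(** For one individual present at time [j], the conditional mean given the
environment of [q] to the number of times j + 1, ..., j + m at which it is still
present. *)
Fixpoint thinning (m j : nat) (w : T) : R :=
  if m is m'.+1 then
    1 - phi j.+1 w + phi j.+1 w * (q * thinning m' j.+1 w)
  else 1.

Definition trunc_pgf M (u : R) : R := \sum_(0 <= i < M) p i * u ^+ i.

Fixpoint pgf_prod (Psi : R -> R) (m j : nat) (w : T) : R :=
  if m is m'.+1 then
    Psi (q * thinning m' j.+1 w) * pgf_prod Psi m' j.+1 w
  else 1.

Let mphi i : measurable_fun setT (phi i). Proof. exact: measurable_funP. Qed.

Let unit_phi i : unit_fun (phi i).
Proof. by split; [exact: mphi|exact: (phi_01 model)]. Qed.

Lemma unit_thinning m j : unit_fun (thinning m j).
Proof.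
elim: m j => [|m IH] j; first by apply: unit_cst; rewrite ler01 lexx.
have uq : unit_fun (fun w => q * thinning m j.+1 w).
  by apply: unit_mul => //; exact: unit_cst.
rewrite (_ : thinning m.+1 j =
    fun w => 1 - phi j.+1 w * (1 - q * thinning m j.+1 w)).
  by apply: unit_onem; apply: unit_mul => //; exact: unit_onem.
by apply/funext => w /=; ring.
Qed.

Lemma unit_qthinning m j : unit_fun (fun w => q * thinning m j w).
Proof. by apply: unit_mul; [exact: unit_cst|exact: unit_thinning]. Qed.

Let p_ge0 i : 0 <= p i. Proof. exact: fine_ge0. Qed.

Let unit_wgt x : unit_fun (wgt x).
Proof. by rewrite /wgt; case: x => k [] /=; [|exact: unit_onem]. Qed.

Let unit_nat i (A : nat -> bool) : unit_fun (fun w => (A (Z i w))%:R : R).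
Proof.
apply: unit_bool; rewrite (_ : [set w | _] = [set w | (A \o Z i) w = true]).
  by apply: measurable_val_eq => //; exact: measurable_nat_comp.
by apply/seteqP; split.
Qed.

Let unit_powZ i (u : R) : 0 <= u <= 1 -> unit_fun (fun w => u ^+ Z i w).
Proof.
move=> u01; apply: (unit_select (N := Z i) (f := fun n _ => u ^+ n)) => // n.
by apply: unit_exp; exact: unit_cst.
Qed.

Let unit_trunc M (u : R) : 0 <= u <= 1 ->
  unit_fun (fun w => (Z 0 w < M)%N%:R * u ^+ Z 0 w : R).
Proof.
move=> u01; apply: unit_mul; last exact: unit_powZ.
exact: (@unit_nat 0 (fun n => n < M)%N).
Qed.

Lemma trunc_sum M i (F : nat -> R) w : (Z i w < M)%N%:R * F (Z i w) =
  \sum_(0 <= k < M) (Z i w == k)%:R * F k.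
Proof.
have [zM|zM] := ltnP (Z i w) M.
  rewrite mul1r big_mkord (bigD1 (Ordinal zM))//= eqxx mul1r big1 ?addr0// => k kz.
  by rewrite (_ : (_ == _) = false) ?mul0r//; apply/negbTE; rewrite eq_sym.
rewrite mul0r big_nat_cond big1// => k; rewrite andbT => /andP[_ kM].
by rewrite (_ : (_ == _) = false) ?mul0r//; apply/negbTE; rewrite gtn_eqF// (leq_trans kM).
Qed.

Lemma trunc_pgfE M (u : R) : 0 <= u <= 1 ->
  trunc_pgf M u = \int[P]_w ((Z 0 w < M)%N%:R * u ^+ Z 0 w).
Proof.
move=> u01; under eq_Rintegral do rewrite trunc_sum.
have u1 k : unit_fun (fun w => (Z 0 w == k)%:R : R) by exact: (@unit_nat 0 (eq_op^~ k)).
rewrite Rintegral_sum => [|k]; last first.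
  apply: unit_integrable; apply: unit_mul => //.
  by apply: unit_exp; exact: unit_cst.
apply: eq_bigr => k _; rewrite RintegralZr; last exact: unit_integrable.
rewrite Rintegral_bool//; congr (fine (P _) * _).
by apply/seteqP; split => w /= => [->|/eqP].
by [].
Qed.

Lemma trunc_pgf01 M (u : R) : 0 <= u <= 1 -> 0 <= trunc_pgf M u <= 1.
Proof.
move=> u01; have /andP[u0 u1] := u01; apply/andP; split.
  by apply: sumr_ge0 => i _; rewrite mulr_ge0// exprn_ge0.
rewrite trunc_pgfE// -[leRHS](Rintegral_prob_cst P); apply: le_Rintegral => //.
- exact/unit_integrable/unit_trunc.
- by apply: unit_integrable; apply: unit_cst; rewrite ler01 lexx.
by move=> w _; have [_ /(_ w)/andP[]] := unit_trunc M u01.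
Qed.

Lemma unit_trunc_pgf M f : unit_fun f -> unit_fun (fun w : T => trunc_pgf M (f w)).
Proof.
move=> uf; split; last by move=> w; apply: trunc_pgf01; case: uf.
rewrite /trunc_pgf; apply: measurable_sum => i; apply: measurable_funM => //.
by apply: measurable_funX; case: uf.
Qed.

Let unit_pgf_prod M m j : unit_fun (pgf_prod (trunc_pgf M) m j).
Proof.
elim: m j => [|m IH] j; first by apply: unit_cst; rewrite ler01 lexx.
by apply: unit_mul => //; apply: unit_trunc_pgf; exact: unit_qthinning.
Qed.

Let arrive M m j (y : nat) w : R := (Z j.+1 w < M)%N%:R * q ^+ (y + Z j.+1 w) *
  trunc_gf M m j.+1 (y + Z j.+1 w)%N w.

Let trunc_gfS M m j x w : trunc_gf M m.+1 j x w =
  arrive M m j (\sum_(1 <= k < x.+1) B j.+1 k w)%N w.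
Proof. by []. Qed.

Let mZ' i : measurable_fun setT (Z i). Proof. exact: measurable_funP. Qed.

Let unit_arrive_of M m j y : (forall x, unit_fun (trunc_gf M m j.+1 x)) ->
  unit_fun (arrive M m j y).
Proof.
move=> IH; apply: unit_mul.
  apply: unit_mul; first exact: (@unit_nat j.+1 (fun n => n < M)%N).
  apply: (unit_select (N := fun w => (y + Z j.+1 w)%N) (f := fun n _ => q ^+ n)).
    exact: (measurable_nat_comp (addn y)).
  by move=> n; apply: unit_exp; exact: unit_cst.
by apply: unit_select => //; exact: (measurable_nat_comp (addn y)).
Qed.

Let unit_trunc_gf M m j x : unit_fun (trunc_gf M m j x).
Proof.
elim: m j x => [|m IH] j x; first by apply: unit_cst; rewrite ler01 lexx.
rewrite (_ : trunc_gf M m.+1 j x = fun w =>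
  arrive M m j (\sum_(1 <= k < x.+1) B j.+1 k w)%N w)//.
apply: unit_select; last by move=> y; exact: unit_arrive_of.
apply: measurable_sumn => k; apply: measurable_bool_nat; exact: measurable_funP.
Qed.

Let unit_arrive M m j y : unit_fun (arrive M m j y).
Proof. exact: unit_arrive_of. Qed.

Let cyl c e w : R := (cylB c w)%:R * (cylZ e w)%:R.
Let W c w : R := \prod_(x <- c) wgt x w.

Let unit_cyl c e : unit_fun (cyl c e).
Proof. by apply: unit_mul; apply: unit_bool. Qed.

Let unit_W c : unit_fun (W c).
Proof. exact: unit_prod. Qed.

(** Decision-tree form of the formula, by induction on the number [m] of steps: the
event is any cylinder that involves the past of time [j] only, so that the [B]
and [Z] of the next step can be revealed one at a time and added to it. *)
Let claim M m := forall j x c e,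
  uniq (unzip1 c) -> uniq (unzip1 e) ->
  all (fun y => y.1.1 <= j%:Z) c -> all (fun y => y.1 <= j%:Z) e ->
  \int[P]_w (cyl c e w * trunc_gf M m j x w) =
  (\int[P]_w (W c w * (pgf_prod (trunc_pgf M) m j w * thinning m j w ^+ x))) *
  \prod_(x <- e) p x.2.

(** Revealing the arrival at time j + 1 sums the generating function of [Z]. *)
Let arrival_step M m j y c e : claim M m ->
  uniq (unzip1 c) -> uniq (unzip1 e) ->
  all (fun y => y.1.1 <= j.+1%:Z) c -> all (fun y => y.1 <= j%:Z) e ->
  \int[P]_w (cyl c e w * arrive M m j y w) =
  (\int[P]_w (W c w * (pgf_prod (trunc_pgf M) m.+1 j w *
     (q * thinning m j.+1 w) ^+ y))) * \prod_(x <- e) p x.2.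
Proof.
move=> IH uc ue cj ej.
have ue' k : uniq (unzip1 ((j.+1%:Z, k) :: e)).
  rewrite /= ue andbT; apply/mapP => -[[i b] ie /= ji].
  by have := allP ej _ ie; rewrite /= -ji lez_nat ltnn.
have ej' k : all (fun y => y.1 <= j.+1%:Z) ((j.+1%:Z, k) :: e).
  rewrite /= lexx/=; apply/allP => z /(allP ej) h.
  by apply: le_trans h _; rewrite lez_nat.
transitivity (\int[P]_w \sum_(0 <= k < M)
    (q ^+ (y + k) * (cyl c ((j.+1%:Z, k) :: e) w * trunc_gf M m j.+1 (y + k) w))).
  apply: eq_Rintegral => w _.
  rewrite /arrive -mulrA (trunc_sum M j.+1 (fun k => q ^+ (y + k) * trunc_gf M m j.+1 (y + k) w)).
  rewrite mulr_sumr; apply: eq_bigr => k _; rewrite /cyl /cylZ /=.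
  by case: (_ == _); rewrite ?mulr0 ?mul0r ?mulr0// !mul1r; ring.
have uu k : unit_fun (fun w => cyl c ((j.+1%:Z, k) :: e) w * trunc_gf M m j.+1 (y + k) w).
  exact: unit_mul.
rewrite Rintegral_sum => [|k]; last first.
  by apply: unit_integrable; apply: unit_mul => //; apply: unit_exp; exact: unit_cst.
have uR k : unit_fun (fun w => W c w * (pgf_prod (trunc_pgf M) m j.+1 w *
    thinning m j.+1 w ^+ (y + k))).
  apply: unit_mul => //; apply: unit_mul => //; apply: unit_exp; exact: unit_thinning.
transitivity (\sum_(0 <= k < M) q ^+ (y + k) * (\int[P]_w
    (W c w * (pgf_prod (trunc_pgf M) m j.+1 w * thinning m j.+1 w ^+ (y + k)))) *
    (p k * \prod_(x <- e) p x.2)).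
  apply: eq_bigr => k _; rewrite RintegralZl//; last exact: unit_integrable.
  have h := IH j.+1 (y + k)%N c ((j.+1%:Z, k) :: e) uc (ue' k) cj (ej' k).
  by rewrite h big_cons; ring.
transitivity ((\int[P]_w \sum_(0 <= k < M) (q ^+ (y + k) * p k) *
    (W c w * (pgf_prod (trunc_pgf M) m j.+1 w * thinning m j.+1 w ^+ (y + k)))) *
    \prod_(x <- e) p x.2).
  rewrite Rintegral_sum => [|k]; last by apply: RintegrableZl => //; exact: unit_integrable.
  rewrite mulr_suml; apply: eq_bigr => k _.
  rewrite RintegralZl//; last exact: unit_integrable.
  by ring.
congr (_ * _); apply: eq_Rintegral => w _ /=.
rewrite [RHS](_ : _ = trunc_pgf M (q * thinning m j.+1 w) * (W c w *
    (pgf_prod (trunc_pgf M) m j.+1 w * (q * thinning m j.+1 w) ^+ y))); last by ring.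
rewrite /trunc_pgf mulr_suml; apply: eq_bigr => k _.
by rewrite !exprMn !exprD; ring.
Qed.

(** Revealing the [B] of time j + 1 one by one: each contributes a factor
[thinning], whether it is true or false. *)
Let bit_step M m j r y k c e : claim M m ->
  uniq (unzip1 c) -> uniq (unzip1 e) ->
  all (fun y => (y.1.1 <= j%:Z) || (y.1.1 == j.+1%:Z) && (y.1.2 <= k%:Z)) c ->
  all (fun y => y.1 <= j%:Z) e ->
  \int[P]_w (cyl c e w *
     arrive M m j (y + \sum_(k.+1 <= l < k.+1 + r) B j.+1 l w)%N w) =
  (\int[P]_w (W c w * (pgf_prod (trunc_pgf M) m.+1 j w *
     (q * thinning m j.+1 w) ^+ y * thinning m.+1 j w ^+ r))) * \prod_(x <- e) p x.2.
Proof.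
move=> IH + ue + ej; elim: r k y c => [|r IHr] k y c uc ck.
  transitivity (\int[P]_w (cyl c e w * arrive M m j y w)).
    by apply: eq_Rintegral => w _; rewrite addn0 big_geq// addn0.
  rewrite arrival_step//.
    by congr (_ * _); apply: eq_Rintegral => w _; rewrite expr0 mulr1.
  apply/allP => z /(allP ck) /orP[h|/andP[/eqP -> _]]//.
  by apply: le_trans h _; rewrite lez_nat.
pose i0 : int * int := (j.+1%:Z, k.+1%:Z).
have i0c : i0 \notin unzip1 c.
  apply/mapP => -[[i b] ic /= ii0]; have /= := allP ck _ ic.
  by rewrite -ii0 /i0/= eqxx/= !lez_nat !ltnn.
have ck' b : all (fun y => (y.1.1 <= j%:Z) || (y.1.1 == j.+1%:Z) && (y.1.2 <= k.+1%:Z))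
    ((i0, b) :: c).
  rewrite /= eqxx lexx orbT/=; apply/allP => z /(allP ck) /orP[->//|/andP[-> h]].
  by rewrite (le_trans h) ?orbT// lez_nat.
have uc' b : uniq (unzip1 ((i0, b) :: c)) by rewrite /= i0c.
pose g b w := cyl ((i0, b) :: c) e w *
  arrive M m j ((y + b) + \sum_(k.+2 <= l < k.+2 + r) B j.+1 l w)%N w.
have ug b : unit_fun (g b).
  apply: unit_mul => //; apply: (unit_select _ (unit_arrive M m j)).
  apply: measurable_addn; first exact: measurable_cst.
  by apply: measurable_sumn => l; apply: measurable_bool_nat; exact: measurable_funP.
transitivity (\int[P]_w (g true w + g false w)).
  apply: eq_Rintegral => w _; rewrite /g addnS big_ltn; last by rewrite addSn ltnS leq_addr.
  rewrite addSn -addSn addnA /cyl /cylB /=.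
  by case: (B _ _ w); rewrite ?mul0r ?add0r ?addr0 ?addn0.
rewrite RintegralD//; [|exact: unit_integrable|exact: unit_integrable].
rewrite /g (IHr k.+1 (y + true)%N)// (IHr k.+1 (y + false)%N)// -mulrDl; congr (_ * _).
have uV b : unit_fun (fun w => W ((i0, b) :: c) w * (pgf_prod (trunc_pgf M) m.+1 j w *
     (q * thinning m j.+1 w) ^+ (y + b) * thinning m.+1 j w ^+ r)).
  apply: unit_mul => //; apply: unit_mul; last by apply: unit_exp; exact: unit_thinning.
  by apply: unit_mul => //; apply: unit_exp; exact: unit_qthinning.
rewrite -RintegralD//; [|exact: unit_integrable|exact: unit_integrable].
apply: eq_Rintegral => w _; rewrite /W !big_cons /wgt /= addn0 addn1 !exprS; ring.
Qed.

Let claim_all M m : claim M m.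
Proof.
elim: m => [|m IH] j x c e uc ue cj ej.
  transitivity (\int[P]_w (cyl c e w)).
    by apply: eq_Rintegral => w _; rewrite mulr1.
  rewrite cyl_prob//; congr (_ * _); apply: eq_Rintegral => w _ /=.
  by rewrite expr1n !mulr1.
transitivity (\int[P]_w (cyl c e w *
     arrive M m j (0 + \sum_(1 <= l < 1 + x) B j.+1 l w)%N w)).
  by apply: eq_Rintegral => w _.
rewrite (@bit_step M m j x 0 0 c e)//.
  by congr (_ * _); apply: eq_Rintegral => w _; rewrite expr0 mulr1.
by apply/allP => z /(allP cj) ->.
Qed.

Lemma trunc_gf_mean M n :
  \int[P]_w trunc_gf M n 0 0 w = \int[P]_w pgf_prod (trunc_pgf M) n 0 w.
Proof.
have := @claim_all M n 0 0 [::] [::] isT isT isT isT.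
rewrite big_nil mulr1 => H.
transitivity (\int[P]_w (cyl [::] [::] w * trunc_gf M n 0 0 w)).
  by apply: eq_Rintegral => w _; rewrite /cyl /= !mul1r.
by rewrite H; apply: eq_Rintegral => w _; rewrite /W big_nil expr0 mulr1 mul1r.
Qed.

Definition pgf (u : R) : R := \int[P]_w (u ^+ Z 0 w).

Lemma pgf01 (u : R) : 0 <= u <= 1 -> 0 <= pgf u <= 1.
Proof.
move=> u01; have [_ u1] := unit_powZ 0 u01; apply/andP; split.
  by apply: Rintegral_ge0 => w _; have /andP[] := u1 w.
rewrite -[leRHS](Rintegral_prob_cst P); apply: le_Rintegral => //.
- exact/unit_integrable/unit_powZ.
- by apply: unit_integrable; apply: unit_cst; rewrite ler01 lexx.
by move=> w _; have /andP[] := u1 w.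
Qed.

Lemma trunc_pgf_cvg (u : R) : 0 <= u <= 1 -> trunc_pgf M u @[M --> \oo] --> pgf u.
Proof.
move=> u01; apply: (@near_cvg _ _ \oo _ (fun M =>
    \int[P]_w ((Z 0 w < M)%N%:R * u ^+ Z 0 w))).
  by near=> M; rewrite trunc_pgfE.
have uM M := unit_trunc M u01.
have [||||||_] := @Rdominated_cvg _ _ _ P setT
  (fun M w => (Z 0 w < M)%N%:R * u ^+ Z 0 w) (fun w => u ^+ Z 0 w) (fun=> 1) => //.
- by move=> M; case: (uM M).
- by case: (unit_powZ 0 u01).
- move=> w _; apply: (@near_cvg _ _ \oo _ (fun=> u ^+ Z 0 w)); last exact: cvg_cst.
  near=> M; rewrite (_ : (Z 0 w < M)%N) ?mul1r//.
  by near: M; exact: nbhs_infty_gt.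
- by apply: unit_integrable; apply: unit_cst; rewrite ler01 lexx.
- by move=> M w _; have [_ /(_ w)/andP[h0 h1]] := uM M; rewrite ger0_norm.
Unshelve. all: by end_near. Qed.

Lemma unit_pgf (f : T -> R) : unit_fun f -> unit_fun (fun w => pgf (f w)).
Proof.
move=> uf; split; last by move=> w; apply: pgf01; case: uf.
apply: (@measurable_fun_cvg _ _ _ setT (fun M w => trunc_pgf M (f w))) => //.
  by move=> M; case: (unit_trunc_pgf M uf).
by move=> w _; apply: trunc_pgf_cvg; case: uf.
Qed.

Lemma unit_pgf_product m j : unit_fun (pgf_prod pgf m j).
Proof.
elim: m j => [|m IH] j; first by apply: unit_cst; rewrite ler01 lexx.
by apply: unit_mul => //; apply: unit_pgf; exact: unit_qthinning.
Qed.

Lemma measurable_rcinar n : measurable_fun setT (rcinar Z B n).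
Proof.
elim: n => [|n IH] /=; first exact: measurable_cst.
apply: measurable_addn; last exact: mZ'.
apply: (measurable_select (N := rcinar Z B n)
   (f := fun x w => \sum_(1 <= k < x.+1) B n.+1 k w)%N) => // x.
by apply: measurable_sumn => k; apply: measurable_bool_nat; exact: measurable_funP.
Qed.

Lemma measurable_partial_sum n : measurable_fun setT (partial_sum (rcinar Z B) n).
Proof. by apply: measurable_sumn => k; exact: measurable_rcinar. Qed.

Let trunc_gf_rcinar M m j w : trunc_gf M m j (rcinar Z B j w) w =
  (\prod_(j.+1 <= i < j.+1 + m) (Z i w < M)%N%:R) *
  q ^+ (\sum_(j.+1 <= i < j.+1 + m) rcinar Z B i w).
Proof.
elim: m j => [|m IH] j; first by rewrite addn0 !big_geq// mulr1.
rewrite trunc_gfS /arrive.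
have -> : (\sum_(1 <= k < (rcinar Z B j w).+1) B j.+1 k w + Z j.+1 w)%N =
  rcinar Z B j.+1 w by [].
have lt_j : (j.+1 < j.+1 + m.+1)%N by rewrite addnS ltnS leq_addr.
by rewrite IH [in RHS]big_ltn// [in RHS](big_ltn lt_j) -addSnnS exprD; ring.
Qed.

(** Remove the truncation of the arrivals by dominated convergence. *)
Lemma generating_function n :
  \int[P]_w q ^+ partial_sum (rcinar Z B) n w = \int[P]_w pgf_prod pgf n 0 w.
Proof.
have u1 : P.-integrable setT (EFin \o (fun=> 1 : R)).
  by apply: unit_integrable; apply: unit_cst; rewrite ler01 lexx.
have upow : unit_fun (fun w => q ^+ partial_sum (rcinar Z B) n w).
  apply: (unit_select (N := partial_sum (rcinar Z B) n) (f := fun n _ => q ^+ n)).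
    exact: measurable_partial_sum.
  by move=> k; apply: unit_exp; exact: unit_cst.
have [||||||_ H1] := @Rdominated_cvg _ _ _ P setT
  (fun M => trunc_gf M n 0 0) (fun w => q ^+ partial_sum (rcinar Z B) n w) (fun=> 1) => //.
- by move=> M; case: (unit_trunc_gf M n 0 0).
- by case: upow.
- move=> w _; apply: (@near_cvg _ _ \oo _ (fun=> q ^+ partial_sum (rcinar Z B) n w)); last exact: cvg_cst.
  near=> M; have := trunc_gf_rcinar M n 0 w; rewrite /= => ->.
  rewrite add1n /partial_sum [X in X * _]big_nat_cond [X in X * _]big1 ?mul1r//.
  move=> i; rewrite andbT => /andP[_ iN].
  rewrite (_ : (Z i w < M)%N)// (leq_ltn_trans (leq_bigmax (F := fun i : 'I_n.+1 => Z i w) (Ordinal iN)))//.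
  by near: M; exact: nbhs_infty_gt.
- by move=> M w _; have [_ /(_ w)/andP[h0 h1]] := unit_trunc_gf M n 0 0; rewrite ger0_norm.
have [||||||_ H2] := @Rdominated_cvg _ _ _ P setT
  (fun M => pgf_prod (trunc_pgf M) n 0) (pgf_prod pgf n 0) (fun=> 1) => //.
- by move=> M; case: (unit_pgf_prod M n 0).
- by case: (unit_pgf_product n 0).
- move=> w _; elim: n {upow H1} 0%N => [|m IH] j /=; first exact: cvg_cst.
  apply: cvgM => //; apply: trunc_pgf_cvg.
  by case: (unit_qthinning m j.+1).
- by move=> M w _; have [_ /(_ w)/andP[h0 h1]] := unit_pgf_prod M n 0; rewrite ger0_norm.
apply: (cvg_unique _ H1) => //.
rewrite (_ : (fun M => _) = fun M => \int[P]_w pgf_prod (trunc_pgf M) n 0 w)//.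
by apply/funext => M; exact: trunc_gf_mean.
Unshelve. all: by end_near. Qed.

End exact_formula.

(** * The defect of the generating function near 1 *)

Lemma powR_cvg (R : realType) (a r : R) : 0 < r -> s `^ a @[s --> r] --> r `^ a.
Proof.
move=> r0; rewrite {2}/powR gt_eqF//.
apply: (@near_cvg _ _ (nbhs r) _ (fun s => expR (a * ln s))).
  near=> s; rewrite /powR gt_eqF//.
  by near: s; exact: lt_nbhsr.
apply: (cvg_comp (fun v => a * ln v)); last exact: continuous_expR.
by apply: cvgMr; exact: continuous_ln.
Unshelve. all: by end_near. Qed.

Section power_inequalities.
Context (R : realType).
Implicit Types (x y r : R) (N : nat).

(** Union bound: 1 - (1 - x)^N is the probability that one of N independent trials
of success probability x succeeds. *)
Lemma onem_expr_subadditive x y N : 0 <= x -> 0 <= y -> x + y <= 1 ->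
  1 - (1 - (x + y)) ^+ N <= (1 - (1 - x) ^+ N) + (1 - (1 - y) ^+ N).
Proof.
move=> x0 y0 xy1; elim: N => [|N IH]; first by rewrite !expr0; lra.
have x1 : x <= 1 by lra.
have y1 : y <= 1 by lra.
have hA : (1 - x) ^+ N <= 1 by rewrite exprn_ile1// ?subr_ge0// gerBl.
have hB : (1 - y) ^+ N <= 1 by rewrite exprn_ile1// ?subr_ge0// gerBl.
rewrite !exprS; move: ((1 - x) ^+ N) ((1 - y) ^+ N) ((1 - (x + y)) ^+ N) IH hA hB.
move=> A B C IH hA hB.
have h1 : (1 - (x + y)) * (A + B - 1) <= (1 - (x + y)) * C.
  by rewrite ler_wpM2l; lra.
have h2 : 0 <= y * (1 - A) by rewrite mulr_ge0; lra.
have h3 : 0 <= x * (1 - B) by rewrite mulr_ge0; lra.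
lra.
Qed.

(** Concavity of 1 - (1 - x)^N, in the form that its slope from 0 decreases. *)
Lemma onem_expr_slope x r N : 0 <= r -> r <= x -> x <= 1 ->
  r * (1 - (1 - x) ^+ N) <= x * (1 - (1 - r) ^+ N).
Proof.
move=> r0 rx x1; elim: N => [|N IH]; first by rewrite !expr0; lra.
have hB : (1 - r) ^+ N <= 1 by rewrite exprn_ile1//; lra.
have h1 : (1 - x) * (r * (1 - (1 - x) ^+ N)) <= (1 - x) * (x * (1 - (1 - r) ^+ N)).
  by rewrite ler_wpM2l//; lra.
have h2 : (1 - x) * (x * (1 - (1 - r) ^+ N)) <= (1 - r) * (x * (1 - (1 - r) ^+ N)).
  rewrite ler_wpM2r//; last lra.
  by rewrite mulr_ge0; lra.
by rewrite !exprS; lra.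
Qed.

Lemma expr_onem_le_expR x N : x <= 1 -> (1 - x) ^+ N <= expR (- (x * N%:R)).
Proof.
move=> x1; rewrite -mulNr mulrC expRM_natl.
by rewrite lerXn2r ?nnegrE ?subr_ge0 ?expR_ge0//; exact: expR_ge1Dx.
Qed.

Lemma expR_le_expr_onem x N : 0 <= x -> x < 1 ->
  expR (- (x / (1 - x) * N%:R)) <= (1 - x) ^+ N.
Proof.
move=> x0 x1; rewrite -mulNr mulrC expRM_natl.
have h : 0 < 1 - x by lra.
rewrite lerXn2r ?nnegrE ?expR_ge0 ?(ltW h)// expRN -[leRHS]invrK lef_pV2 ?posrE ?expR_gt0 ?invr_gt0//.
apply: le_trans (expR_ge1Dx _).
by rewrite le_eqVlt; apply/orP; left; apply/eqP; field; rewrite gt_eqF.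
Qed.

End power_inequalities.

Section pgf_defect.
Context d (T : measurableType d) (R : realType) (P : probability T R).
Variable N : T -> nat.
Hypothesis mN : measurable_fun setT N.

Definition defect (x : R) : R := \int[P]_w (1 - (1 - x) ^+ N w).

Let unit_defect (x : R) : 0 <= x <= 1 -> unit_fun (fun w => 1 - (1 - x) ^+ N w).
Proof.
move=> /andP[x0 x1]; apply: unit_onem.
apply: (unit_select (N := N) (f := fun n _ => (1 - x) ^+ n)) => // n.
by apply: unit_exp; apply: unit_cst; rewrite subr_ge0 x1 gerBl.
Qed.

Let int_defect (x : R) : 0 <= x <= 1 ->
  P.-integrable setT (EFin \o (fun w => 1 - (1 - x) ^+ N w)).
Proof. by move=> x01; apply: unit_integrable; exact: unit_defect. Qed.

Lemma defectE (x : R) : 0 <= x <= 1 -> defect x = 1 - \int[P]_w ((1 - x) ^+ N w).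
Proof.
move=> /andP[x0 x1]; rewrite /defect RintegralB ?Rintegral_prob_cst//.
  by apply: unit_integrable; apply: unit_cst; rewrite ler01 lexx.
apply: unit_integrable; apply: (unit_select (N := N) (f := fun n _ => (1 - x) ^+ n)) => // n.
by apply: unit_exp; apply: unit_cst; rewrite subr_ge0 x1 gerBl.
Qed.

Lemma defect_ge0 (x : R) : 0 <= x <= 1 -> 0 <= defect x.
Proof.
move=> x01; apply: Rintegral_ge0 => w _.
by have [_ /(_ w)/andP[]] := unit_defect x01.
Qed.

Lemma defect_le1 (x : R) : 0 <= x <= 1 -> defect x <= 1.
Proof.
move=> x01; rewrite -[leRHS](Rintegral_prob_cst P); apply: le_Rintegral => //.
- exact: int_defect.
- by apply: unit_integrable; apply: unit_cst; rewrite ler01 lexx.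
by move=> w _; have [_ /(_ w)/andP[]] := unit_defect x01.
Qed.

Lemma defect_le (x y : R) : 0 <= x -> x <= y -> y <= 1 -> defect x <= defect y.
Proof.
move=> x0 xy y1; apply: le_Rintegral => //.
- by apply: int_defect; rewrite x0 (le_trans xy).
- by apply: int_defect; rewrite y1 (le_trans x0).
move=> w _; rewrite lerD2l lerN2 lerXn2r ?nnegrE ?subr_ge0//.
  exact: le_trans y1.
by rewrite lerD2l lerN2.
Qed.

Lemma defectD (x y : R) : 0 <= x -> 0 <= y -> x + y <= 1 ->
  defect (x + y) <= defect x + defect y.
Proof.
move=> x0 y0 xy1.
have ix : 0 <= x <= 1 by apply/andP; split; lra.
have iy : 0 <= y <= 1 by apply/andP; split; lra.
have ixy : 0 <= x + y <= 1 by apply/andP; split; lra.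
rewrite /defect -RintegralD//; [|exact: int_defect|exact: int_defect].
apply: le_Rintegral => //; first exact: int_defect.
  by apply: RintegrableD => //; exact: int_defect.
by move=> w _; exact: onem_expr_subadditive.
Qed.

(** Monotonicity and subadditivity together bound increments by the defect of the
distance. *)
Lemma defect_dist (x y : R) : 0 <= x <= 1 -> 0 <= y <= 1 ->
  `|defect x - defect y| <= defect `|x - y|.
Proof.
wlog xy : x y / x <= y => [H x01 y01|].
  have [xy|/ltW yx] := leP x y; first exact: H.
  by rewrite distrC (distrC x); exact: H.
move=> /andP[x0 x1] /andP[y0 y1].
rewrite distrC (distrC x) !ger0_norm ?subr_ge0//; last exact: defect_le.
rewrite lerBlDr -{1}(subrK x y); apply: defectD; rewrite ?subr_ge0//.
by rewrite subrK.
Qed.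

(** The linear majorant through the point [r]: choosing [r] of the order of 1 / b_n,
only a first moment of [x] is needed to estimate the mean defect. *)
Lemma defect_slope (x r : R) : 0 < r -> r <= 1 -> 0 <= x <= 1 ->
  defect x <= defect r * (1 + x / r).
Proof.
move=> r0 r1 /andP[x0 x1]; have r01 : 0 <= r <= 1 by rewrite ltW.
rewrite mulrDr mulr1; have [xr|/ltW rx] := leP x r.
  apply: le_trans (defect_le x0 xr r1) _.
  by rewrite lerDl mulr_ge0 ?divr_ge0// ?defect_ge0// ltW.
apply: (@le_trans _ _ (defect r * (x / r))); last by rewrite lerDr defect_ge0.
rewrite mulrA ler_pdivlMr// mulrC [leRHS]mulrC /defect -!RintegralZl//;
  [|exact: int_defect|by apply: int_defect; rewrite x0].
apply: le_Rintegral => //.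
- by apply: RintegrableZl => //; apply: int_defect; rewrite x0.
- by apply: RintegrableZl => //; apply: int_defect.
by move=> w _; apply: onem_expr_slope => //; exact: ltW.
Qed.

(** The tail integral formula applies to Laplace transforms; the defect is sandwiched
between two of them. *)
Definition laplace_defect (x : R) : R := 1 - laplace P (fun w => (N w)%:R) x.

Let mNR : measurable_fun setT (fun w => (N w)%:R : R).
Proof. exact: (measurable_nat_comp (fun n => n%:R : R)). Qed.

Let N0 w : 0 <= (N w)%:R :> R. Proof. exact: ler0n. Qed.

Lemma laplace_defect_le (x y : R) : 0 <= x -> x <= y ->
  laplace_defect x <= laplace_defect y.
Proof.
move=> x0 xy; rewrite lerD2l lerN2; apply: le_Rintegral => //.
- exact: (laplace_integrable P mNR N0 (le_trans x0 xy)).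
- exact: (laplace_integrable P mNR N0 x0).
by move=> w _; rewrite ler_expR lerN2 ler_wpM2r.
Qed.

Lemma laplace_defect_bounds (x : R) : 0 <= x -> x < 1 ->
  laplace_defect x <= defect x <= laplace_defect (x / (1 - x)).
Proof.
move=> x0 x1; have x01 : 0 <= x <= 1 by rewrite x0 ltW.
have y0 : 0 <= x / (1 - x) by rewrite divr_ge0// subr_ge0 ltW.
have iN : P.-integrable setT (EFin \o (fun w => (1 - x) ^+ N w)).
  apply: unit_integrable; apply: (unit_select (N := N) (f := fun n _ => (1 - x) ^+ n)) => // n.
  by apply: unit_exp; apply: unit_cst; rewrite subr_ge0 ltW// gerBl.
rewrite defectE// !lerD2l !lerN2; apply/andP; split; apply: le_Rintegral => //.
- exact: (laplace_integrable P mNR N0 x0).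
- by move=> w _; apply: expr_onem_le_expR; exact: ltW.
- exact: (laplace_integrable P mNR N0 y0).
- by move=> w _; exact: expR_le_expr_onem.
Qed.

Section asymptotics.
Variables (b : nat -> R) (alpha beta C : R).
Hypothesis alpha01 : 0 < alpha < 1.
Hypothesis beta1 : alpha < beta < 1.
Hypothesis b_cvgy : b n @[n --> \oo] --> +oo.
Local Notation U := (fun t : R => fine (P [set w | t < (N w)%:R])).
Hypothesis tail_cvg : forall x, 0 < x ->
  n%:R * U (x * b n) @[n --> \oo] --> x `^ (- alpha).
Hypothesis tail_bound : \forall n \near \oo, forall x, 0 < x ->
  n%:R * U (x * b n) <= C * (1 + x `^ (- beta)).
Local Notation c := (gamma_const (1 - alpha)).

Let b_gt0 : \forall n \near \oo, 0 < b n.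
Proof. by have /cvgryPgt/(_ 0) := b_cvgy. Qed.

Let laplace_defect_scaled (s : R) : 0 < s ->
  n%:R * laplace_defect (s / b n) @[n --> \oo] --> c * s `^ alpha.
Proof.
move=> s0; have al := alpha01.
have H := @abelian _ _ _ P (fun w => (N w)%:R) b alpha beta C mNR alpha01 beta1
  b_gt0 tail_cvg tail_bound (fun=> 1) 1 s.
have {}H := H (measurable_cst _) (fun=> _) s0.
rewrite mulrC /gamma_const (_ : 1 - alpha - 1 = - alpha); last by ring.
have -> : \int[expo R]_(y in `]0, +oo[) (y `^ (- alpha)) =
    \int[expo R]_(y in `]0, +oo[) (y `^ (- alpha) * 1).
  by apply: eq_Rintegral => y _; rewrite mulr1.
rewrite normr1 in H; apply: near_cvg (H (lexx _)).
near=> n; have bn : 0 < b n by near: n.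
congr (_ * _).
have mV : measurable_fun setT (fun w => s * (N w)%:R / b n).
  by apply: measurable_funM => //; exact: measurable_funM.
have V0 w : 0 <= s * (N w)%:R / b n by rewrite divr_ge0 ?mulr_ge0// ltW.
have := laplace_tail P mV V0.
rewrite /laplace_defect (_ : laplace P _ 1 = laplace P (fun w => (N w)%:R) (s / b n)).
  by move=> ->; apply: eq_Rintegral => y _; rewrite mul1r.
by apply: eq_Rintegral => w _; rewrite mul1r mulrAC.
Unshelve. all: by end_near. Qed.

(** Continuity of r^alpha absorbs the discrepancy between the two Laplace
transforms. *)
Let squeeze (r : R) (F : nat -> R) : 0 < r ->
  (forall s1 s2 : R, 0 < s1 -> s1 < r -> r < s2 -> \forall n \near \oo,
    n%:R * laplace_defect (s1 / b n) <= F n <= n%:R * laplace_defect (s2 / b n)) ->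
  F n @[n --> \oo] --> c * r `^ alpha.
Proof.
move=> r0 HF; apply/cvgrPdist_lt => e e0.
have e2 : 0 < e / 2 :> R by rewrite divr_gt0.
have cr : c * s `^ alpha @[s --> r] --> c * r `^ alpha.
  by apply: cvgMr; exact: powR_cvg.
have /cvgrPdist_lt/(_ _ e2) Hl := cvg_at_left_filter cr.
have /cvgrPdist_lt/(_ _ e2) Hr := cvg_at_right_filter cr.
have [s1 [s10 s1r Hs1]] : exists s1, [/\ 0 < s1, s1 < r &
    `|c * r `^ alpha - c * s1 `^ alpha| < e / 2].
  near r^'- => s; exists s; split; near: s => //; [exact: nbhs_left_gt|exact: nbhs_left_lt].
have [s2 [s2r Hs2]] : exists s2, r < s2 /\
    `|c * r `^ alpha - c * s2 `^ alpha| < e / 2.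
  near r^'+ => s; exists s; split; near: s => //.
  exact: nbhs_right_gt.
have /cvgrPdist_lt/(_ _ e2) L1 := laplace_defect_scaled s10.
have /cvgrPdist_lt/(_ _ e2) L2 := laplace_defect_scaled (lt_trans r0 s2r).
have HF' := HF s1 s2 s10 s1r s2r.
near=> n.
have /andP[f1 f2] : n%:R * laplace_defect (s1 / b n) <= F n <=
  n%:R * laplace_defect (s2 / b n) by near: n.
have l1 : `|c * s1 `^ alpha - n%:R * laplace_defect (s1 / b n)| < e / 2.
  by near: n; exact: L1.
have l2 : `|c * s2 `^ alpha - n%:R * laplace_defect (s2 / b n)| < e / 2.
  by near: n; exact: L2.
move: Hs1 Hs2 f1 f2 l1 l2.
move: (c * r `^ alpha) (c * s1 `^ alpha) (c * s2 `^ alpha) (F n)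
  (n%:R * laplace_defect (s1 / b n)) (n%:R * laplace_defect (s2 / b n)) => x1 x2 x3 x4 x5 x6.
rewrite !ltr_norml => /andP[? ?] /andP[? ?] ? ? /andP[? ?] /andP[? ?].
by apply/andP; split; lra.
Unshelve. all: by end_near. Qed.

Lemma defect_scaled (x : nat -> R) (r : R) : 0 < r ->
  (forall n, 0 <= x n <= 1) -> x n * b n @[n --> \oo] --> r ->
  n%:R * defect (x n) @[n --> \oo] --> c * r `^ alpha.
Proof.
move=> r0 x01 xb; apply: squeeze => // s1 s2 s10 s1r s2r.
have x_cvg0 : x n @[n --> \oo] --> (0 : R).
  apply: (@near_cvg _ _ \oo _ (fun n => x n * b n * (b n)^-1)).
    near=> n; rewrite mulfK// gt_eqF//.
    by near: n.
  rewrite -[X in _ --> X](mulr0 r); apply: cvgM => //.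
  by apply/gtr0_cvgV0.
have gap : (1 - x n) * s2 - x n * b n @[n --> \oo] --> s2 - r.
  apply: cvgB => //; rewrite -[s2 in X in _ --> X]mul1r -[1 in X in _ --> X](subr0 1).
  by apply: cvgMl; apply: cvgB => //; exact: cvg_cst.
near=> n.
have bn : 0 < b n by near: n.
have /andP[x0 x1] := x01 n.
have h1 : s1 < x n * b n by near: n; exact: (cvgr_gt _ xb).
have h2 : x n * b n < (1 - x n) * s2.
  rewrite -subr_gt0; near: n; apply: (cvgr_gt _ gap).
  by rewrite subr_gt0.
have x1' : x n < 1 by near: n; exact: (cvgr_lt _ x_cvg0).
have /andP[d1 d2] := laplace_defect_bounds x0 x1'.
apply/andP; split; apply: (ler_wpM2l (ler0n R n)).
  apply: le_trans d1; apply: laplace_defect_le; first by rewrite divr_ge0 ?ltW.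
  by rewrite ler_pdivrMr// ltW.
apply: (le_trans d2); apply: laplace_defect_le; first by rewrite divr_ge0 ?subr_ge0.
by rewrite ler_pdivrMr ?subr_gt0// mulrAC ler_pdivlMr// ltW// [ltRHS]mulrC.
Unshelve. all: by end_near. Qed.

Lemma onem_expR_scaled (s : R) : 0 < s ->
  (1 - expR (- (s / b n))) * b n @[n --> \oo] --> s.
Proof.
move=> s0.
have bV : (b n)^-1 @[n --> \oo] --> (0 : R) by apply/gtr0_cvgV0.
have lo : s / (1 + s / b n) @[n --> \oo] --> s.
  rewrite -[X in _ --> X]divr1; apply: cvgM; first exact: cvg_cst.
  apply: cvgV; first exact: oner_neq0.
  rewrite -[X in _ --> X]addr0; apply: cvgD; first exact: cvg_cst.
  by rewrite -(mulr0 s); exact: cvgMr.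
apply: (squeeze_cvgr _ lo (cvg_cst s)).
near=> n; have bn : 0 < b n by near: n.
have sb : 0 < s / b n by rewrite divr_gt0.
apply/andP; split.
  have : expR (- (s / b n)) <= (1 + s / b n)^-1.
    by rewrite expRN lef_pV2 ?posrE ?expR_gt0 ?expR_ge1Dx//; lra.
  have -> : s / (1 + s / b n) = (1 - (1 + s / b n)^-1) * b n.
    by field; rewrite !gt_eqF//=; move: sb; rewrite ltr_pdivlMr// mul0r; lra.
  by move=> h; apply: ler_wpM2r; [exact: ltW|rewrite lerD2l lerN2].
rewrite -ler_pdivlMr//; have := expR_ge1Dx (- (s / b n)); lra.
Unshelve. all: by end_near. Qed.

End asymptotics.

End pgf_defect.

(** * Perpetuities of the environment *)

Section perpetuities.
Context (R : realType) d (T : measurableType d) (P : probability T R).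
Variable phi : int -> {RV P >-> R}.
Hypothesis phi_iid : iid P phi.
Hypothesis phi_01 : forall n w, 0 <= phi n w <= 1.

Definition future (j : nat) : set (set T) := block_gen phi [set i : int | j%:Z < i].
Local Notation fmeasurable j f :=
  (measurable_fun (setT : set (g_sigma_algebraType (future j))) f).

(** This is 1 - q * [thinning], see [excess_thinning]; this recursion shows that it is
of order 1 - q and close to (1 - q) times [perpetuity]. *)
Fixpoint excess (q : R) (k j : nat) (w : T) : R :=
  if k is k'.+1 then (1 - q) + q * (phi j.+1 w * excess q k' j.+1 w) else 1 - q.

(** 1 + phi_(j+1) + phi_(j+1) phi_(j+2) + ..., with [m] products. *)
Fixpoint perpetuity (m j : nat) (w : T) : R :=
  if m is m'.+1 then 1 + phi j.+1 w * perpetuity m' j.+1 w else 1.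

Let mphi i : measurable_fun setT (phi i). Proof. exact: measurable_funP. Qed.

Let future_coord j : fmeasurable j (phi j.+1).
Proof.
by apply: (block_measurable_coord (X := fun i => phi i : T -> R)) => /=; rewrite ltz_nat.
Qed.

Let futureS d' (S : measurableType d') j (f : T -> S) :
  fmeasurable j.+1 f -> fmeasurable j f.
Proof.
apply: (block_measurable_funS (X := fun i => phi i : T -> R)) => i /=.
by apply: lt_trans; rewrite ltz_nat.
Qed.

Lemma future_measurable d' (S : measurableType d') j (f : T -> S) :
  fmeasurable j f -> measurable_fun setT f.
Proof. exact: (block_measurable_fun (X := fun i => phi i : T -> R)). Qed.

Lemma future_excess q k j : fmeasurable j (excess q k j).
Proof.
elim: k j => [|k IH] j /=; first exact: measurable_cst.
apply: measurable_funD; first exact: measurable_cst.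
apply: measurable_funM; first exact: measurable_cst.
by apply: measurable_funM; [exact: future_coord|apply: futureS; exact: IH].
Qed.

Lemma future_perpetuity m j : fmeasurable j (perpetuity m j).
Proof.
elim: m j => [|m IH] j /=; first exact: measurable_cst.
apply: measurable_funD; first exact: measurable_cst.
by apply: measurable_funM; [exact: future_coord|apply: futureS; exact: IH].
Qed.

Lemma excess_thinning q k j w : excess q k j w = 1 - q * thinning phi q k j w.
Proof. by elim: k j => [|k IH] j /=; [rewrite mulr1|rewrite IH; ring]. Qed.

Lemma perpetuity_bounds m j w : 1 <= perpetuity m j w <= m.+1%:R.
Proof.
elim: m j => [|m IH] j /=; first by rewrite lexx.
have /andP[p0 p1] := phi_01 j.+1 w; have /andP[h1 h2] := IH j.+1.
rewrite lerDl mulr_ge0//=; last exact: le_trans h1.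
rewrite -[m.+2%:R]natr1 addrC lerD2r; apply: le_trans h2.
by rewrite ler_piMl// (le_trans _ h1).
Qed.

Lemma excess_bounds q k j w : 0 <= q <= 1 ->
  [/\ 0 <= excess q k j w, excess q k j w <= 1 & excess q k j w <= k.+1%:R * (1 - q)].
Proof.
move=> /andP[q0 q1]; elim: k j => [|k IH] j /=; first by rewrite mul1r; split; lra.
have /andP[p0 p1] := phi_01 j.+1 w; have [h0 h1 h2] := IH j.+1.
have pe0 : 0 <= phi j.+1 w * excess q k j.+1 w by rewrite mulr_ge0.
have pe : phi j.+1 w * excess q k j.+1 w <= excess q k j.+1 w by rewrite ler_piMl.
have qpe0 : 0 <= q * (phi j.+1 w * excess q k j.+1 w) by rewrite mulr_ge0.
have qpe : q * (phi j.+1 w * excess q k j.+1 w) <= phi j.+1 w * excess q k j.+1 w.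
  by rewrite ler_piMl.
have qpe1 : q * (phi j.+1 w * excess q k j.+1 w) <= q.
  by rewrite ler_piMr// (le_trans pe).
rewrite -[k.+2%:R]natr1 mulrDl mul1r.
by split; lra.
Qed.

Definition thinning_mean : R := \int[P]_w phi 0 w.
Local Notation rho := thinning_mean.

Let phi_mean i : \int[P]_w phi i w = rho.
Proof.
have [_ Hid] := phi_iid.
(* Equal laws give equal means of bounded functions: h is the identity on [0, 1]. *)
pose h (x : R) : R := Num.max 0 (Num.min 1 x).
have hE x : 0 <= x <= 1 -> h x = x.
  by move=> /andP[x0 x1]; rewrite /h (min_r x1) (max_r x0).
have mh : measurable_fun setT h by apply: measurable_maxr => //; exact: measurable_minr.
have hM x : `|h x| <= 1.
  by rewrite ger0_norm ?le_max ?lexx// ge_max ler01 ge_min lexx.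
rewrite /thinning_mean.
transitivity (\int[P]_w h (phi i w)).
  by apply: eq_Rintegral => w _; rewrite hE.
rewrite (law_ext (mphi i) (Q := distribution P (phi 0)) (M := 1))//; last first.
  by move=> A mA; rewrite (Hid i 0 A mA).
rewrite -(law_ext (P := P) (mphi 0) (Q := distribution P (phi 0)) (M := 1))//.
by apply: eq_Rintegral => w _; rewrite hE.
Qed.

Lemma thinning_mean_ge0 : 0 <= rho.
Proof. by apply: Rintegral_ge0 => w _; have /andP[] := phi_01 0 w. Qed.

Let i1 : P.-integrable setT (EFin \o (fun=> 1 : R)).
Proof. by apply: unit_integrable; apply: unit_cst; rewrite ler01 lexx. Qed.

Let unit_phi i : unit_fun (phi i).
Proof. by split; [exact: mphi|exact: phi_01]. Qed.

Lemma thinning_mean_le1 : rho <= 1.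
Proof.
rewrite -[leRHS](Rintegral_prob_cst P); apply: le_Rintegral => //.
  exact: unit_integrable.
by move=> w _; have /andP[] := phi_01 0 w.
Qed.

Let bernoulli_bound (x : R) k : 0 <= x <= 1 -> 1 - k%:R * (1 - x) <= x ^+ k.
Proof.
move=> /andP[x0 x1]; elim: k => [|k IH]; first by rewrite mul0r subr0 expr0.
have h : x * (1 - k%:R * (1 - x)) <= x * x ^+ k by rewrite ler_wpM2l.
have h2 : 0 <= k%:R * (1 - x) * (1 - x) by rewrite !mulr_ge0 ?subr_ge0.
by rewrite exprS -natr1; lra.
Qed.

(** If the mean were 1, all powers would have mean 1 by Bernoulli's inequality,
while they converge to the indicator of phi_0 = 1. *)
Lemma thinning_mean_lt1 : (P [set w | phi 0%R w = 1%R] < 1)%E -> rho < 1.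
Proof.
move=> p1; rewrite lt_neqAle thinning_mean_le1 andbT; apply/negP => /eqP rho1.
have m1 : measurable [set w | phi 0 w = 1] by exact: measurable_val_eq.
have Epow k : \int[P]_w (phi 0 w ^+ k) = 1.
  have uk := unit_exp k (unit_phi 0).
  apply/eqP; rewrite eq_le; apply/andP; split.
    rewrite -[leRHS](Rintegral_prob_cst P); apply: le_Rintegral => //.
      exact: unit_integrable.
    by move=> w _; have [_ /(_ w)/andP[]] := uk.
  have iB : P.-integrable setT (EFin \o (fun w => 1 - phi 0 w)).
    exact/unit_integrable/unit_onem.
  have : \int[P]_w (1 - k%:R * (1 - phi 0 w)) <= \int[P]_w (phi 0 w ^+ k).
    apply: le_Rintegral => //; last by move=> w _; exact: bernoulli_bound.
      by apply: RintegrableB => //; exact: RintegrableZl.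
    exact: unit_integrable.
  rewrite RintegralB//; last exact: RintegrableZl.
  rewrite RintegralZl// RintegralB//; last exact: unit_integrable.
  by rewrite phi_mean !Rintegral_prob_cst rho1 subrr mulr0 subr0.
have [||||||_ H] := @Rdominated_cvg _ _ _ P setT (fun k w => phi 0 w ^+ k)
    (\1_[set w | phi 0 w = 1]) (fun=> 1) => //.
- by move=> k; case: (unit_exp k (unit_phi 0)).
- move=> w _; have /andP[h0 h1] := phi_01 0 w.
  have [e1|n1] := eqVneq (phi 0 w) 1.
    rewrite indicE mem_set//=.
    apply: (@near_cvg _ _ \oo _ (fun=> 1)); last exact: cvg_cst.
    by near=> k; rewrite e1 expr1n.
  rewrite indicE memNset//=; last exact/eqP.
  by apply: cvg_expr; rewrite ger0_norm// lt_neqAle n1.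
- by move=> k w _; have [_ /(_ w)/andP[h0 h1]] := unit_exp k (unit_phi 0); rewrite ger0_norm.
have : \int[P]_w (\1_[set w | phi 0 w = 1] w) = 1 :> R.
  apply: (cvg_unique _ H) => //.
  apply: (@near_cvg _ _ \oo _ (fun=> 1)); last exact: cvg_cst.
  by near=> k; rewrite Epow.
rewrite Rintegral_indic// => f1; move: p1.
by rewrite -[P _]fineK ?fin_num_measure// f1 ltxx.
Unshelve. all: by end_near. Qed.

Let future_indep j (X : T -> R) : fmeasurable j.+1 X ->
  independent_pair P (phi j.+1) X.
Proof.
move=> mX; apply: (block_independent_pair (X := fun i => phi i : T -> R)
  _ phi_iid.1 (A := [set i | i <= j.+1%:Z]) (B := [set i | j.+1%:Z < i])) => //.
- by apply/seteqP; split => i //= [ij ji]; have := lt_le_trans ji ij; rewrite ltxx.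
- by apply: (block_measurable_coord (X := fun i => phi i : T -> R)) => /=.
Qed.

(** The factor phi_(j+1) is independent of whatever depends on the later
environment; all first moments below come from this by induction. *)
Lemma mean_mul_future j (X : T -> R) (M : R) : fmeasurable j.+1 X ->
  (forall w, `|X w| <= M) ->
  \int[P]_w (phi j.+1 w * X w) = rho * \int[P]_w X w.
Proof.
move=> mX XM; rewrite (@integral_independent_mul _ _ _ P (phi j.+1) X 1 M)//.
- by rewrite phi_mean.
- exact: future_measurable mX.
- exact: future_indep mX.
- by move=> w; have /andP[h0 h1] := phi_01 j.+1 w; rewrite ger0_norm.
Qed.

Lemma perpetuity_law m j (U : set R) : measurable U ->
  P (perpetuity m j @^-1` U) = P (perpetuity m 0 @^-1` U).
Proof.
move=> mU; elim: m j U mU => [//|m IH] j U mU.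
pose h (z : R * R) : R := \1_U (1 + z.1 * z.2).
have mh : measurable_fun setT h.
  apply: measurableT_comp; first exact: measurable_indic.
  by apply: measurable_funD => //; apply: measurable_funM.
have hM z : `|h z| <= 1.
  by rewrite /h indicE; case: (_ \in _); rewrite ?normr1 ?normr0.
have mper i k : measurable_fun setT (perpetuity i k).
  by apply: future_measurable; exact: future_perpetuity.
have main i : \int[P]_w h (phi i.+1 w, perpetuity m i.+1 w) =
    \int[P]_x \int[P]_y h (phi 1 x, perpetuity m 0 y).
  apply: (integral_independent_pair (M := 1)) => //.
  - by apply: future_indep; exact: future_perpetuity.
  - by have [_ Hid] := phi_iid; move=> V mV; exact: Hid.
  - by move=> V mV; exact: IH.
have toP i : fine (P (perpetuity m.+1 i @^-1` U)) =
    \int[P]_w h (phi i.+1 w, perpetuity m i.+1 w).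
  rewrite -Rintegral_indic; last first.
    by rewrite -[X in measurable X]setTI; exact: mper.
  by apply: eq_Rintegral => w _; rewrite /h !indicE.
have mp i : measurable (perpetuity m.+1 i @^-1` U).
  by rewrite -[X in measurable X]setTI; exact: mper.
by rewrite -[LHS]fineK ?fin_num_measure// -[RHS]fineK ?fin_num_measure// !toP !main.
Qed.

Lemma perpetuity_mean m j (h : R -> R) (M : R) : measurable_fun setT h ->
  (forall x, `|h x| <= M) ->
  \int[P]_w h (perpetuity m j w) = \int[P]_w h (perpetuity m 0 w).
Proof.
move=> mh hM.
have mper i k : measurable_fun setT (perpetuity i k).
  by apply: future_measurable; exact: future_perpetuity.
rewrite (law_ext (mper m j) (Q := distribution P (mfun_of (mper m 0))) (M := M))//.
  by rewrite -(law_ext (P := P) (mper m 0) (M := M)).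
by move=> A mA; rewrite perpetuity_law.
Qed.

Local Notation kappa := (1 - rho)^-1.
Hypothesis rho_lt1 : rho < 1.

Let kappa_ge1 : 1 <= kappa.
Proof.
have r0 := thinning_mean_ge0; have r1 := rho_lt1.
by rewrite -[leLHS]invr1 lef_pV2 ?posrE ?subr_gt0// gerBl.
Qed.

Let kappaE : kappa = 1 + rho * kappa.
Proof. by have r1 := rho_lt1; field; rewrite subr_eq0 eq_sym lt_eqF. Qed.

Let unit_excess q k j : 0 <= q <= 1 -> unit_fun (excess q k j).
Proof.
move=> q01; split; first by apply: future_measurable; exact: future_excess.
by move=> w; have [-> ->] := excess_bounds k j w q01.
Qed.

(** The recursion gives a geometric series of ratio [rho]. *)
Lemma mean_excess q k j : 0 <= q <= 1 ->
  \int[P]_w excess q k j w <= (1 - q) * kappa.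
Proof.
move=> q01; have /andP[q0 q1] := q01; have k1 := kappa_ge1; have r0 := thinning_mean_ge0.
elim: k j => [|k IH] j /=.
  by rewrite Rintegral_prob_cst ler_peMr// subr_ge0.
have ue := unit_excess k j.+1 q01.
have up : unit_fun (fun w => phi j.+1 w * excess q k j.+1 w) by exact: unit_mul.
rewrite RintegralD//; first last.
- by apply: RintegrableZl => //; exact: unit_integrable.
- by apply: unit_integrable; apply: unit_cst; rewrite subr_ge0 q1 gerBl.
rewrite Rintegral_prob_cst RintegralZl//; last exact: unit_integrable.
rewrite (@mean_mul_future j _ 1)//; first last.
- by move=> w; have [h0 h1 _] := excess_bounds k j.+1 w q01; rewrite ger0_norm.
- exact: future_excess.
have e0 : 0 <= \int[P]_w excess q k j.+1 w.
  by apply: Rintegral_ge0 => w _; have [] := excess_bounds k j.+1 w q01.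
rewrite [in leRHS]kappaE mulrDr mulr1 lerD2l.
apply: (@le_trans _ _ (rho * \int[P]_w excess q k j.+1 w)).
  by rewrite ler_piMl// mulr_ge0.
by rewrite mulrCA ler_wpM2l.
Qed.

Definition truncation_gap q m k j w : R :=
  `|excess q k j w - (1 - q) * perpetuity m j w|.
Local Notation gap := truncation_gap.

Lemma future_gap q m k j : fmeasurable j (gap q m k j).
Proof.
apply: measurableT_comp; first exact: normr_measurable.
apply: measurable_funB; first exact: future_excess.
by apply: measurable_funM; [exact: measurable_cst|exact: future_perpetuity].
Qed.

(** A crude pointwise bound, used for the last few times, where there are fewer
than [m] steps left. *)
Lemma gap_bound q m k j w : 0 <= q <= 1 ->
  gap q m k j w <= (1 - q) * (maxn k m).+1%:R.
Proof.
move=> q01; have /andP[q0 q1] := q01.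
have [h0 h1 h2] := excess_bounds k j w q01.
have /andP[p0 p1] := perpetuity_bounds m j w.
have a0 : 0 <= 1 - q by rewrite subr_ge0.
have kM : k.+1%:R * (1 - q) <= (1 - q) * (maxn k m).+1%:R.
  by rewrite mulrC ler_wpM2l// ler_nat ltnS leq_maxl.
have pM : (1 - q) * perpetuity m j w <= (1 - q) * (maxn k m).+1%:R.
  by rewrite ler_wpM2l// (le_trans p1)// ler_nat ltnS leq_maxr.
have p'0 : 0 <= (1 - q) * perpetuity m j w by rewrite mulr_ge0// (le_trans _ p0).
by rewrite /gap ler_norml; apply/andP; split; lra.
Qed.

Let gap_integrable q m k j : 0 <= q <= 1 -> P.-integrable setT (EFin \o gap q m k j).
Proof.
move=> q01; apply: (@bounded_integrable _ _ _ _ _ ((1 - q) * (maxn k m).+1%:R)).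
  by apply: future_measurable; exact: future_gap.
by move=> w; rewrite ger0_norm ?normr_ge0//; exact: gap_bound.
Qed.

(** The first term is the tail of the perpetuity beyond [m] steps, geometric in
[m]; the second collects the factors [q] that the excess carries and the
perpetuity does not, and is of second order in 1 - q. *)
Lemma mean_gap q m r j : 0 <= q <= 1 ->
  \int[P]_w gap q m (m + r) j w <=
  rho ^+ m * ((1 - q) * kappa) + m%:R * ((1 - q) ^+ 2 * kappa).
Proof.
move=> q01; have /andP[q0 q1] := q01; have k1 := kappa_ge1.
have r0 := thinning_mean_ge0; have r1 := thinning_mean_le1.
have a0 : 0 <= 1 - q by rewrite subr_ge0.
have ak0 : 0 <= (1 - q) * kappa by rewrite mulr_ge0// (le_trans _ k1).
have mul_excess k i : \int[P]_w (phi i.+1 w * excess q k i.+1 w) <= rho * ((1 - q) * kappa).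
  rewrite (@mean_mul_future i _ 1)//; first last.
  - by move=> w; have [h0 h1 _] := excess_bounds k i.+1 w q01; rewrite ger0_norm.
  - exact: future_excess.
  by rewrite ler_wpM2l// mean_excess.
have iexc k i : P.-integrable setT (EFin \o (fun w => phi i.+1 w * excess q k i.+1 w)).
  by apply: unit_integrable; apply: unit_mul => //; exact: unit_excess.
elim: m j => [|m IH] j.
  rewrite expr0 mul1r mul0r addr0 add0n; case: r => [|r].
    rewrite (@eq_Rintegral _ _ _ P setT (fun=> 0)) ?Rintegral_prob_cst//.
    by move=> w _; rewrite /gap /= mulr1 subrr normr0.
  apply: (@le_trans _ _ (\int[P]_w (phi j.+1 w * excess q r j.+1 w))).
    apply: le_Rintegral => //; first exact: gap_integrable.
    move=> w _; rewrite /gap /= mulr1 addrAC subrr add0r.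
    have [h0 h1 _] := excess_bounds r j.+1 w q01; have /andP[p0 p1] := phi_01 j.+1 w.
    by rewrite ger0_norm ?mulr_ge0// ler_piMl// mulr_ge0.
  by apply: le_trans (mul_excess r j) _; rewrite ler_piMl.
have ig := @gap_integrable q m (m + r) j.+1 q01.
have uz : P.-integrable setT (EFin \o (fun w => gap q m (m + r) j.+1 w + (1 - q) * excess q (m + r) j.+1 w)).
  apply: RintegrableD => //; apply: RintegrableZl => //.
  by apply: unit_integrable; exact: unit_excess.
pose M := (1 - q) * (maxn (m + r) m).+1%:R + (1 - q).
have bz w : `|gap q m (m + r) j.+1 w + (1 - q) * excess q (m + r) j.+1 w| <= M.
  have [h0 h1 _] := excess_bounds (m + r) j.+1 w q01.
  rewrite ger0_norm ?addr_ge0 ?mulr_ge0 ?normr_ge0// lerD ?gap_bound//.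
  by rewrite ler_piMr.
have mz : fmeasurable j.+1 (fun w => gap q m (m + r) j.+1 w + (1 - q) * excess q (m + r) j.+1 w).
  apply: measurable_funD; first exact: future_gap.
  by apply: measurable_funM; [exact: measurable_cst|exact: future_excess].
apply: (@le_trans _ _ (\int[P]_w (phi j.+1 w *
    (gap q m (m + r) j.+1 w + (1 - q) * excess q (m + r) j.+1 w)))).
  apply: le_Rintegral => //; first exact: gap_integrable.
    apply: (@bounded_integrable _ _ _ _ _ M).
      by apply: measurable_funM => //; exact: future_measurable mz.
    move=> w; have /andP[p0 p1] := phi_01 j.+1 w.
    by rewrite normrM (ger0_norm p0) (le_trans _ (bz w))// ler_piMl.
  move=> w _; have [h0 h1 _] := excess_bounds (m + r) j.+1 w q01.
  have /andP[p0 p1] := phi_01 j.+1 w.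
  rewrite /gap /= (_ : _ - _ = phi j.+1 w * (excess q (m + r) j.+1 w -
    (1 - q) * perpetuity m j.+1 w - (1 - q) * excess q (m + r) j.+1 w)); last by ring.
  rewrite normrM (ger0_norm p0) ler_wpM2l//.
  by rewrite (le_trans (ler_normB _ _))// lerD2l ger0_norm// mulr_ge0.
rewrite (mean_mul_future mz bz) RintegralD//; last first.
  by apply: RintegrableZl => //; apply: unit_integrable; exact: unit_excess.
rewrite RintegralZl//; last by apply: unit_integrable; exact: unit_excess.
have hI := IH j.+1; have hE := mean_excess (m + r) j.+1 q01.
have h1 : (1 - q) * \int[P]_w excess q (m + r) j.+1 w <= (1 - q) ^+ 2 * kappa.
  by rewrite expr2 -mulrA ler_wpM2l.
apply: (@le_trans _ _ (rho * (rho ^+ m * ((1 - q) * kappa) + m.+1%:R * ((1 - q) ^+ 2 * kappa)))).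
  apply: ler_wpM2l => //; rewrite -natr1 [X in _ <= _ + X]mulrDl mul1r [leRHS]addrA.
  by apply: lerD.
rewrite mulrDr mulrA -exprS lerD2l ler_piMl// mulr_ge0// mulr_ge0 ?sqr_ge0//.
exact: le_trans k1.
Qed.

End perpetuities.

(** * The law of large numbers for powers of perpetuities *)

Lemma sum_ltn_le n m : (\sum_(0 <= i < n) (i < m) <= m)%N.
Proof.
suff -> : (\sum_(0 <= i < n) (i < m) = minn n m)%N by exact: geq_minr.
elim: n => [|n IH]; first by rewrite big_geq// min0n.
rewrite big_nat_recr//= IH; have [nm|mn] := ltnP n m.
  by rewrite (minn_idPl nm) addn1.
by rewrite (minn_idPr (leqW mn)) addn0.
Qed.

Lemma prod01 (R : realType) (I : Type) (s : seq I) (x : I -> R) :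
  (forall i, 0 <= x i <= 1) -> 0 <= \prod_(i <- s) x i <= 1.
Proof.
move=> x01; elim: s => [|i s IH]; first by rewrite big_nil ler01 lexx.
rewrite big_cons; have /andP[h0 h1] := x01 i; have /andP[k0 k1] := IH.
by rewrite mulr_ge0// mulr_ile1.
Qed.

Section comparison_of_products.
Context d (T : measurableType d) (R : realType) (P : probability T R).

Lemma unit_dist_integrable (f g : T -> R) : unit_fun f -> unit_fun g ->
  P.-integrable setT (EFin \o (fun w => `|f w - g w|)).
Proof.
move=> [mf f01] [mg g01]; apply: (@bounded_integrable _ _ _ _ _ 1).
  by apply: measurableT_comp; [exact: normr_measurable|exact: measurable_funB].
move=> w; rewrite normr_id ler_norml.
by have /andP[? ?] := f01 w; have /andP[? ?] := g01 w; apply/andP; split; lra.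
Qed.

(** Telescoping, all factors being in the unit interval. *)
Lemma dist_prod (I : Type) (s : seq I) (x y : I -> R) :
  (forall i, 0 <= x i <= 1) -> (forall i, 0 <= y i <= 1) ->
  `|\prod_(i <- s) x i - \prod_(i <- s) y i| <= \sum_(i <- s) `|x i - y i|.
Proof.
move=> x01 y01; elim: s => [|i s IH]; first by rewrite !big_nil subrr normr0.
rewrite !big_cons; set X := \prod_(i <- s) x i in IH *; set Y := \prod_(i <- s) y i in IH *.
rewrite (_ : _ - _ = (x i - y i) * X + y i * (X - Y)); last by ring.
apply: le_trans (ler_normD _ _) _; rewrite !normrM lerD//.
  by have /andP[h0 h1] := prod01 s x01; rewrite ler_piMr// ger0_norm.
have /andP[h0 h1] := y01 i.
by apply: le_trans IH; rewrite ger0_norm// ler_piMl.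
Qed.

Lemma dist_mean_prod (I : Type) (s : seq I) (f g : I -> T -> R) :
  (forall i, unit_fun (f i)) -> (forall i, unit_fun (g i)) ->
  `|\int[P]_w \prod_(i <- s) f i w - \int[P]_w \prod_(i <- s) g i w| <=
  \sum_(i <- s) \int[P]_w `|f i w - g i w|.
Proof.
move=> uf ug; have upf := unit_prod s uf; have upg := unit_prod s ug.
rewrite -RintegralB//; [|exact: unit_integrable|exact: unit_integrable].
apply: le_trans (le_normr_Rintegral _ _) _ => //.
  by apply: RintegrableB => //; exact: unit_integrable.
rewrite -Rintegral_sum => [|i]; last exact: unit_dist_integrable.
apply: le_Rintegral => //.
- exact: unit_dist_integrable.
- have is_ : P.-integrable setT (EFin \o (fun w => \sum_(i <- s) `|f i w - g i w|)).
    elim: s {upf upg} => [|i s IH].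
      rewrite (_ : _ \o _ = EFin \o (fun=> 0)).
        by apply: unit_integrable; apply: unit_cst; rewrite lexx ler01.
      by apply/funext => w /=; rewrite big_nil.
    rewrite (_ : _ \o _ = EFin \o (fun w => `|f i w - g i w| + \sum_(j <- s) `|f j w - g j w|)).
      by apply: RintegrableD => //; exact: unit_dist_integrable.
    by apply/funext => w /=; rewrite big_cons.
  exact: is_.
- by move=> w _; apply: dist_prod => i; [case: (uf i)|case: (ug i)].
Qed.

(** Only pairs at distance less than [m] contribute, and there are at most
(2 m + 1) n of them. *)
Lemma variance_mdependent (X : nat -> T -> R) (b : R) (m : nat) : 0 <= b ->
  (forall i, measurable_fun setT (X i)) -> (forall i w, `|X i w| <= b) ->
  (forall i j, (i + m <= j)%N -> \int[P]_w (X i w * X j w) = 0) ->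
  forall n, \int[P]_w ((\sum_(0 <= i < n) X i w) ^+ 2) <=
    n%:R * ((m.*2.+1)%:R * b ^+ 2).
Proof.
move=> b0 mX Xb X0.
have iXX i j : P.-integrable setT (EFin \o (fun w => X i w * X j w)).
  apply: (@bounded_integrable _ _ _ _ _ (b * b)); first exact: measurable_funM.
  by move=> w; rewrite normrM ler_pM.
have bXX i j : `|\int[P]_w (X i w * X j w)| <= b ^+ 2.
  rewrite expr2; apply: le_norm_Rintegral; first exact: measurable_funM.
  by move=> w; rewrite normrM ler_pM.
have mS n : measurable_fun setT (fun w => \sum_(0 <= i < n) X i w).
  by apply: measurable_sum => i.
have bS n w : `|\sum_(0 <= i < n) X i w| <= n%:R * b.
  apply: le_trans (ler_norm_sum _ _ _) _.
  apply: (@le_trans _ _ (\sum_(0 <= i < n) b)); first exact: ler_sum.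
  by rewrite big_const_nat iter_addr subn0 addr0 mulr_natl.
have iSX n j : P.-integrable setT (EFin \o (fun w => (\sum_(0 <= i < n) X i w) * X j w)).
  apply: (@bounded_integrable _ _ _ _ _ (n%:R * b * b)); first exact: measurable_funM.
  by move=> w; rewrite normrM ler_pM.
have cross n : \int[P]_w ((\sum_(0 <= i < n) X i w) * X n w) <= m%:R * b ^+ 2.
  rewrite (@eq_Rintegral _ _ _ P setT (fun w => \sum_(0 <= i < n) X i w * X n w)); last first.
    by move=> w _; rewrite mulr_suml.
  rewrite Rintegral_sum => [|i//].
  apply: (@le_trans _ _ (\sum_(0 <= i < n) (n < i + m)%N%:R * b ^+ 2)).
    apply: ler_sum => i _; have [nim|nim] := ltnP n (i + m).
      by rewrite mul1r; apply: le_trans (ler_norm _) (bXX i n).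
    by rewrite X0// mul0r.
  rewrite -mulr_suml ler_wpM2r ?sqr_ge0// -natr_sum ler_nat.
  rewrite big_nat_rev add0n; apply: leq_trans (sum_ltn_le n m).
  rewrite big_nat_cond [leqRHS]big_nat_cond; apply: leq_sum => i /andP[/andP[_ ni] _].
  case: ltnP => // h; case: (ltnP i m) => // mi.
  by move: h; rewrite ltnNge -{2}(subnK ni) leq_add2l (leq_trans mi).
elim=> [|n IH].
  rewrite mul0r (@eq_Rintegral _ _ _ P setT (fun=> 0)) ?Rintegral_prob_cst//.
  by move=> w _; rewrite big_geq// expr0n.
have iS2 : P.-integrable setT (EFin \o (fun w => (\sum_(0 <= i < n) X i w) ^+ 2)).
  apply: (@bounded_integrable _ _ _ _ _ ((n%:R * b) ^+ 2)); first exact: measurable_funX.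
  by move=> w; rewrite normrX lerXn2r ?nnegrE// mulr_ge0.
rewrite (@eq_Rintegral _ _ _ P setT (fun w => (\sum_(0 <= i < n) X i w) ^+ 2 +
  (2 * ((\sum_(0 <= i < n) X i w) * X n w) + X n w * X n w))); last first.
  by move=> w _; rewrite big_nat_recr//=; ring.
rewrite RintegralD//; last by apply: RintegrableD => //; exact: RintegrableZl.
rewrite RintegralD//; last exact: RintegrableZl.
rewrite RintegralZl//.
have h1 := cross n; have h2 := le_trans (ler_norm _) (bXX n n).
rewrite -[n.+1%:R]natr1 [leRHS]mulrDl mul1r; apply: lerD => //.
rewrite -[m.*2.+1%:R]natr1 -muln2 natrM.
move: h1 h2; lra.
Qed.

End comparison_of_products.

Section averages.
Context (R : realType) d (T : measurableType d) (P : probability T R).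
Variable phi : int -> {RV P >-> R}.
Hypothesis phi_iid : iid P phi.
Hypothesis phi_01 : forall n w, 0 <= phi n w <= 1.
Hypothesis phi_lt1 : (P [set w | phi 0%R w = 1%R] < 1)%E.
Variable alpha : R.
Hypothesis alpha01 : 0 < alpha < 1.

Local Notation W := (perpetuity phi).
Local Notation rho := (thinning_mean phi).

Let rho_lt1 : rho < 1. Proof. exact: thinning_mean_lt1. Qed.

Let mW m j : measurable_fun setT (W m j).
Proof. by apply: future_measurable; exact: future_perpetuity. Qed.

(** The indices of the environment that [perpetuity phi m j] depends on. *)
Definition window (j m : nat) : set int := [set i | j%:Z < i <= (j + m)%:Z].

Lemma window_perpetuity m j :
  measurable_fun (setT : set (g_sigma_algebraType (block_gen phi (window j m)))) (W m j).
Proof.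
elim: m j => [|m IH] j /=; first exact: measurable_cst.
apply: measurable_funD; first exact: measurable_cst.
apply: measurable_funM.
  apply: (block_measurable_coord (X := fun i => phi i : T -> R)).
  by rewrite /window/= !lez_nat ltz_nat ltnSn addnS ltnS leq_addr.
apply: (block_measurable_funS (X := fun i => phi i : T -> R)) (IH j.+1).
move=> i /= /andP[h1 h2]; rewrite addSnnS in h2; rewrite /window/= h2 andbT.
by apply: lt_trans h1; rewrite ltz_nat.
Qed.

Lemma perpetuity_disjoint m i j : (i + m <= j)%N ->
  independent_pair P (W m i) (W m j).
Proof.
move=> imj; apply: (block_independent_pair (X := fun i => phi i : T -> R)
  _ phi_iid.1 (A := window i m) (B := window j m)) => //.
- apply/seteqP; split => k //= [/andP[_ h1] /andP[h2 _]].
  by have := lt_le_trans h2 h1; rewrite ltz_nat ltnNge imj.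
- exact: window_perpetuity.
- exact: window_perpetuity.
Qed.

Let powW m j w : 1 <= W m j w `^ alpha <= W m j w.
Proof.
have /andP[al0 al1] := alpha01; have /andP[w1 _] := perpetuity_bounds phi_01 m j w.
rewrite ler1_powR// ?andbT; last exact: ltW.
have one : 1 `^ alpha = 1 :> R by rewrite powR1.
rewrite -[leLHS]one.
by apply: ge0_ler_powR; rewrite ?nnegrE ?(ltW al0)// (le_trans _ w1).
Qed.

(** A bounded function that is the identity on [0, B], so that the law of a
perpetuity, which is bounded by m + 1, determines its moments. *)
Let clip (B x : R) : R := Num.min (Num.max 0 x) B.

Let mpow : measurable_fun setT (fun x : R => x `^ alpha).
Proof. exact: measurable_powR. Qed.

Let mWa m j : measurable_fun setT (fun w => W m j w `^ alpha).
Proof. by apply: (measurableT_comp mpow). Qed.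

Let Wa_bound m j w : 0 <= W m j w `^ alpha <= m.+1%:R.
Proof.
have /andP[_ h2] := perpetuity_bounds phi_01 m j w; have /andP[h3 h4] := powW m j w.
by rewrite powR_ge0 (le_trans h4).
Qed.

Let iWa m j : P.-integrable setT (EFin \o (fun w => W m j w `^ alpha)).
Proof.
apply: (@bounded_integrable _ _ _ _ _ m.+1%:R) => // w.
by have /andP[h0 h1] := Wa_bound m j w; rewrite ger0_norm.
Qed.

Definition moment m : R := \int[P]_w (W m 0 w `^ alpha).

Lemma moment_stationary m j : \int[P]_w (W m j w `^ alpha) = moment m.
Proof.
pose h x : R := clip m.+1%:R (x `^ alpha).
have mh : measurable_fun setT h by apply: measurable_minr => //; exact: measurable_maxr.
have hM x : `|h x| <= m.+1%:R.
  by rewrite ger0_norm /h /clip ?ge_min ?lexx ?orbT// le_min le_max lexx/=.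
have hE i w : h (W m i w) = W m i w `^ alpha.
  by have /andP[h0 h1] := Wa_bound m i w; rewrite /h /clip (max_r h0) (min_l h1).
transitivity (\int[P]_w h (W m j w)); first by apply: eq_Rintegral => w _; rewrite hE.
rewrite (perpetuity_mean phi_iid m j mh hM).
by apply: eq_Rintegral => w _; rewrite hE.
Qed.

Lemma moment_ge1 m : 1 <= moment m.
Proof.
rewrite -[leLHS](Rintegral_prob_cst P); apply: le_Rintegral => //.
  by apply: unit_integrable; apply: unit_cst; rewrite ler01 lexx.
by move=> w _; have /andP[] := powW m 0 w.
Qed.

Let perpetuityS m j w : W m j w <= W m.+1 j w.
Proof.
elim: m j => [|m IH] j.
  rewrite /= lerDl mulr1.
  by have /andP[] := phi_01 j.+1 w.
change (1 + phi j.+1 w * W m j.+1 w <= 1 + phi j.+1 w * W m.+1 j.+1 w).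
rewrite lerD2l ler_wpM2l//.
by have /andP[] := phi_01 j.+1 w.
Qed.

Let moment_nd : nondecreasing_seq moment.
Proof.
apply/nondecreasing_seqP => m; apply: le_Rintegral => // w _.
have /andP[al0 _] := alpha01; have /andP[w1 _] := perpetuity_bounds phi_01 m 0 w.
have h := perpetuityS m 0 w.
have w0 : 0 <= W m 0 w by exact: le_trans w1.
by apply: ge0_ler_powR; rewrite ?nnegrE ?(ltW al0)//; exact: le_trans h.
Qed.

Let iW m j : P.-integrable setT (EFin \o W m j).
Proof.
apply: (@bounded_integrable _ _ _ _ _ m.+1%:R) => // w.
have /andP[h0 h1] := perpetuity_bounds phi_01 m j w.
by rewrite ger0_norm// (le_trans _ h0).
Qed.

Let mean_perpetuity m j : \int[P]_w W m j w <= (1 - rho)^-1.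
Proof.
have r0 := thinning_mean_ge0 phi_01; have r1 := rho_lt1.
elim: m j => [|m IH] j /=.
  rewrite Rintegral_prob_cst -[leLHS]invr1 lef_pV2 ?posrE ?subr_gt0//.
  by rewrite gerBl.
have bW w : `|W m j.+1 w| <= m.+1%:R.
  have /andP[h0 h1] := perpetuity_bounds phi_01 m j.+1 w.
  by rewrite ger0_norm// (le_trans _ h0).
rewrite RintegralD//; first last.
- apply: (@bounded_integrable _ _ _ _ _ m.+1%:R); first exact: measurable_funM.
  move=> w; rewrite normrM; apply: le_trans (bW w).
  by have /andP[h0 h1] := phi_01 j.+1 w; rewrite ger0_norm// ler_piMl.
- by apply: unit_integrable; apply: unit_cst; rewrite ler01 lexx.
rewrite Rintegral_prob_cst (mean_mul_future phi_iid phi_01 _ bW); last exact: future_perpetuity.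
have -> : (1 - rho)^-1 = 1 + rho * (1 - rho)^-1.
  by field; rewrite subr_eq0 eq_sym lt_eqF.
by rewrite lerD2l ler_wpM2l.
Qed.

(** Moments increase with [m], and W^alpha <= W bounds them by the mean of the full
perpetuity. *)
Lemma moment_cvg : cvg (moment m @[m --> \oo]).
Proof.
apply: (nondecreasing_is_cvgn moment_nd); exists (1 - rho)^-1 => _ [m _ <-].
apply: le_trans (mean_perpetuity m 0); apply: le_Rintegral => // w _.
by have /andP[] := powW m 0 w.
Qed.

Definition limit_moment : R := lim (moment m @[m --> \oo]).

Lemma limit_moment_gt0 : 0 < limit_moment.
Proof.
apply: (@lt_le_trans _ _ 1) => //; apply: limr_ge; first exact: moment_cvg.
by near=> m; exact: moment_ge1.
Unshelve. all: by end_near. Qed.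

Let centered m i w : R := W m i.+1 w `^ alpha - moment m.

Let mcentered m i : measurable_fun setT (centered m i).
Proof. exact: measurable_funB. Qed.

Let moment_le m : moment m <= m.+1%:R.
Proof.
rewrite -[leRHS](Rintegral_prob_cst P); apply: le_Rintegral => //.
  by apply: (@bounded_integrable _ _ _ _ _ m.+1%:R) => // w; rewrite ger0_norm.
by move=> w _; have /andP[] := Wa_bound m 0 w.
Qed.

Let centered_bound m i w : `|centered m i w| <= m.+1%:R.
Proof.
have /andP[h0 h1] := Wa_bound m i.+1 w; have h2 := moment_le m; have h3 := moment_ge1 m.
by rewrite /centered ler_norml; apply/andP; split; lra.
Qed.

Let centered_uncorrelated m i j : (i + m <= j)%N ->
  \int[P]_w (centered m i w * centered m j w) = 0.
Proof.
move=> imj; have imj' : (i.+1 + m <= j.+1)%N by rewrite addSn ltnS.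
have mean0 k : \int[P]_w centered m k w = 0.
  rewrite RintegralB//; last first.
    by apply: (@bounded_integrable _ _ _ _ _ `|moment m|).
  by rewrite moment_stationary Rintegral_prob_cst subrr.
have mf : measurable_fun setT (fun x : R => x `^ alpha - moment m).
  exact: measurable_funB.
rewrite (@integral_independent_mul _ _ _ P _ _ m.+1%:R m.+1%:R)//.
  by rewrite mean0 mul0r.
move=> U V mU mV; rewrite /centered.
have := @perpetuity_disjoint m i.+1 j.+1 imj'
  ((fun x => x `^ alpha - moment m) @^-1` U) ((fun x => x `^ alpha - moment m) @^-1` V).
apply; rewrite -[X in measurable X]setTI; exact: mf.
Qed.

(** The law of large numbers in L^1, from the variance bound and |x| <= e + x^2 / e. *)
Lemma mean_average_dist m n (e : R) : (0 < n)%N -> 0 < e ->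
  \int[P]_w `|n%:R^-1 * (\sum_(0 <= i < n) W m i.+1 w `^ alpha) - moment m| <=
  e + e^-1 * (n%:R^-1 * (m.*2.+1%:R * m.+1%:R ^+ 2)).
Proof.
move=> n0 e0; have nR0 : 0 < n%:R :> R by rewrite ltr0n.
have V := variance_mdependent (ler0n R m.+1) (mcentered m) (centered_bound m)
  (@centered_uncorrelated m) n.
have mS : measurable_fun setT (fun w => \sum_(0 <= i < n) centered m i w).
  exact: measurable_sum.
have bS w : `|\sum_(0 <= i < n) centered m i w| <= n%:R * m.+1%:R.
  apply: le_trans (ler_norm_sum _ _ _) _.
  apply: (@le_trans _ _ (\sum_(0 <= i < n) m.+1%:R)); first exact: ler_sum.
  by rewrite big_const_nat iter_addr subn0 addr0 mulr_natl.
have iS2 : P.-integrable setT (EFin \o (fun w => (\sum_(0 <= i < n) centered m i w) ^+ 2)).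
  apply: (@bounded_integrable _ _ _ _ _ ((n%:R * m.+1%:R) ^+ 2)); first exact: measurable_funX.
  by move=> w; rewrite normrX lerXn2r ?nnegrE// mulr_ge0.
have -> : \int[P]_w `|n%:R^-1 * (\sum_(0 <= i < n) W m i.+1 w `^ alpha) - moment m| =
    \int[P]_w `|n%:R^-1 * (\sum_(0 <= i < n) centered m i w)|.
  apply: eq_Rintegral => w _; congr (`|_|).
  rewrite /centered big_split/= sumrN big_const_nat iter_addr subn0 addr0.
  by rewrite -[moment m *+ n]mulr_natl mulrDr mulrN mulKf// gt_eqF.
have i0 : P.-integrable setT (EFin \o (fun=> e)).
  by apply: (@bounded_integrable _ _ _ _ _ e) => // w; rewrite gtr0_norm.
apply: (@le_trans _ _ (\int[P]_w (e + e^-1 * n%:R ^- 2 *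
    (\sum_(0 <= i < n) centered m i w) ^+ 2))); last first.
  rewrite RintegralD//; last exact: RintegrableZl.
  rewrite Rintegral_prob_cst RintegralZl// lerD2l -mulrA ler_wpM2l ?invr_ge0 ?(ltW e0)//.
  apply: (@le_trans _ _ (n%:R ^- 2 * (n%:R * (m.*2.+1%:R * m.+1%:R ^+ 2)))).
    by rewrite ler_wpM2l// invr_ge0 sqr_ge0.
  rewrite le_eqVlt; apply/orP; left; apply/eqP; field.
  by rewrite gt_eqF.
apply: le_Rintegral => //.
- apply: (@bounded_integrable _ _ _ _ _ (n%:R^-1 * (n%:R * m.+1%:R))).
    by apply: measurableT_comp; [exact: normr_measurable|exact: measurable_funM].
  by move=> w; rewrite normr_id normrM (@ger0_norm _ n%:R^-1) ?invr_ge0// ler_wpM2l ?invr_ge0.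
- by apply: RintegrableD => //; exact: RintegrableZl.
move=> w _; rewrite -mulrA -exprVn -exprMn.
move: (n%:R^-1 * _) => x; have [xe|/ltW ex] := leP `|x| e.
  by apply: le_trans xe _; rewrite lerDl mulr_ge0 ?sqr_ge0// invr_ge0 ltW.
apply: (@le_trans _ _ (e^-1 * x ^+ 2)); last by rewrite lerDr ltW.
by rewrite mulrC ler_pdivlMr// -[x ^+ 2]real_normK ?num_real// expr2 ler_wpM2l.
Qed.

End averages.

(** * The Laplace transform of the rescaled partial sums *)

Lemma dist_min1 (R : realType) (x y : R) : x <= 1 -> `|x - Num.min 1 y| <= `|x - y|.
Proof.
move=> x1; case: (leP 1 y) => // y1.
by rewrite distrC [leRHS]distrC !ger0_norm ?subr_ge0 ?lerD2r// (le_trans x1).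
Qed.

Lemma expRN_lipschitz (R : realType) (x y : R) : 0 <= x -> 0 <= y ->
  `|expR (- x) - expR (- y)| <= `|x - y|.
Proof.
wlog xy : x y / x <= y => [H x0 y0|x0 y0].
  have [xy|/ltW yx] := leP x y; first exact: H.
  by rewrite distrC (distrC x); exact: H.
rewrite [leRHS]distrC !ger0_norm ?subr_ge0 ?ler_expR ?lerN2//.
rewrite (_ : - y = - x + - (y - x)); last by ring.
rewrite expRD -{1}[expR (- x)]mulr1 -mulrBr.
have e1 := expR_ge1Dx (- (y - x)).
have /andP[h0 h1] := expRN_01 x0.
apply: (@le_trans _ _ (1 - expR (- (y - x)))); last by lra.
by rewrite ler_piMl// subr_ge0 -expR0 ler_expR oppr_le0 subr_ge0.
Qed.

Section laplace_limit.
Context (R : realType) d (T : measurableType d) (P : probability T R).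
Variables (phi : int -> {RV P >-> R}) (Z : int -> {RV P >-> nat})
  (B : int -> int -> {RV P >-> bool}).
Hypothesis model : rcinar_model phi Z B.
Hypothesis phi_lt1 : (P [set w | phi 0%R w = 1%R] < 1)%E.
Variables (alpha c : R) (b : nat -> R).
Hypothesis alpha01 : 0 < alpha < 1.
Hypothesis c_gt0 : 0 < c.
Hypothesis b_ge0 : forall n, 0 <= b n.
Hypothesis b_cvgy : b n @[n --> \oo] --> +oo.
Local Notation G := (defect P (Z 0)).
Hypothesis G_scaled : forall (x : nat -> R) (r : R), 0 < r ->
  (forall n, 0 <= x n <= 1) -> x n * b n @[n --> \oo] --> r ->
  n%:R * G (x n) @[n --> \oo] --> c * r `^ alpha.
Variable s : R.
Hypothesis s_gt0 : 0 < s.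

Let phi_iid' := phi_iid model.
Let phi_01' := phi_01 model.
Let mZ0 : measurable_fun setT (Z 0). Proof. exact: measurable_funP. Qed.

(** With this [q], the generating function of S_n is the Laplace transform of
S_n / b_n at [s]; [a n = 1 - q n] is equivalent to s / b_n. *)
Let q n : R := expR (- (s / b n)).
Let a n : R := 1 - q n.
Local Notation W := (perpetuity phi).
Local Notation rho := (thinning_mean phi).
Local Notation kappa := (1 - rho)^-1.
Let c' := c * s `^ alpha.

Let rho_lt1 : rho < 1. Proof. exact: thinning_mean_lt1. Qed.
Let rho_ge0 : 0 <= rho. Proof. exact: thinning_mean_ge0. Qed.

Let kappa_gt0 : 0 < kappa. Proof. by rewrite invr_gt0 subr_gt0. Qed.

Let c'_gt0 : 0 < c'. Proof. by rewrite mulr_gt0// powR_gt0. Qed.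

Let q01 n : 0 <= q n <= 1.
Proof. by apply: expRN_01; rewrite divr_ge0// ltW. Qed.

Let a01 n : 0 <= a n <= 1.
Proof. by have /andP[h0 h1] := q01 n; rewrite subr_ge0 h1 gerBl. Qed.

Let ab_cvg : a n * b n @[n --> \oo] --> s.
Proof. exact: onem_expR_scaled. Qed.

Let b_gt0 : \forall n \near \oo, 0 < b n.
Proof. by have /cvgryPgt/(_ 0) := b_cvgy. Qed.

Let a_cvg0 : a n @[n --> \oo] --> (0 : R).
Proof.
apply: (@near_cvg _ _ \oo _ (fun n => a n * b n * (b n)^-1)).
  by near=> n; rewrite mulfK// gt_eqF//; near: n.
rewrite -[X in _ --> X](mulr0 s); apply: cvgM => //.
by apply/gtr0_cvgV0.
Unshelve. all: by end_near. Qed.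

Let a_gt0 : \forall n \near \oo, 0 < a n.
Proof.
near=> n; have bn : 0 < b n by near: n; exact: b_gt0.
rewrite subr_gt0 /q -expR0 ltr_expR oppr_lt0 divr_gt0//.
Unshelve. all: by end_near. Qed.

Let unit_G (f : T -> R) : unit_fun f -> unit_fun (fun w => G (f w)).
Proof.
move=> uf; have := unit_onem (unit_pgf Z (unit_onem uf)).
congr unit_fun; apply/funext => w; rewrite defectE//.
by case: uf.
Qed.

Let pgf_prodE r (Psi : R -> R) k j w : pgf_prod phi r Psi k j w =
  \prod_(0 <= i < k) Psi (r * thinning phi r (k - i.+1) (j + i.+1) w).
Proof.
elim: k j => [|k IH] j; first by rewrite big_geq.
rewrite big_nat_recl//= subSS subn0 addn1; congr (_ * _).
by rewrite IH; apply: eq_bigr => i _; rewrite subSS addSnnS.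
Qed.

(** The factors of the exact formula.  They are replaced by [X'], where the excess
becomes the truncated perpetuity, and then by [Y], where the defect becomes its
power-law equivalent. *)
Let X n i w : R := 1 - G (excess phi (q n) (n - i.+1) i.+1 w).

Let meanX n : \int[P]_w q n ^+ partial_sum (rcinar Z B) n w =
  \int[P]_w \prod_(0 <= i < n) X n i w.
Proof.
rewrite (generating_function model (q01 n)); apply: eq_Rintegral => w _.
rewrite pgf_prodE; apply: eq_bigr => i _; rewrite add0n /X defectE//.
  by rewrite subKr excess_thinning subKr.
by have [-> ->] := excess_bounds phi_01' (n - i.+1) i.+1 w (q01 n).
Qed.

Section fixed_order.
Variable m : nat.

Let X' n i w : R := 1 - G (Num.min 1 (a n * W m i.+1 w)).
Let Y n i w : R := expR (- (c' / n%:R * W m i.+1 w `^ alpha)).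

Let mW j : measurable_fun setT (W m j).
Proof. by apply: future_measurable; exact: future_perpetuity. Qed.

Let W_ge0 j w : 0 <= W m j w.
Proof. by have /andP[h _] := perpetuity_bounds phi_01' m j w; exact: le_trans h. Qed.

Let unit_aW n i : unit_fun (fun w => Num.min 1 (a n * W m i.+1 w)).
Proof.
have /andP[a0 a1] := a01 n.
split; first by apply: measurable_minr => //; exact: measurable_funM.
by move=> w; rewrite le_min ler01 mulr_ge0//= ge_min lexx.
Qed.

Let unit_excess n k j : unit_fun (excess phi (q n) k j).
Proof.
split; first by apply: future_measurable; exact: future_excess.
by move=> w; have [-> ->] := excess_bounds phi_01' k j w (q01 n).
Qed.

Let unit_X n i : unit_fun (X n i).
Proof. by apply: unit_onem; exact: unit_G. Qed.

Let unit_X' n i : unit_fun (X' n i).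
Proof. by apply: unit_onem; apply: unit_G; exact: unit_aW. Qed.

Let unit_Y n i : unit_fun (Y n i).
Proof.
split; last by move=> w; apply: expRN_01; rewrite mulr_ge0 ?powR_ge0// divr_ge0// ltW.
apply: measurable_expRN; apply: measurable_funM => //.
by apply: (@measurableT_comp _ _ _ _ _ _ (fun x : R => x `^ alpha)); first exact: measurable_powR.
Qed.

Section fixed_scale.
(** The majorant [defect_slope] is used at the point [eps * a n]. *)
Variable eps : R.
Hypothesis eps01 : 0 < eps <= 1.

Let dist_X n i : 0 < a n -> \int[P]_w `|X n i w - X' n i w| <=
  G (eps * a n) * (1 + (\int[P]_w truncation_gap phi (q n) m (n - i.+1) i.+1 w) / (eps * a n)).
Proof.
move=> an; have /andP[e0 e1] := eps01; have /andP[_ a1] := a01 n.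
have ea0 : 0 < eps * a n by rewrite mulr_gt0.
have ea1 : eps * a n <= 1 by rewrite mulr_ile1// ltW.
have igap : P.-integrable setT (EFin \o truncation_gap phi (q n) m (n - i.+1) i.+1).
  apply: (@bounded_integrable _ _ _ _ _ ((1 - q n) * (maxn (n - i.+1) m).+1%:R)).
    by apply: future_measurable; exact: future_gap.
  by move=> w; rewrite ger0_norm ?normr_ge0//; exact: gap_bound.
have ione : P.-integrable setT (EFin \o (fun=> 1 : R)).
  by apply: unit_integrable; apply: unit_cst; rewrite ler01 lexx.
have igV : P.-integrable setT (EFin \o (fun w =>
    (eps * a n)^-1 * truncation_gap phi (q n) m (n - i.+1) i.+1 w)).
  exact: RintegrableZl.
have igV1 : P.-integrable setT (EFin \o (fun w =>
    1 + (eps * a n)^-1 * truncation_gap phi (q n) m (n - i.+1) i.+1 w)).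
  exact: RintegrableD.
rewrite [leRHS](_ : _ = \int[P]_w (G (eps * a n) *
    (1 + (eps * a n)^-1 * truncation_gap phi (q n) m (n - i.+1) i.+1 w))); last first.
  by rewrite RintegralZl// RintegralD// Rintegral_prob_cst RintegralZl// [X in 1 + X]mulrC.
apply: le_Rintegral => //.
- exact: unit_dist_integrable.
- exact: RintegrableZl.
move=> w _; rewrite distrC /X /X' (_ : _ - _ =
  G (excess phi (q n) (n - i.+1) i.+1 w) - G (Num.min 1 (a n * W m i.+1 w))); last by ring.
have [_ /(_ w) ue] := unit_excess n (n - i.+1) i.+1.
have [_ /(_ w) uw] := unit_aW n i.
have /andP[ue0 ue1] := ue; have /andP[uw0 uw1] := uw.
apply: le_trans (defect_dist P mZ0 ue uw) _.
set x := `|_ - _|.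
have x01 : 0 <= x <= 1.
  by rewrite normr_ge0/= ler_norml; apply/andP; split; lra.
apply: le_trans (defect_slope P mZ0 ea0 ea1 x01) _.
apply: ler_wpM2l; first by apply: defect_ge0 => //; rewrite (ltW ea0).
rewrite lerD2l mulrC ler_wpM2l ?invr_ge0 ?(ltW ea0)//.
exact: dist_min1.
Qed.

(** [edge_bound] is for the last [m] factors, which have too few steps ahead for
[main_bound]; there are boundedly many of them, so they disappear in the
limit. *)
Let main_bound n : R :=
  G (eps * a n) * (1 + (rho ^+ m * kappa + m%:R * (a n * kappa)) / eps).
Let edge_bound n : R := G (eps * a n) * (1 + m.+1%:R / eps).

Let sum_dist_X n : 0 < a n ->
  \sum_(0 <= i < n) \int[P]_w `|X n i w - X' n i w| <=
  n%:R * main_bound n + m%:R * edge_bound n.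
Proof.
move=> an; have /andP[e0 e1] := eps01; have /andP[a0 a1] := a01 n.
have ea0 : 0 < eps * a n by rewrite mulr_gt0.
have G0 : 0 <= G (eps * a n).
  by apply: defect_ge0 => //; rewrite (ltW ea0)/= mulr_ile1// ltW.
have mb0 : 0 <= main_bound n.
  rewrite mulr_ge0// addr_ge0// divr_ge0 ?(ltW e0)// addr_ge0// mulr_ge0 ?exprn_ge0//.
    exact: ltW.
  by rewrite mulr_ge0// ltW.
have eb0 : 0 <= edge_bound n by rewrite mulr_ge0// addr_ge0// divr_ge0// ltW.
apply: (@le_trans _ _ (\sum_(0 <= i < n)
    (main_bound n + (n - i.+1 < m)%N%:R * edge_bound n))).
  apply: ler_sum => i _; apply: le_trans (dist_X i an) _.
  have [nim|mni] := ltnP (n - i.+1) m.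
    rewrite mul1r -[leLHS]add0r lerD//; apply: ler_wpM2l => //.
    rewrite lerD2l ler_pdivrMr//.
    have -> : m.+1%:R / eps * (eps * a n) = a n * m.+1%:R.
      by field; rewrite gt_eqF.
    apply: le_trans (ler_norm _) _; apply: le_norm_Rintegral.
      by apply: future_measurable; exact: future_gap.
    move=> w; rewrite ger0_norm ?normr_ge0//.
    by have := gap_bound phi_01' m (n - i.+1) i.+1 w (q01 n); rewrite (maxn_idPr (ltnW nim)).
  rewrite mul0r addr0; apply: ler_wpM2l => //; rewrite lerD2l ler_pdivrMr//.
  have := mean_gap phi_iid' phi_01' rho_lt1 m (n - i.+1 - m) i.+1 (q01 n).
  rewrite subnKC// => /le_trans; apply; rewrite -/(a n).
  rewrite le_eqVlt; apply/orP; left; apply/eqP.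
  have enz : eps != 0 by rewrite gt_eqF.
  have rnz : 1 - rho != 0 by rewrite gt_eqF ?subr_gt0.
  by field; rewrite ?enz ?rnz.
rewrite big_split/= big_const_nat iter_addr addr0 subn0 mulr_natl lerD2l.
rewrite -mulr_suml; apply: ler_wpM2r => //; rewrite -natr_sum ler_nat.
apply: leq_trans (sum_ltn_le n m).
rewrite big_nat_rev add0n big_nat_cond [leqRHS]big_nat_cond.
apply: leq_sum => i /andP[/andP[_ ni] _].
have -> : (n - (n - i.+1).+1)%N = i by rewrite subnSK// subKn// ltnW.
by [].
Qed.

Let main_bound_cvg : n%:R * main_bound n + m%:R * edge_bound n @[n --> \oo] -->
  c' * eps `^ alpha * (1 + rho ^+ m * kappa / eps).
Proof.
have /andP[e0 e1] := eps01; have /andP[al0 _] := alpha01.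
have nG : n%:R * G (eps * a n) @[n --> \oo] --> c' * eps `^ alpha.
  rewrite /c' -mulrA -powRM ?(ltW s_gt0) ?(ltW e0)//.
  apply: G_scaled; first by rewrite mulr_gt0.
    by move=> n; have /andP[a0 a1] := a01 n; rewrite mulr_ge0 ?(ltW e0)// mulr_ile1// ltW.
  rewrite mulrC; apply: (@near_cvg _ _ \oo _ (fun n => eps * (a n * b n))).
    by near=> n; rewrite mulrA.
  exact: cvgMr.
have main : n%:R * main_bound n @[n --> \oo] --> c' * eps `^ alpha * (1 + rho ^+ m * kappa / eps).
  apply: (@near_cvg _ _ \oo _ (fun n => n%:R * G (eps * a n) *
    (1 + (rho ^+ m * kappa + m%:R * (a n * kappa)) / eps))).
    by near=> n; rewrite /main_bound -mulrA.
  apply: cvgM => //; apply: cvgD; first exact: cvg_cst.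
  apply: cvgMl; rewrite -[X in _ --> X]addr0; apply: cvgD; first exact: cvg_cst.
  by rewrite -(mulr0 m%:R); apply: cvgMr; rewrite -(mul0r kappa); exact: cvgMl.
have edge : m%:R * edge_bound n @[n --> \oo] --> (0 : R).
  apply: (@near_cvg _ _ \oo _ (fun n => n%:R * G (eps * a n) * n%:R^-1 *
    (m%:R * (1 + m.+1%:R / eps)))).
    near=> n; have n0 : n%:R != 0 :> R.
      by rewrite pnatr_eq0 -lt0n; near: n; exact: nbhs_infty_gt.
    have enz : eps != 0 by rewrite gt_eqF.
    by rewrite /edge_bound; field; rewrite ?enz ?n0.
  rewrite -(mul0r (m%:R * (1 + m.+1%:R / eps))); apply: cvgMl.
  rewrite -(mulr0 (c' * eps `^ alpha)); apply: cvgM => //.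
  by apply/gtr0_cvgV0; [near=> n; rewrite ltr0n; near: n; exact: nbhs_infty_gt|exact: cvgr_idn].
by rewrite -[X in _ --> X]addr0; exact: cvgD.
Unshelve. all: by end_near. Qed.

Lemma substitution_limit (e : R) : 0 < e -> \forall n \near \oo,
  \sum_(0 <= i < n) \int[P]_w `|X n i w - X' n i w| <
  c' * eps `^ alpha * (1 + rho ^+ m * kappa / eps) + e.
Proof.
move=> e0; near=> n.
have an : 0 < a n by near: n; exact: a_gt0.
apply: le_lt_trans (sum_dist_X an) _.
by near: n; apply: (cvgr_lt _ main_bound_cvg); rewrite ltrDl.
Unshelve. all: by end_near. Qed.

End fixed_scale.

Let clipped (x : R) : R := Num.min 1 (Num.max 0 x).

Let clipped01 x : 0 <= clipped x <= 1.
Proof. by rewrite le_min ler01 le_max lexx ge_min lexx. Qed.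

Let clipped_le x y : x <= y -> clipped x <= clipped y.
Proof.
move=> xy; rewrite /clipped le_min ge_min lexx/= ge_min ge_max !le_max lexx xy.
by rewrite !orbT.
Qed.

Let mG_clipped : measurable_fun setT (fun x : R => G (clipped x)).
Proof.
apply: nondecreasing_measurable => // x y xy.
have /andP[x0 x1] := clipped01 x; have /andP[y0 y1] := clipped01 y.
by apply: defect_le => //; exact: clipped_le.
Qed.

Let deviation n (x : R) : R := `|1 - G (clipped (a n * x)) -
  expR (- (c' / n%:R * Num.max 0 x `^ alpha))|.

Let deviationE n i w : `|X' n i w - Y n i w| = deviation n (W m i.+1 w).
Proof.
have w0 := W_ge0 i.+1 w; have /andP[a0 _] := a01 n.
by rewrite /X' /Y /deviation /clipped (max_r w0) max_r ?mulr_ge0.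
Qed.

Let rate_ge0 n (x : R) : 0 <= c' / n%:R * Num.max 0 x `^ alpha.
Proof. by rewrite mulr_ge0 ?powR_ge0// divr_ge0// ltW. Qed.

Let deviation_bound n x : `|deviation n x| <= 1.
Proof.
rewrite normr_id; have /andP[e0 e1] := expRN_01 (rate_ge0 n x).
have G0 := defect_ge0 P mZ0 (clipped01 (a n * x)).
have G1 := defect_le1 P mZ0 (clipped01 (a n * x)).
by rewrite ler_norml; apply/andP; split; lra.
Qed.

Let mdeviation n : measurable_fun setT (deviation n).
Proof.
apply: measurableT_comp; first exact: normr_measurable.
apply: measurable_funB.
  apply: measurable_funB => //.
  by apply: (measurableT_comp mG_clipped); exact: measurable_funM.
apply: measurable_expRN; apply: measurable_funM => //.
apply: (@measurableT_comp _ _ _ _ _ _ (fun x : R => x `^ alpha)); first exact: measurable_powR.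
exact: measurable_maxr.
Qed.

(** By stationarity the sum is n times its first term, and n can be taken inside the
expectation. *)
Let sum_deviation n : \sum_(0 <= i < n) \int[P]_w `|X' n i w - Y n i w| =
  n%:R * \int[P]_w deviation n (W m 0 w).
Proof.
transitivity (\sum_(0 <= i < n) \int[P]_w deviation n (W m 0 w)).
  apply: eq_bigr => i _.
  apply: eq_trans (perpetuity_mean phi_iid' m i.+1 (mdeviation n) (deviation_bound n)).
  by apply: eq_Rintegral => w _; exact: deviationE.
by rewrite big_const_nat iter_addr subn0 addr0 mulr_natl.
Qed.

Let scaled_G (x : R) : 1 <= x ->
  n%:R * G (clipped (a n * x)) @[n --> \oo] --> c' * x `^ alpha.
Proof.
move=> x1; have x0 : 0 < x by exact: lt_le_trans x1.
rewrite /c' -mulrA -powRM ?(ltW s_gt0) ?(ltW x0)//.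
apply: G_scaled; [by rewrite mulr_gt0|by move=> n; exact: clipped01|].
apply: (@near_cvg _ _ \oo _ (fun n => a n * b n * x)); last exact: cvgMl.
near=> n; have /andP[a0 _] := a01 n.
have ax : a n < x^-1 by near: n; apply: (cvgr_lt _ a_cvg0); rewrite invr_gt0.
rewrite /clipped max_r ?mulr_ge0 ?(ltW x0)// min_r; first by rewrite mulrAC.
by rewrite -ler_pdivlMr// div1r ltW.
Unshelve. all: by end_near. Qed.

Let scaled_exp (x : R) : 0 < x ->
  n%:R * (1 - expR (- (x / n%:R))) @[n --> \oo] --> x.
Proof.
move=> x0; apply: (@near_cvg _ _ \oo _ (fun n => (1 - expR (- (x / n%:R))) * n%:R)).
  by near=> n; rewrite mulrC.
by apply: onem_expR_scaled => //; exact: cvgr_idn.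
Unshelve. all: by end_near. Qed.

(** Inside the expectation both n G (a_n W) and n (1 - exp (- c' W^alpha / n)) tend to
c' W^alpha, and W is bounded by m + 1. *)
Lemma linearization_limit :
  \sum_(0 <= i < n) \int[P]_w `|X' n i w - Y n i w| @[n --> \oo] --> (0 : R).
Proof.
under eq_fun do rewrite sum_deviation.
have /andP[al0 _] := alpha01.
have [K [_ HK]] := cvg_seq_bounded (cvgP _ (scaled_G (ler1n R m.+1))).
pose M := `|K| + 1 + c' * m.+1%:R `^ alpha.
have Wb w : 1 <= W m 0 w <= m.+1%:R by exact: perpetuity_bounds.
have [||||||_ H] := @Rdominated_cvg _ _ _ P setT
  (fun n w => n%:R * deviation n (W m 0 w)) (fun=> 0) (fun=> M) => //.
- move=> n; apply: measurable_funM => //.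
  by apply: (measurableT_comp (mdeviation n)).
- move=> w _; have /andP[w1 _] := Wb w; have w0 : 0 < W m 0 w by exact: lt_le_trans w1.
  have wa0 : 0 < c' * W m 0 w `^ alpha by rewrite mulr_gt0// powR_gt0.
  have L := cvgB (scaled_exp wa0) (scaled_G w1).
  rewrite subrr in L.
  apply: (@near_cvg _ _ \oo _ (fun n => `|n%:R * (1 - expR (- (c' * W m 0 w `^ alpha / n%:R)))
     - n%:R * G (clipped (a n * W m 0 w))|)).
    near=> n; rewrite -mulrBr normrM (ger0_norm (ler0n _ n)) /deviation max_r ?(ltW w0)//.
    rewrite (mulrAC c'); congr (_ * `|_|).
    by ring.
  apply/cvgrPdist_lt => r r0; have /cvgrPdist_lt/(_ _ r0) := L eventually_filter.
  by apply: filterS => k; rewrite !sub0r !normrN normr_id.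
- by apply: (@bounded_integrable _ _ _ _ _ `|M|).
- move=> n w _; rewrite normrM (ger0_norm (ler0n _ n)).
  have /andP[w1 wm] := Wb w; have w0 : 0 < W m 0 w by exact: lt_le_trans w1.
  have c0 := ltW c'_gt0; have /andP[an0 _] := a01 n.
  have G0 := defect_ge0 P mZ0 (clipped01 (a n * W m 0 w)).
  have /andP[e0 e1] := expRN_01 (rate_ge0 n (W m 0 w)).
  have hG : n%:R * G (clipped (a n * W m 0 w)) <= `|K| + 1.
    apply: (@le_trans _ _ (n%:R * G (clipped (a n * m.+1%:R)))).
      apply: (ler_wpM2l (ler0n R n)); have /andP[x0 x1] := clipped01 (a n * W m 0 w).
      have /andP[y0 y1] := clipped01 (a n * m.+1%:R).
      apply: defect_le => //; apply: clipped_le; exact: (ler_wpM2l an0 wm).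
    apply: le_trans (ler_norm _) _; apply: HK => //.
    by rewrite ltr_pwDr// ler_norm.
  have hE : n%:R * (1 - expR (- (c' / n%:R * Num.max 0 (W m 0 w) `^ alpha))) <=
      c' * m.+1%:R `^ alpha.
    case: n {hG e0 e1 G0 an0} => [|n].
      by rewrite mul0r mulr_ge0// powR_ge0.
    rewrite mulrC -ler_pdivlMr//.
    have h := expR_ge1Dx (- (c' / n.+1%:R * Num.max 0 (W m 0 w) `^ alpha)).
    apply: (@le_trans _ _ (c' / n.+1%:R * Num.max 0 (W m 0 w) `^ alpha)).
      by rewrite lerBlDl -lerBlDr.
    rewrite mulrAC ler_wpM2r ?invr_ge0// ler_wpM2l// max_r ?(ltW w0)//.
    by apply: ge0_ler_powR; rewrite ?nnegrE ?(ltW al0) ?(ltW w0).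
  apply: (@le_trans _ _ (n%:R * (1 - expR (- (c' / n%:R * Num.max 0 (W m 0 w) `^ alpha))
      + G (clipped (a n * W m 0 w))))).
    apply: (ler_wpM2l (ler0n R n)); rewrite /deviation normr_id.
    by rewrite ler_norml; apply/andP; split; lra.
  by rewrite mulrDr /M addrC lerD.
move: H; rewrite Rintegral_prob_cst; apply: cvg_trans; apply: near_eq_cvg; near=> n.
rewrite RintegralZl//; apply: (@bounded_integrable _ _ _ _ _ 1) => //.
by apply: (measurableT_comp (mdeviation n)).
Unshelve. all: by end_near. Qed.

Let prodY n w : \prod_(0 <= i < n) Y n i w =
  expR (- (c' * (n%:R^-1 * \sum_(0 <= i < n) W m i.+1 w `^ alpha))).
Proof.
rewrite !mulrA mulr_sumr -sumrN.
elim: {1 3}n => [|k IH]; first by rewrite !big_geq// expR0.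
by rewrite !big_nat_recr//= IH expRD.
Qed.

Local Notation mom := (moment phi alpha m).

Lemma average_limit : \int[P]_w \prod_(0 <= i < n) Y n i w @[n --> \oo] -->
  expR (- (c' * mom)).
Proof.
apply/cvgrPdist_le => e e0.
have c0 := ltW c'_gt0.
have mom0 : 0 <= mom by apply: le_trans (moment_ge1 phi_01' alpha01 m).
pose r := e / (2 * c'); have r0 : 0 < r by rewrite divr_gt0// mulr_gt0.
pose C : R := m.*2.+1%:R * m.+1%:R ^+ 2.
have C_cvg : r^-1 * (n%:R^-1 * C) @[n --> \oo] --> (0 : R).
  rewrite -(mulr0 r^-1); apply: cvgMr; rewrite -(mul0r C); apply: cvgMl.
  by apply/gtr0_cvgV0; [near=> n; rewrite ltr0n; near: n; exact: nbhs_infty_gt|exact: cvgr_idn].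
near=> n.
have n0 : (0 < n)%N by near: n; exact: nbhs_infty_gt.
have Cn : r^-1 * (n%:R^-1 * C) < r by near: n; exact: (cvgr_lt _ C_cvg).
have D := mean_average_dist phi_iid' phi_01' alpha01 m n0 r0.
have mav : measurable_fun setT (fun w => n%:R^-1 * \sum_(0 <= i < n) W m i.+1 w `^ alpha).
  apply: measurable_funM => //; apply: measurable_sum => i.
  by apply: (@measurableT_comp _ _ _ _ _ _ (fun x : R => x `^ alpha)); first exact: measurable_powR.
have av0 w : 0 <= n%:R^-1 * \sum_(0 <= i < n) W m i.+1 w `^ alpha.
  by rewrite mulr_ge0 ?invr_ge0// sumr_ge0// => i _; exact: powR_ge0.
have uprod : unit_fun (fun w => \prod_(0 <= i < n) Y n i w).
  by apply: unit_prod => i; exact: unit_Y.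
have ucst : unit_fun (fun _ : T => expR (- (c' * mom))).
  by apply: unit_cst; apply: expRN_01; rewrite mulr_ge0.
rewrite -(Rintegral_prob_cst P (expR (- (c' * mom)))) -RintegralB//;
  [|exact: unit_integrable|exact: unit_integrable].
apply: le_trans (le_normr_Rintegral _ _) _ => //.
  by apply: RintegrableB => //; exact: unit_integrable.
have iav : P.-integrable setT (EFin \o (fun w =>
    `|n%:R^-1 * (\sum_(0 <= i < n) W m i.+1 w `^ alpha) - mom|)).
  apply: (@bounded_integrable _ _ _ _ _ (n%:R^-1 * (n%:R * m.+1%:R) + mom)).
    by apply: measurableT_comp; [exact: normr_measurable|exact: measurable_funB].
  move=> w; rewrite normr_id; apply: le_trans (ler_normB _ _) _.
  rewrite (ger0_norm mom0) lerD2r ger0_norm// ler_wpM2l ?invr_ge0//.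
  apply: (@le_trans _ _ (\sum_(0 <= i < n) m.+1%:R)).
    apply: ler_sum => i _; have /andP[w1 wm] := perpetuity_bounds phi_01' m i.+1 w.
    by apply: le_trans wm; apply: ler1_powR => //; case/andP: alpha01 => _ /ltW.
  by rewrite big_const_nat iter_addr subn0 addr0 mulr_natl.
apply: (@le_trans _ _ (\int[P]_w (c' *
    `|n%:R^-1 * (\sum_(0 <= i < n) W m i.+1 w `^ alpha) - mom|))).
  apply: le_Rintegral => //.
  - exact: unit_dist_integrable.
  - exact: RintegrableZl.
  move=> w _; rewrite prodY distrC; apply: le_trans (expRN_lipschitz _ _) _.
  - by rewrite mulr_ge0.
  - by rewrite mulr_ge0.
  by rewrite -mulrBr normrM (ger0_norm c0).
rewrite RintegralZl// mulrC -ler_pdivlMr//.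
apply: le_trans D _; rewrite -/C.
have : r + r = e / c' by rewrite /r; field; rewrite gt_eqF.
by move: Cn; lra.
Unshelve. all: by end_near. Qed.

Lemma laplace_error (eps e : R) : 0 < eps <= 1 -> 0 < e ->
  \forall n \near \oo,
  `|\int[P]_w expR (- (s / b n)) ^+ partial_sum (rcinar Z B) n w -
    expR (- (c * s `^ alpha * mom))| <
  c * s `^ alpha * eps `^ alpha * (1 + rho ^+ m * kappa / eps) + e.
Proof.
move=> eps01 e0; have e3 : 0 < e / 3 by rewrite divr_gt0.
have H1 := substitution_limit eps01 e3.
have H2 : \forall n \near \oo, \sum_(0 <= i < n) \int[P]_w `|X' n i w - Y n i w| < e / 3.
  exact: (cvgr_lt _ linearization_limit).
have /cvgrPdist_lt/(_ _ e3) H3 := average_limit.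
near=> n.
have h1 : \sum_(0 <= i < n) \int[P]_w `|X n i w - X' n i w| <
  c' * eps `^ alpha * (1 + rho ^+ m * kappa / eps) + e / 3.
  by near: n; exact: H1.
have h2 : \sum_(0 <= i < n) \int[P]_w `|X' n i w - Y n i w| < e / 3.
  by near: n; exact: H2.
have h3 : `|expR (- (c' * mom)) - \int[P]_w \prod_(0 <= i < n) Y n i w| < e / 3.
  by near: n; exact: H3.
have k1 := dist_mean_prod P (index_iota 0 n) (unit_X n) (unit_X' n).
have k2 := dist_mean_prod P (index_iota 0 n) (unit_X' n) (unit_Y n).
rewrite -/(q n) -/c' meanX.
move: h1 h2 h3 k1 k2.
move: (\sum_(0 <= i < n) \int[P]_w `|X n i w - X' n i w|)
  (\sum_(0 <= i < n) \int[P]_w `|X' n i w - Y n i w|) (expR (- (c' * mom)))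
  (\int[P]_w \prod_(0 <= i < n) X n i w) (\int[P]_w \prod_(0 <= i < n) X' n i w)
  (\int[P]_w \prod_(0 <= i < n) Y n i w)
  (c' * eps `^ alpha * (1 + rho ^+ m * kappa / eps)) => x1 x2 x3 x4 x5 x6 x7.
move=> h1 h2; rewrite !ltr_norml !ler_norml => /andP[? ?] /andP[? ?] /andP[? ?].
by apply/andP; split; lra.
Unshelve. all: by end_near. Qed.

End fixed_order.

(** First eps is chosen small, to control the term that does not involve [m], and then
[m] large, depending on eps. *)
Let small_scale (e : R) : 0 < e -> exists2 eps : R, 0 < eps <= 1 &
  c * s `^ alpha * eps `^ alpha < e.
Proof.
move=> e0; have /andP[al0 _] := alpha01.
have : c' * x `^ alpha @[x --> 0^'+] --> (0 : R).
  by rewrite -[X in _ --> X](mulr0 c'); apply: cvgMr; exact: powR_cvg0.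
move=> /cvgr_lt/(_ _ e0) H.
near (0 : R)^'+ => eps; exists eps.
  by apply/andP; split; near: eps; [exact: nbhs_right_gt|exact: nbhs_right_le].
by near: eps.
Unshelve. all: by end_near. Qed.

(** For fixed [m] the three replacements give the limit up to an error that does not
vanish with n; it vanishes when [m] tends to infinity and then eps to 0. *)
Theorem laplace_partial_sum :
  laplace P (fun w => (b n)^-1 * (partial_sum (rcinar Z B) n w)%:R) s @[n --> \oo] -->
  expR (- (c * limit_moment phi alpha * s `^ alpha)).
Proof.
apply: (@near_cvg _ _ \oo _ (fun n =>
    \int[P]_w expR (- (s / b n)) ^+ partial_sum (rcinar Z B) n w)).
  near=> n; apply: eq_Rintegral => w _; rewrite -expRM_natl; congr expR.
  by ring.
rewrite mulrAC -/c'; apply/cvgrPdist_lt => e e0.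
have e5 : 0 < e / 5 by rewrite divr_gt0.
have [eps eps01 ceps] := small_scale e5; have /andP[eps0 eps1] := eps01.
have Lm : expR (- (c' * moment phi alpha m)) @[m --> \oo] -->
    expR (- (c' * limit_moment phi alpha)).
  apply: (cvg_comp (fun m => - (c' * moment phi alpha m))); last exact: continuous_expR.
  apply: cvgN; apply: cvgMr; exact: moment_cvg.
have Lr : c' * eps `^ alpha * (1 + rho ^+ m * kappa / eps) @[m --> \oo] -->
    c' * eps `^ alpha.
  rewrite -[X in _ --> X]mulr1; apply: cvgMr.
  rewrite -[X in _ --> X]addr0; apply: cvgD; first exact: cvg_cst.
  rewrite -(mul0r (eps^-1)); apply: cvgMl; rewrite -(mul0r kappa); apply: cvgMl.
  by apply: cvg_expr; rewrite ger0_norm.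
have /cvgrPdist_lt/(_ _ e5) Hm := Lm.
have Hr := cvgr_lt _ Lr _ ceps.
near \oo => m.
have hm : `|expR (- (c' * limit_moment phi alpha)) - expR (- (c' * moment phi alpha m))| < e / 5.
  by near: m; exact: Hm.
have hr : c' * eps `^ alpha * (1 + rho ^+ m * kappa / eps) < e / 5.
  by near: m; exact: Hr.
have := @laplace_error m eps (e / 5) eps01 e5; apply: filterS => n.
rewrite -/c'; move: hm hr.
move: (expR (- (c' * limit_moment phi alpha))) (expR (- (c' * moment phi alpha m)))
  (c' * eps `^ alpha * (1 + rho ^+ m * kappa / eps))
  (\int[P]_w _) => x1 x2 x3 x4.
rewrite !ltr_norml => /andP[? ?] ? /andP[? ?].
by apply/andP; split; lra.
Unshelve. all: by end_near. Qed.

End laplace_limit.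

(** * Complex transforms of sums of independent variables *)

Section complex_powers.
Context (R : realType).

(** exp (- (u - i v)), in coordinates. *)
Definition polar (u v : R) : R[i] := ((expR (- u) * cos v) +i* (expR (- u) * sin v))%C.

Lemma polarD u1 u2 v1 v2 : polar (u1 + u2) (v1 + v2) = polar u1 v1 * polar u2 v2.
Proof.
rewrite /polar opprD expRD cosD sinD; apply/eqP.
by rewrite eq_complex /=; apply/andP; split; apply/eqP; ring.
Qed.

Lemma polarX u v n : polar u v ^+ n = polar (n%:R * u) (n%:R * v).
Proof.
elim: n => [|n IH].
  by rewrite expr0 !mul0r /polar oppr0 expR0 cos0 sin0 mulr1 mulr0.
by rewrite exprS IH -polarD -natr1 !mulrDl !mul1r addrC [v + _]addrC.
Qed.

Lemma normc_polar u v : Normc.normc (polar u v) = expR (- u).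
Proof.
rewrite /Normc.normc /polar !exprMn -mulrDr cos2Dsin2 mulr1 sqrtr_sqr.
by rewrite ger0_norm// expR_ge0.
Qed.

Lemma normc_le_sum (x y : R) : Normc.normc (x +i* y)%C <= `|x| + `|y|.
Proof.
rewrite /Normc.normc -[leRHS]ger0_norm ?addr_ge0// -sqrtr_sqr ler_wsqrtr//.
rewrite sqrrD !real_normK ?num_real// addrAC lerDl.
by rewrite mulrn_wge0// mulr_ge0.
Qed.

Lemma le_normc_Re (z : R[i]) : `|complex.Re z| <= Normc.normc z.
Proof.
case: z => x y /=; rewrite -sqrtr_sqr ler_wsqrtr// lerDl; exact: sqr_ge0.
Qed.

Lemma le_normc_Im (z : R[i]) : `|complex.Im z| <= Normc.normc z.
Proof.
case: z => x y /=; rewrite -sqrtr_sqr ler_wsqrtr// lerDr; exact: sqr_ge0.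
Qed.

Lemma normc_dist_expr (x y : R[i]) n : Normc.normc x <= 1 -> Normc.normc y <= 1 ->
  Normc.normc (x ^+ n - y ^+ n) <= n%:R * Normc.normc (x - y).
Proof.
move=> x1 y1; elim: n => [|n IH]; first by rewrite !expr0 subrr Normc.normc0 mul0r.
have n0 z : 0 <= Normc.normc z :> R by case: z => ? ?; exact: sqrtr_ge0.
have xn1 : Normc.normc (x ^+ n) <= 1.
  elim: n {IH} => [|n IH]; first by rewrite expr0 Normc.normc1.
  by rewrite exprS Normc.normcM mulr_ile1.
rewrite !exprS (_ : x * x ^+ n - y * y ^+ n = (x - y) * x ^+ n + y * (x ^+ n - y ^+ n)).
  apply: le_trans (le_normcD _ _) _; rewrite !Normc.normcM -natr1 mulrDl mul1r addrC.
  apply: lerD; first by apply: le_trans IH; rewrite ler_piMl.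
  by rewrite ler_piMr.
by ring.
Qed.

Lemma derivative_along_harmonic (f : R -> R) (l u : R) : 0 < u ->
  f 0 = 0 -> is_derive (0 : R) 1 f l ->
  n%:R * f (u / n%:R) @[n --> \oo] --> u * l.
Proof.
move=> u0 f0 df.
case: df => D E; have {D E}H : h^-1 *: (f (h *: 1 + 0) - f 0) @[h --> 0^'] --> l.
  by rewrite -E; exact: D.
rewrite -(cvg_shiftS (fun n => n%:R * f (u / n%:R))).
have hn : u / n.+1%:R @[n --> \oo] --> (0 : R).
  by rewrite -(mulr0 u); apply: cvgMr; exact: cvg_harmonic.
have up n : 0 < u / n.+1%:R by rewrite divr_gt0.
have H' := (cvg_at_rightP _ _ _).1 (cvg_dnbhs_at_right H) _ (conj up hn).
apply: (@near_cvg _ _ \oo _ (fun n => u * ((u / n.+1%:R)^-1 *: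
    (f ((u / n.+1%:R) *: 1 + 0) - f 0)))).
  near=> n; rewrite f0 subr0 addr0 /GRing.scale/= mulr1.
  by rewrite invf_div mulrA [u * _]mulrC divfK// gt_eqF.
exact: cvgMr.
Unshelve. all: by end_near. Qed.

(** The complex form of (1 - z_n / n)^n --> exp (- z).  Rather than with
logarithms, x_n is compared with exp (- z / n), which has the right n-th power,
and n |x_n - exp (- z / n)| tends to 0. *)
Lemma complex_power_limit (x : nat -> R[i]) (u v : R) : 0 < u ->
  (forall n, Normc.normc (x n) <= 1) ->
  n%:R * (1 - complex.Re (x n)) @[n --> \oo] --> u ->
  n%:R * complex.Im (x n) @[n --> \oo] --> v ->
  complex.Re (x n ^+ n) @[n --> \oo] --> expR (- u) * cos v /\
  complex.Im (x n ^+ n) @[n --> \oo] --> expR (- u) * sin v.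
Proof.
move=> u0 x1 xu xv; pose t := v / u.
(* A real ratio t = v / u reduces the derivative at 0 to that of functions of one variable. *)
have vE : v = u * t by rewrite /t mulrC divfK// gt_eqF.
have vn n : v / n%:R = t * (u / n%:R) by rewrite {1}vE; ring.
pose y n := polar (u / n%:R) (v / n%:R).
have yu : n%:R * (1 - complex.Re (y n)) @[n --> \oo] --> u.
  have := @derivative_along_harmonic (fun h => 1 - expR (- h) * cos (t * h)) 1 u u0.
  rewrite oppr0 expR0 mulr0 cos0 mulr1 subrr mulr1 => /(_ erefl) H.
  apply: (@near_cvg _ _ \oo _ (fun n => n%:R *
      (1 - expR (- (u / n%:R)) * cos (t * (u / n%:R))))).
    by near=> n; rewrite /y /polar /= vn.
  apply: H; have D := is_derive_expRN_cosM t (0 : R).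
  have := is_deriveD (is_derive_cst (1 : R) (0 : R) 1) D.
  by rewrite mulr0 cos0 sin0 oppr0 expR0 mulr0 addr0 mulr1 add0r.
have yv : n%:R * complex.Im (y n) @[n --> \oo] --> v.
  have := @derivative_along_harmonic (fun h => expR (- h) * sin (t * h)) t u u0.
  rewrite oppr0 expR0 mulr0 sin0 mulr0 -vE => /(_ erefl) H.
  apply: (@near_cvg _ _ \oo _ (fun n => n%:R *
      (expR (- (u / n%:R)) * sin (t * (u / n%:R))))).
    by near=> n; rewrite /y /polar /= vn.
  apply: H; have := is_derive_expRN_sinM t (0 : R).
  by rewrite mulr0 cos0 sin0 oppr0 expR0 addr0 !mulr1.
have dist_cvg : n%:R * Normc.normc (x n - y n) @[n --> \oo] --> (0 : R).
  have ub : n%:R * `|complex.Re (x n) - complex.Re (y n)| +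
      n%:R * `|complex.Im (x n) - complex.Im (y n)| @[n --> \oo] --> (0 : R).
    rewrite -[X in _ --> X]addr0; apply: cvgD.
      apply: (@near_cvg _ _ \oo _ (fun n => `|n%:R * (1 - complex.Re (y n)) -
          n%:R * (1 - complex.Re (x n))|)).
        near=> n; rewrite -mulrBr normrM (ger0_norm (ler0n _ n)).
        by rewrite (_ : 1 - _ - _ = complex.Re (x n) - complex.Re (y n))//; ring.
      have := cvg_norm (cvgB yu xu); rewrite subrr normr0; exact.
    apply: (@near_cvg _ _ \oo _ (fun n => `|n%:R * complex.Im (x n) -
        n%:R * complex.Im (y n)|)).
      by near=> n; rewrite -mulrBr normrM (ger0_norm (ler0n _ n)).
    have := cvg_norm (cvgB xv yv); rewrite subrr normr0; exact.
  apply: (squeeze_cvgr _ (cvg_cst (0 : R)) ub).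
  near=> n; apply/andP; split.
    rewrite mulr_ge0//; by case: (_ - _) => ? ?; exact: sqrtr_ge0.
  rewrite -mulrDr ler_wpM2l//.
  case: (x n) (y n) => [a b] [a' b']; exact: normc_le_sum.
have y1 n : Normc.normc (y n) <= 1.
  by rewrite normc_polar; have /andP[] := expRN_01 (divr_ge0 (ltW u0) (ler0n R n)).
have yn : \forall n \near \oo, y n ^+ n = polar u v.
  near=> n; have n0 : n%:R != 0 :> R.
    by rewrite pnatr_eq0 -lt0n; near: n; exact: nbhs_infty_gt.
  by rewrite polarX ![n%:R * (_ / _)]mulrC !divfK.
have pow_dist n : Normc.normc (x n ^+ n - y n ^+ n) <= n%:R * Normc.normc (x n - y n).
  exact: normc_dist_expr.
split; apply/cvgrPdist_le => e e0; have /cvgrPdist_le/(_ _ e0) H := dist_cvg.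
  near=> n.
  have h : `|0 - n%:R * Normc.normc (x n - y n)| <= e by near: n; exact: H.
  have yn' : y n ^+ n = polar u v by near: n; exact: yn.
  apply: le_trans h; rewrite sub0r normrN distrC.
  apply: le_trans (ler_norm _); apply: le_trans (pow_dist n).
  by rewrite yn'; apply: le_trans (le_normc_Re _); rewrite raddfB.
near=> n.
have h : `|0 - n%:R * Normc.normc (x n - y n)| <= e by near: n; exact: H.
have yn' : y n ^+ n = polar u v by near: n; exact: yn.
apply: le_trans h; rewrite sub0r normrN distrC.
apply: le_trans (ler_norm _); apply: le_trans (pow_dist n).
by rewrite yn'; apply: le_trans (le_normc_Im _); rewrite raddfB.
Unshelve. all: by end_near. Qed.

End complex_powers.

Section iid_sums.
Context (R : realType) d (T : measurableType d) (P : probability T R).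
Variable Z : int -> {RV P >-> nat}.
Hypothesis Z_iid : iid P Z.

Definition integer_sum (n : nat) (w : T) : R := \sum_(1 <= k < n.+1) (Z k%:Z w)%:R.

(** E exp (- (1 - i t) V). *)
Definition twisted_laplace (t : R) (V : T -> R) : R[i] :=
  ((\int[P]_w (expR (- V w) * cos (t * V w))) +i*
   (\int[P]_w (expR (- V w) * sin (t * V w))))%C.

Section fixed.
Variables (r t : R).
Hypothesis r_ge0 : 0 <= r.

Let C (x : R) : R := expR (- (r * x)) * cos (t * (r * x)).
Let S (x : R) : R := expR (- (r * x)) * sin (t * (r * x)).

Let CS_bound (x : R) : 0 <= x -> `|C x| <= 1 /\ `|S x| <= 1.
Proof.
move=> x0; have /andP[e0 e1] := expRN_01 (mulr_ge0 r_ge0 x0).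
by split; rewrite normrM (ger0_norm e0) mulr_ile1// ?norm_cos_le1 ?norm_sin_le1.
Qed.

Let mC : measurable_fun setT C.
Proof.
apply: measurable_funM; first by apply: measurable_expRN; exact: measurable_funM.
apply: measurableT_comp; first exact: (continuous_measurable_fun (@continuous_cos R)).
by apply: measurable_funM => //; exact: measurable_funM.
Qed.

Let mS : measurable_fun setT S.
Proof.
apply: measurable_funM; first by apply: measurable_expRN; exact: measurable_funM.
apply: measurableT_comp; first exact: (continuous_measurable_fun (@continuous_sin R)).
by apply: measurable_funM => //; exact: measurable_funM.
Qed.

Definition past_block (n : nat) : set (set T) := block_gen Z [set i : int | i <= n%:Z].

Let mZR k (A : set int) : A k ->
  measurable_fun (setT : set (g_sigma_algebraType (block_gen Z A))) (fun w => (Z k w)%:R : R).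
Proof.
move=> Ak; apply: (measurable_nat_comp (fun n => n%:R : R)).
by apply: (block_measurable_coord (X := fun i => Z i : T -> nat)).
Qed.

Let integer_sumS n w : integer_sum n.+1 w = integer_sum n w + (Z n.+1 w)%:R.
Proof. by rewrite /integer_sum big_nat_recr. Qed.

Let past_sum n :
  measurable_fun (setT : set (g_sigma_algebraType (past_block n))) (integer_sum n).
Proof.
elim: n => [|n IH].
  rewrite (_ : integer_sum 0 = fun=> 0); first exact: measurable_cst.
  by apply/funext => w; rewrite /integer_sum big_geq.
rewrite (_ : integer_sum n.+1 = fun w => integer_sum n w + (Z n.+1 w)%:R); last first.
  by apply/funext => w; exact: integer_sumS.
apply: measurable_funD; last by apply: mZR => /=.
apply: (block_measurable_funS (X := fun i => Z i : T -> nat)) IH => i /= h.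
by apply: le_trans h _; rewrite lez_nat.
Qed.

Lemma measurable_integer_sum n : measurable_fun setT (integer_sum n).
Proof.
apply: measurable_sum => k; apply: (measurable_nat_comp (fun n => n%:R : R)).
exact: measurable_funP.
Qed.

Lemma integer_sum_ge0 n w : 0 <= integer_sum n w.
Proof. exact: sumr_ge0. Qed.

Let sum_indep n (F H : R -> R) : measurable_fun setT F -> measurable_fun setT H ->
  (forall x, 0 <= x -> `|F x| <= 1) -> (forall x, 0 <= x -> `|H x| <= 1) ->
  \int[P]_w (F (integer_sum n w) * H (Z n.+1 w)%:R) =
  (\int[P]_w F (integer_sum n w)) * \int[P]_w H (Z 0 w)%:R.
Proof.
move=> mF mH F1 H1.
have mZ0 i : measurable_fun setT (Z i) by exact: measurable_funP.
have mFs : measurable_fun setT (fun w => F (integer_sum n w)).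
  by apply: (measurableT_comp mF); exact: measurable_integer_sum.
have mHZ : measurable_fun setT (fun w => H (Z n.+1 w)%:R).
  by apply: (measurable_nat_comp (fun n => H n%:R)).
rewrite (@integral_independent_mul _ _ _ P _ _ 1 1)//.
- congr (_ * _); have [_ Hid] := Z_iid.
  have mHn : measurable_fun setT (fun n : nat => H n%:R) by move=> _ U _; rewrite setTI.
  have Hn k : `|H k%:R| <= 1 by exact: H1.
  rewrite (law_ext (P := P) (mZ0 n.+1) (Q := distribution P (Z 0)) (h := fun n => H n%:R) (M := 1))//.
    by rewrite -(law_ext (P := P) (mZ0 0) (h := fun n => H n%:R) (M := 1)).
  by move=> A mA; rewrite (Hid n.+1 0 A mA).
- apply: (block_independent_pair (X := fun i => Z i : T -> nat)
    _ Z_iid.1 (A := [set i | i <= n%:Z]) (B := [set i | n%:Z < i])) => //.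
  + by apply/seteqP; split => i //= [h1 h2]; have := lt_le_trans h2 h1; rewrite ltxx.
  + by apply: (measurableT_comp mF); exact: past_sum.
  + apply: (measurableT_comp mH); apply: mZR => /=; by rewrite ltz_nat.
- by move=> w; apply: F1; exact: integer_sum_ge0.
- by move=> w; exact: H1.
Qed.

(** The addition formulas for cos and sin, integrated over the independent last
summand. *)
Lemma twisted_laplace_sum n :
  twisted_laplace t (fun w => r * integer_sum n w) =
  twisted_laplace t (fun w => r * (Z 0 w)%:R) ^+ n.
Proof.
have bC x x0 := (@CS_bound x x0).1; have bS x x0 := (@CS_bound x x0).2.
have iFs k (F : R -> R) (H : R -> R) : measurable_fun setT F -> measurable_fun setT H ->
    (forall x, 0 <= x -> `|F x| <= 1) -> (forall x, 0 <= x -> `|H x| <= 1) ->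
    P.-integrable setT (EFin \o (fun w => F (integer_sum k w) * H (Z k.+1 w)%:R)).
  move=> mF mH F1 H1; apply: (@bounded_integrable _ _ _ _ _ 1).
    apply: measurable_funM.
      by apply: (measurableT_comp mF); exact: measurable_integer_sum.
    by apply: (measurable_nat_comp (fun n => H n%:R)); exact: measurable_funP.
  by move=> w; rewrite normrM mulr_ile1 ?F1 ?H1 ?integer_sum_ge0.
elim: n => [|n IH].
  rewrite expr0 /twisted_laplace.
  have s0 w : integer_sum 0 w = 0 by rewrite /integer_sum big_geq.
  congr (_ +i* _)%C; rewrite -[RHS](Rintegral_prob_cst P).
    by apply: eq_Rintegral => w _; rewrite s0 !mulr0 oppr0 expR0 cos0 mulr1.
  by apply: eq_Rintegral => w _; rewrite s0 !mulr0 sin0 mulr0.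
rewrite exprSr -IH /twisted_laplace -/(C _) -/(S _).
have CE w : C (integer_sum n.+1 w) = C (integer_sum n w) * C (Z n.+1 w)%:R -
    S (integer_sum n w) * S (Z n.+1 w)%:R.
  by rewrite integer_sumS /C /S mulrDr opprD expRD mulrDr cosD; ring.
have SE w : S (integer_sum n.+1 w) = S (integer_sum n w) * C (Z n.+1 w)%:R +
    C (integer_sum n w) * S (Z n.+1 w)%:R.
  by rewrite integer_sumS /C /S mulrDr opprD expRD mulrDr sinD; ring.
have -> : \int[P]_w C (integer_sum n.+1 w) =
    (\int[P]_w C (integer_sum n w)) * (\int[P]_w C (Z 0 w)%:R) -
    (\int[P]_w S (integer_sum n w)) * (\int[P]_w S (Z 0 w)%:R).
  rewrite -!sum_indep// -RintegralB//; [|exact: iFs|exact: iFs].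
  by apply: eq_Rintegral => w _; exact: CE.
have -> : \int[P]_w S (integer_sum n.+1 w) =
    (\int[P]_w S (integer_sum n w)) * (\int[P]_w C (Z 0 w)%:R) +
    (\int[P]_w C (integer_sum n w)) * (\int[P]_w S (Z 0 w)%:R).
  rewrite -!sum_indep// -RintegralD//; [|exact: iFs|exact: iFs].
  by apply: eq_Rintegral => w _; exact: SE.
by apply/eqP; rewrite eq_complex /= [X in _ && (X == _)]addrC !eqxx.
Qed.

End fixed.

Lemma twisted_integrable t (V : T -> R) : measurable_fun setT V ->
  (forall w, 0 <= V w) ->
  P.-integrable setT (EFin \o (fun w => expR (- V w) * cos (t * V w))) /\
  P.-integrable setT (EFin \o (fun w => expR (- V w) * sin (t * V w))).
Proof.
move=> mV V0; split; apply: (@bounded_integrable _ _ _ _ _ 1).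
- apply: measurable_funM; first exact: measurable_expRN.
  apply: measurableT_comp; first exact: (continuous_measurable_fun (@continuous_cos R)).
  exact: measurable_funM.
- move=> w; have /andP[e0 e1] := expRN_01 (V0 w).
  by rewrite normrM (ger0_norm e0) mulr_ile1// norm_cos_le1.
- apply: measurable_funM; first exact: measurable_expRN.
  apply: measurableT_comp; first exact: (continuous_measurable_fun (@continuous_sin R)).
  exact: measurable_funM.
- move=> w; have /andP[e0 e1] := expRN_01 (V0 w).
  by rewrite normrM (ger0_norm e0) mulr_ile1// norm_sin_le1.
Qed.

(** Multiplying the integral by its conjugate bounds its squared modulus by the
modulus itself. *)
Lemma normc_twisted_laplace t (V : T -> R) : measurable_fun setT V ->
  (forall w, 0 <= V w) -> Normc.normc (twisted_laplace t V) <= 1.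
Proof.
move=> mV V0; have [iC iS] := twisted_integrable t mV V0.
set a := \int[P]_w (expR (- V w) * cos (t * V w)).
set b := \int[P]_w (expR (- V w) * sin (t * V w)).
rewrite /twisted_laplace -/a -/b; set N := Normc.normc _.
have N0 : 0 <= N by exact: sqrtr_ge0.
have NE : N ^+ 2 = a * a + b * b.
  by rewrite sqr_sqrtr ?addr_ge0 ?sqr_ge0// -!expr2.
have : a * a + b * b <= N.
  rewrite {2}/a {2}/b -!RintegralZl// -RintegralD//; [|exact: RintegrableZl|exact: RintegrableZl].
  rewrite -(Rintegral_prob_cst P N); apply: le_Rintegral => //.
  - by apply: RintegrableD => //; exact: RintegrableZl.
  - by apply: (@bounded_integrable _ _ _ _ _ N) => // w; rewrite ger0_norm.
  move=> w _; have /andP[e0 e1] := expRN_01 (V0 w).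
  have -> : a * (expR (- V w) * cos (t * V w)) + b * (expR (- V w) * sin (t * V w)) =
      complex.Re ((a +i* b)%C * polar (V w) (- (t * V w))).
    by rewrite /polar cosN sinN /=; ring.
  apply: le_trans (ler_norm _) _; apply: le_trans (le_normc_Re _) _.
  by rewrite Normc.normcM normc_polar ler_piMr.
rewrite -NE expr2 => NN; rewrite leNgt; apply/negP => N1.
by move: NN; rewrite leNgt ltr_pMr ?N1// (lt_trans _ N1).
Qed.

End iid_sums.

Section kernel_integrals.
Context (R : realType) (alpha : R).
Hypothesis alpha01 : 0 < alpha < 1.
Local Notation D := (`]0, +oo[%classic : set R).
Local Notation c := (gamma_const (1 - alpha)).

Let mD : measurable D. Proof. exact: measurable_itv. Qed.

Let kernel_integrable (k : R -> R) : measurable_fun setT k -> (forall y, `|k y| <= 1) ->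
  (expo R).-integrable D (EFin \o (fun y : R => y `^ (- alpha) * k y)).
Proof.
move=> mk k1; have /andP[al0 al1] := alpha01.
have iD : (expo R).-integrable D (EFin \o (fun y : R => y `^ (- alpha))).
  have := @expo_integrable_powR R (1 - alpha).
  by rewrite addrAC subrr add0r; apply; rewrite subr_gt0 al1/= gerBl ltW.
apply: (@le_integrable _ _ _ (expo R) D mD _ _ _ _ iD).
- apply/measurable_EFinP/measurable_funM; last exact: measurable_funTS.
  by apply: measurable_funTS; exact: measurable_powR.
- move=> y _; rewrite lee_fin normrM ler_piMr//.
Qed.

Lemma kernel_kcos t : \int[expo R]_(y in D) (y `^ (- alpha) * kcos t y) =
  c * ((1 + t ^+ 2) `^ (alpha / 2) * cos (alpha * atan t)).
Proof.
have /andP[al0 al1] := alpha01.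
have b0 : 0 < 1 - alpha by rewrite subr_gt0.
have b1 : 1 - alpha < 1 by rewrite gtrBl.
have := (gamma_kernel_cos b0 b1 t).1; rewrite subKr -!mulrA => <-.
rewrite /Kcos /Ksin (_ : 1 - alpha - 1 = - alpha); last by ring.
have iC := kernel_integrable (continuous_measurable_fun (@continuous_cosM R t)) (fun y => norm_cos_le1 (t * y)).
have iS := kernel_integrable (continuous_measurable_fun (@continuous_sinM R t)) (fun y => norm_sin_le1 (t * y)).
rewrite -RintegralZl// -RintegralD//; last exact: RintegrableZl.
by apply: eq_Rintegral => y _; rewrite /kcos; ring.
Qed.

Lemma kernel_ksin t : \int[expo R]_(y in D) (y `^ (- alpha) * ksin t y) =
  c * ((1 + t ^+ 2) `^ (alpha / 2) * sin (alpha * atan t)).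
Proof.
have /andP[al0 al1] := alpha01.
have b0 : 0 < 1 - alpha by rewrite subr_gt0.
have b1 : 1 - alpha < 1 by rewrite gtrBl.
have := (gamma_kernel_cos b0 b1 t).2; rewrite subKr -!mulrA => <-.
rewrite /Kcos /Ksin (_ : 1 - alpha - 1 = - alpha); last by ring.
have iC := kernel_integrable (continuous_measurable_fun (@continuous_cosM R t)) (fun y => norm_cos_le1 (t * y)).
have iS := kernel_integrable (continuous_measurable_fun (@continuous_sinM R t)) (fun y => norm_sin_le1 (t * y)).
rewrite -RintegralZl// -RintegralB//; last exact: RintegrableZl.
by apply: eq_Rintegral => y _; rewrite /ksin; ring.
Qed.

End kernel_integrals.

Section sums_limit.
Context (R : realType) d (T : measurableType d) (P : probability T R).
Variable Z : int -> {RV P >-> nat}.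
Hypothesis Z_iid : iid P Z.
Variables (b : nat -> R) (alpha beta C : R).
Hypothesis alpha01 : 0 < alpha < 1.
Hypothesis beta1 : alpha < beta < 1.
Hypothesis b_ge0 : forall n, 0 <= b n.
Hypothesis b_cvgy : b n @[n --> \oo] --> +oo.
Local Notation U := (fun t : R => fine (P [set w | t < (Z 0 w)%:R])).
Hypothesis tail_cvg : forall x, 0 < x ->
  n%:R * U (x * b n) @[n --> \oo] --> x `^ (- alpha).
Hypothesis tail_bound : \forall n \near \oo, forall x, 0 < x ->
  n%:R * U (x * b n) <= C * (1 + x `^ (- beta)).
Local Notation c := (gamma_const (1 - alpha)).

(** Real and imaginary parts of (1 + i t)^alpha. *)
Definition exponent_re (t : R) : R := (1 + t ^+ 2) `^ (alpha / 2) * cos (alpha * atan t).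
Definition exponent_im (t : R) : R := (1 + t ^+ 2) `^ (alpha / 2) * sin (alpha * atan t).

Lemma exponent_re_gt0 t : 0 < exponent_re t.
Proof.
have /andP[al0 al1] := alpha01.
rewrite mulr_gt0//; first by rewrite powR_gt0// ltr_pwDl// sqr_ge0.
have a1 := atan_gtNpi2 t; have a2 := atan_ltpi2 t.
have p0 := pi_gt0 R.
have aa : `|alpha * atan t| < pi / 2.
  rewrite normrM (gtr0_norm al0).
  have h : `|atan t| < pi / 2 by rewrite ltr_norml a1 a2.
  by apply: le_lt_trans h; rewrite ler_piMl// ltW.
by apply: cos_gt0_pihalf; rewrite -ltr_norml.
Qed.

Section scale.
Variables (r t : R).
Hypothesis r_gt0 : 0 < r.

Let V n w : R := r / b n * (Z 0 w)%:R.

Let b_gt0 : \forall n \near \oo, 0 < b n.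
Proof. by have /cvgryPgt/(_ 0) := b_cvgy. Qed.

Let mZR : measurable_fun setT (fun w => (Z 0 w)%:R : R).
Proof. apply: (measurable_nat_comp (fun n => n%:R : R)); exact: measurable_funP. Qed.

Let mV n : measurable_fun setT (V n).
Proof. exact: measurable_funM. Qed.

Let V0 n w : 0 <= V n w.
Proof. by rewrite mulr_ge0// divr_ge0// ltW. Qed.

Let scaled (k : R -> R) : measurable_fun setT k -> (forall y : R, `|k y| <= 1 + `|t|) ->
  n%:R * \int[expo R]_(y in `]0, +oo[) (k y * fine (P [set w | y < V n w]))
   @[n --> \oo] --> r `^ alpha * \int[expo R]_(y in `]0, +oo[) (y `^ (- alpha) * k y).
Proof.
move=> mk kM; have := abelian mZR alpha01 beta1 b_gt0 tail_cvg tail_bound mk kM r_gt0.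
apply: near_cvg; near=> n; congr (_ * _); apply: eq_Rintegral => y _.
by congr (_ * fine (P _)); apply/seteqP; split => w /=; rewrite /V mulrAC.
Unshelve. all: by end_near. Qed.

Let scaled_re : n%:R * (1 - complex.Re (twisted_laplace P t (V n))) @[n --> \oo] -->
  c * r `^ alpha * exponent_re t.
Proof.
rewrite (_ : c * _ * _ = r `^ alpha * (c * exponent_re t)); last by ring.
rewrite -kernel_kcos//; apply: near_cvg (scaled (@measurable_kcos R t) (@kcos_bound R t)).
near=> n; congr (_ * _); rewrite -cos_transform//.
have [iC _] := twisted_integrable P t (mV n) (V0 n).
rewrite RintegralB ?Rintegral_prob_cst//.
by apply: unit_integrable; apply: unit_cst; rewrite ler01 lexx.
Unshelve. all: by end_near. Qed.

Let scaled_im : n%:R * complex.Im (twisted_laplace P t (V n)) @[n --> \oo] -->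
  c * r `^ alpha * exponent_im t.
Proof.
rewrite (_ : c * _ * _ = r `^ alpha * (c * exponent_im t)); last by ring.
rewrite -kernel_ksin//; apply: near_cvg (scaled (@measurable_ksin R t) (@ksin_bound R t)).
by near=> n; congr (_ * _); rewrite -sin_transform.
Unshelve. all: by end_near. Qed.

(** The Abelian theorem with the kernels [kcos] and [ksin] gives the first-order
expansion of the transform of one summand; the n-th power is then
[complex_power_limit]. *)
Lemma twisted_laplace_limit (u := c * r `^ alpha * exponent_re t)
    (v := c * r `^ alpha * exponent_im t) :
  complex.Re (twisted_laplace P t (fun w => r / b n * integer_sum Z n w))
    @[n --> \oo] --> expR (- u) * cos v /\
  complex.Im (twisted_laplace P t (fun w => r / b n * integer_sum Z n w))
    @[n --> \oo] --> expR (- u) * sin v.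
Proof.
have u0 : 0 < u.
  apply: mulr_gt0; last exact: exponent_re_gt0.
  apply: mulr_gt0; last exact: powR_gt0.
  by apply: gamma_const_gt0; have /andP[h1 h2] := alpha01; rewrite subr_gt0 h2 gtrBl.
have [] := complex_power_limit u0
  (fun n => normc_twisted_laplace P t (mV n) (V0 n)) scaled_re scaled_im.
have E n : twisted_laplace P t (V n) ^+ n =
    twisted_laplace P t (fun w => r / b n * integer_sum Z n w).
  by rewrite twisted_laplace_sum// divr_ge0// ltW.
move=> Hre Him; split; [apply: near_cvg Hre|apply: near_cvg Him].
  by near=> n; rewrite E.
by near=> n; rewrite E.
Unshelve. all: by end_near.
Qed.

End scale.

End sums_limit.

(** * Identification of the limit as a stable law *)

Section identification.
Context (R : realType) d (T : measurableType d) (P : probability T R).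
Variable Z : int -> {RV P >-> nat}.
Hypothesis Z_iid : iid P Z.
Variables (b : nat -> R) (alpha beta C : R).
Hypothesis alpha01 : 0 < alpha < 1.
Hypothesis beta1 : alpha < beta < 1.
Hypothesis b_ge0 : forall n, 0 <= b n.
Hypothesis b_cvgy : b n @[n --> \oo] --> +oo.
Local Notation U := (fun t : R => fine (P [set w | t < (Z 0 w)%:R])).
Hypothesis tail_cvg : forall x, 0 < x ->
  n%:R * U (x * b n) @[n --> \oo] --> x `^ (- alpha).
Hypothesis tail_bound : \forall n \near \oo, forall x, 0 < x ->
  n%:R * U (x * b n) <= C * (1 + x `^ (- beta)).
Local Notation c := (gamma_const (1 - alpha)).
Variables (mu : probability R R) (A : R).
Hypothesis A_gt0 : 0 < A.
Hypothesis mu_neg : mu `]-oo, 0[%classic = 0%E.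
Hypothesis mu_laplace : forall s : R, 0 < s ->
  \int[mu]_x expR (- (s * Num.max 0 x)) = expR (- (A * s `^ alpha)).

Let L (s : R) : R := expR (- (A * s `^ alpha)).
Let pos (x : R) : R := Num.max 0 x.
Let pos_ge0 x : 0 <= pos x. Proof. by rewrite le_max lexx. Qed.
Let mpos : measurable_fun setT pos. Proof. exact: measurable_maxr. Qed.
Let al0 : 0 < alpha. Proof. by case/andP: alpha01. Qed.
Let al1 : alpha < 1. Proof. by case/andP: alpha01. Qed.

Let c_gt0 : 0 < c.
Proof. by apply: gamma_const_gt0; rewrite subr_gt0 al1 gtrBl. Qed.

(** The scale at which the i.i.d. sums have the Laplace transform of [mu]. *)
Let lambda : R := (A / c) `^ (alpha^-1).
Let lambda_gt0 : 0 < lambda. Proof. by rewrite powR_gt0// divr_gt0. Qed.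

Let scaleE (s : R) : 0 < s -> c * (s * lambda) `^ alpha = A * s `^ alpha.
Proof.
move=> s0; rewrite powRM ?ltW// /lambda -powRrM mulVf ?gt_eqF// powRr1; last first.
  by rewrite ltW// divr_gt0.
by field; rewrite gt_eqF.
Qed.

Let V n w : R := lambda / b n * integer_sum Z n w.

Let mV n : measurable_fun setT (V n).
Proof. by apply: measurable_funM => //; exact: measurable_integer_sum. Qed.

Let V0 n w : 0 <= V n w.
Proof. by rewrite mulr_ge0 ?integer_sum_ge0// divr_ge0// ltW. Qed.

Let twisted_V (s t : R) : 0 < s ->
  \int[P]_w (expR (- (s * V n w)) * cos (t * (s * V n w))) @[n --> \oo] -->
    expR (- (A * s `^ alpha * exponent_re alpha t)) *
    cos (A * s `^ alpha * exponent_im alpha t) /\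
  \int[P]_w (expR (- (s * V n w)) * sin (t * (s * V n w))) @[n --> \oo] -->
    expR (- (A * s `^ alpha * exponent_re alpha t)) *
    sin (A * s `^ alpha * exponent_im alpha t).
Proof.
move=> s0; have [] := twisted_laplace_limit Z_iid alpha01 beta1 b_ge0 b_cvgy
  tail_cvg tail_bound t (mulr_gt0 s0 lambda_gt0).
rewrite (scaleE s0) => Hre Him.
have VE n w : s * V n w = s * lambda / b n * integer_sum Z n w by rewrite /V; ring.
split; [apply: near_cvg Hre|apply: near_cvg Him]; near=> n => /=;
  by apply: eq_Rintegral => w _; rewrite VE.
Unshelve. all: by end_near. Qed.

Let laplace_V : laplace_cvg L P V.
Proof.
split=> // s s0; have [H _] := twisted_V 0 s0.
rewrite /exponent_re /exponent_im atan0 mulr0 cos0 sin0 !mulr0 cos0 in H.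
rewrite expr0n/= addr0 powR1 !mulr1 in H.
apply: near_cvg H; near=> n; apply: eq_Rintegral => w _.
by rewrite mul0r cos0 mulr1.
Unshelve. all: by end_near. Qed.

Let L1 : L s @[s --> 0^'+] --> (1 : R).
Proof.
rewrite /L -[X in _ --> X]expR0.
apply: (cvg_comp (fun s : R => - (A * s `^ alpha))); last exact: continuous_expR.
have : A * s `^ alpha @[s --> 0^'+] --> (0 : R).
  by rewrite -[X in _ --> X](mulr0 A); apply: cvgMr; exact: powR_cvg0.
by move=> /cvgN; rewrite oppr0.
Qed.

Let laplace_mu : laplace_cvg L mu (fun=> pos).
Proof. exact: laplace_cvg_cst. Qed.

Let continuous_pos : continuous pos.
Proof.
by move=> x; apply: (@continuous_max R R (fun=> 0) id); [exact: cvg_cst|exact: cvg_id].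
Qed.

(** [mu] and the i.i.d. sums share the limiting Laplace transform [L], so they give
the same value to every bounded continuous function. *)
Let mu_limit (f : R -> R) (l : R) : continuous f -> (forall y, `|f y| <= 1) ->
  \int[P]_w f (V n w) @[n --> \oo] --> l -> \int[mu]_x f (pos x) = l.
Proof.
move=> cf f1 fl; have [l' hl] := laplace_method cf f1 L1.
have h1 := hl _ _ _ _ laplace_V; have h2 := hl _ _ _ _ laplace_mu.
rewrite (cvg_unique _ fl h1)//; apply: (cvg_unique _ _ h2) => //; exact: cvg_cst.
Qed.

Let twisted_mu (s t : R) : 0 < s ->
  \int[mu]_x (expR (- (s * pos x)) * cos (t * (s * pos x))) =
    expR (- (A * s `^ alpha * exponent_re alpha t)) *
    cos (A * s `^ alpha * exponent_im alpha t) /\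
  \int[mu]_x (expR (- (s * pos x)) * sin (t * (s * pos x))) =
    expR (- (A * s `^ alpha * exponent_re alpha t)) *
    sin (A * s `^ alpha * exponent_im alpha t).
Proof.
move=> s0; have [Hc Hs] := twisted_V t s0.
have posV n w : pos (V n w) = V n w by rewrite /pos max_r.
have posK x : pos (pos x) = pos x by rewrite {1}/pos max_r.
have c1 : continuous (fun x => expR (- (s * pos x))).
  move=> x; apply: (cvg_comp (fun x => - (s * pos x))); last exact: continuous_expR.
  by apply: cvgN; apply: cvgMr; exact: continuous_pos.
have c2 : continuous (fun x => t * (s * pos x)).
  by move=> x; apply: cvgMr; apply: cvgMr; exact: continuous_pos.
have e1 x : `|expR (- (s * pos x))| <= 1.
  by have /andP[h0 h1] := expRN_01 (mulr_ge0 (ltW s0) (pos_ge0 x)); rewrite ger0_norm.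
split.
- pose f x := expR (- (s * pos x)) * cos (t * (s * pos x)).
  transitivity (\int[mu]_x f (pos x)).
    by apply: eq_Rintegral => x _; rewrite /f posK.
  apply: mu_limit.
  + move=> x; apply: cvgM; first exact: c1.
    by apply: (cvg_comp (fun x => t * (s * pos x))); [exact: c2|exact: continuous_cos].
  + by move=> x; rewrite normrM mulr_ile1// norm_cos_le1.
  + apply: near_cvg Hc; near=> n; apply: eq_Rintegral => w _.
    by rewrite /f posV.
- pose f x := expR (- (s * pos x)) * sin (t * (s * pos x)).
  transitivity (\int[mu]_x f (pos x)).
    by apply: eq_Rintegral => x _; rewrite /f posK.
  apply: mu_limit.
  + move=> x; apply: cvgM; first exact: c1.
    by apply: (cvg_comp (fun x => t * (s * pos x))); [exact: c2|exact: continuous_sin].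
  + by move=> x; rewrite normrM mulr_ile1// norm_sin_le1.
  + apply: near_cvg Hs; near=> n; apply: eq_Rintegral => w _.
    by rewrite /f posV.
Unshelve. all: by end_near. Qed.

Let mu_pos (f : R -> R) : measurable_fun setT f -> (forall y, `|f y| <= 1) ->
  \int[mu]_x f (pos x) = \int[mu]_x f x.
Proof.
move=> mf f1; rewrite /Rintegral; congr fine.
have mneg : measurable (`]-oo, 0[%classic : set R) by exact: measurable_itv.
rewrite (@negligible_integral _ _ _ mu setT `]-oo, 0[%classic)//; last first.
  apply: (@bounded_integrable _ _ _ _ _ 1) => //.
  by apply: (measurableT_comp mf).
rewrite [RHS](@negligible_integral _ _ _ mu setT `]-oo, 0[%classic)//; last first.
  exact: (@bounded_integrable _ _ _ _ _ 1).
apply: eq_integral => x; rewrite inE/= in_itv/= => -[_ /negP].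
by rewrite -leNgt => x0; rewrite /pos max_r.
Qed.

(** The mass of the nonpositive half-line is at most the Laplace transform at every
s > 0, and this tends to 0 at infinity. *)
Lemma stable_positive : mu `]0, +oo[%classic = 1%E.
Proof.
have mN : measurable (`]-oo, 0]%classic : set R) by exact: measurable_itv.
suff N0 : mu `]-oo, 0]%classic = 0%E.
  rewrite (_ : `]0, +oo[%classic = ~` `]-oo, 0]%classic); last by rewrite setCitvl.
  by rewrite probability_setC// N0 sube0.
rewrite -[LHS]fineK ?fin_num_measure//; congr EFin.
set p := fine _; have p0 : 0 <= p by exact: fine_ge0.
have bound s : 0 < s -> p <= expR (- (A * s `^ alpha)).
  move=> s0; rewrite -mu_laplace// /p -Rintegral_indic//; apply: le_Rintegral => //.
  - apply: (@bounded_integrable _ _ _ _ _ 1); first exact: measurable_indic.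
    by move=> x; rewrite indicE; case: (_ \in _); rewrite ?normr1 ?normr0.
  - exact: (laplace_integrable mu mpos pos_ge0 (ltW s0)).
  move=> x _; rewrite indicE; have [|_] := boolP (x \in _); last exact: expR_ge0.
  by rewrite inE/= in_itv/= => x0; rewrite max_l// mulr0 oppr0 expR0.
apply/eqP; rewrite eq_le p0 andbT leNgt; apply/negP => p_gt0.
(* At this s the exponent A s^alpha equals M. *)
pose M := `|ln p| + 1; have M0 : 0 < M by rewrite ltr_wpDl.
have s0 : 0 < (M / A) `^ (alpha^-1) by rewrite powR_gt0// divr_gt0.
have := bound _ s0; rewrite -powRrM mulVf ?gt_eqF// powRr1 ?divr_ge0 ?(ltW M0) ?(ltW A_gt0)//.
rewrite mulrC divfK ?gt_eqF// leNgt => /negP; apply.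
rewrite -[ltRHS](lnK p_gt0)// ltr_expR.
have := ler_norm (- ln p); rewrite normrN /M.
by move: (ln p) => x; lra.
Qed.

(** The real part of A (- i)^alpha, the exponent of the Laplace transform
continued to the imaginary axis. *)
Definition stable_scale : R := A * cos (pi * alpha / 2).

Let angle : - (pi / 2) < pi * alpha / 2 < pi / 2.
Proof.
have p0 := pi_gt0 R; have h0 := al0; have h1 := al1.
have hp : 0 < pi * alpha by rewrite mulr_gt0.
have hq : pi * alpha < pi by rewrite gtr_pMr.
by apply/andP; split; lra.
Qed.

Let cos_angle : 0 < cos (pi * alpha / 2).
Proof. exact: cos_gt0_pihalf. Qed.

Lemma stable_scale_gt0 : 0 < stable_scale.
Proof. by rewrite mulr_gt0. Qed.

Let powR_half (x : R) : 0 < x -> x `^ alpha = (x ^+ 2) `^ (alpha / 2).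
Proof.
move=> x0; rewrite -powR_mulrn ?ltW// -powRrM; congr (_ `^ _).
by field.
Qed.

(** The damping tends to 0 along this sequence, with t / s_k in place of t, so that
the frequency stays equal to t. *)
Let s_ (k : nat) : R := k.+1%:R^-1.
Let s_gt0 k : 0 < s_ k. Proof. by rewrite invr_gt0. Qed.
Let s_cvg0 : s_ k @[k --> \oo] --> (0 : R). Proof. exact: cvg_harmonic. Qed.

Section positive_time.
Variable t : R.
Hypothesis t_gt0 : 0 < t.

Let radius_cvg : s_ k `^ alpha * (1 + (t / s_ k) ^+ 2) `^ (alpha / 2) @[k --> \oo] --> t `^ alpha.
Proof.
rewrite (powR_half t_gt0).
apply: (@near_cvg _ _ \oo _ (fun k => (s_ k ^+ 2 + t ^+ 2) `^ (alpha / 2))).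
  near=> k; have sk := s_gt0 k.
  rewrite (powR_half sk) -powRM ?sqr_ge0 ?addr_ge0 ?sqr_ge0//.
  by congr (_ `^ _); field; rewrite gt_eqF.
have H : s_ k ^+ 2 + t ^+ 2 @[k --> \oo] --> t ^+ 2.
  rewrite -[X in _ --> X]add0r; apply: cvgD; last exact: cvg_cst.
  by rewrite -[X in _ --> X](mulr0 0); apply: cvgM.
have t2 : 0 < t ^+ 2 by rewrite exprn_gt0.
exact: (cvg_comp (fun k => s_ k ^+ 2 + t ^+ 2) (fun x => x `^ (alpha / 2)) H (powR_cvg t2)).
Unshelve. all: by end_near. Qed.

Let angle_cvg : alpha * atan (t / s_ k) @[k --> \oo] --> pi * alpha / 2.
Proof.
rewrite (_ : pi * alpha / 2 = alpha * (pi / 2)); last by ring.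
have H : k.+1%:R @[k --> \oo] --> (+oo : set_system R).
  by have := @cvgr_idn R; rewrite -(cvg_shiftS (fun n => n%:R : R)).
have H' : t / s_ k @[k --> \oo] --> +oo.
  have -> : (fun k => t / s_ k) = (fun k => t * k.+1%:R).
    by apply/funext => k; rewrite /s_ invrK.
  by apply/cvgryPgt => M; near=> k; rewrite -ltr_pdivrMl//; near: k; exact: (cvgryPgt _).1.
by apply: cvgMr; apply: (cvg_comp _ _ H'); exact: cvgy_atan.
Unshelve. all: by end_near. Qed.

Let re_cvg : A * s_ k `^ alpha * exponent_re alpha (t / s_ k) @[k --> \oo] -->
  stable_scale * t `^ alpha.
Proof.
rewrite /stable_scale mulrAC -mulrA.
apply: (@near_cvg _ _ \oo _ (fun k => A * (s_ k `^ alpha * (1 + (t / s_ k) ^+ 2) `^ (alpha / 2)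
    * cos (alpha * atan (t / s_ k))))).
  by near=> k; rewrite /exponent_re; ring.
apply: cvgMr; apply: cvgM; first exact: radius_cvg.
by apply: (cvg_comp (fun k => alpha * atan (t / s_ k))); [exact: angle_cvg|exact: continuous_cos].
Unshelve. all: by end_near. Qed.

Let im_cvg : A * s_ k `^ alpha * exponent_im alpha (t / s_ k) @[k --> \oo] -->
  stable_scale * t `^ alpha * tan (pi * alpha / 2).
Proof.
have -> : stable_scale * t `^ alpha * tan (pi * alpha / 2) =
    A * (t `^ alpha * sin (pi * alpha / 2)).
  by rewrite /stable_scale /tan; field; rewrite gt_eqF.
apply: (@near_cvg _ _ \oo _ (fun k => A * (s_ k `^ alpha * (1 + (t / s_ k) ^+ 2) `^ (alpha / 2)
    * sin (alpha * atan (t / s_ k))))).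
  by near=> k; rewrite /exponent_im; ring.
apply: cvgMr; apply: cvgM; first exact: radius_cvg.
by apply: (cvg_comp (fun k => alpha * atan (t / s_ k))); [exact: angle_cvg|exact: continuous_sin].
Unshelve. all: by end_near. Qed.

Let damped_limit (g : R -> R) : continuous g -> (forall x, `|g x| <= 1) ->
  \int[mu]_x (expR (- (s_ k * pos x)) * g (pos x)) @[k --> \oo] --> \int[mu]_x g x.
Proof.
move=> cg g1; rewrite -mu_pos//; last exact: continuous_measurable_fun.
have mg : measurable_fun setT (fun x => g (pos x)).
  by apply: (measurableT_comp (continuous_measurable_fun cg)).
have [||||||_ //] := @Rdominated_cvg _ _ _ mu setT
  (fun k x => expR (- (s_ k * pos x)) * g (pos x)) (fun x => g (pos x)) (fun=> 1) => //.
- move=> k; apply: measurable_funM => //; apply: measurable_expRN.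
  exact: measurable_funM.
- move=> x _; rewrite -[X in _ --> X]mul1r; apply: cvgMl; rewrite -[X in _ --> X]expR0.
  apply: (cvg_comp (fun k => - (s_ k * pos x))); last exact: continuous_expR.
  by rewrite -oppr0 -(mul0r (pos x)); apply: cvgN; apply: cvgMl; exact: s_cvg0.
- by apply: unit_integrable; apply: unit_cst; rewrite ler01 lexx.
- move=> k x _; have /andP[e0 e1] := expRN_01 (mulr_ge0 (ltW (s_gt0 k)) (pos_ge0 x)).
  by rewrite normrM (ger0_norm e0) mulr_ile1.
Qed.

Let exp_cvg : expR (- (A * s_ k `^ alpha * exponent_re alpha (t / s_ k))) @[k --> \oo] -->
  expR (- (stable_scale * t `^ alpha)).
Proof.
apply: (cvg_comp (fun k => - (A * s_ k `^ alpha * exponent_re alpha (t / s_ k)))); last exact: continuous_expR.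
by apply: cvgN; exact: re_cvg.
Qed.

(** Since (1 + i t / s)^alpha s^alpha = (s + i t)^alpha, the limit of the exponent is
(i t)^alpha, of argument pi alpha / 2. *)
Lemma cf_positive :
  \int[mu]_x cos (t * x) = expR (- (stable_scale * t `^ alpha)) *
    cos (stable_scale * t `^ alpha * tan (pi * alpha / 2)) /\
  \int[mu]_x sin (t * x) = expR (- (stable_scale * t `^ alpha)) *
    sin (stable_scale * t `^ alpha * tan (pi * alpha / 2)).
Proof.
have tE k x : t / s_ k * (s_ k * pos x) = t * pos x.
  by field; rewrite gt_eqF.
split.
- have H := damped_limit (@continuous_cosM R t) (fun x => norm_cos_le1 (t * x)).
  apply: (cvg_unique _ H) => //.
  apply: (@near_cvg _ _ \oo _ (fun k =>
    expR (- (A * s_ k `^ alpha * exponent_re alpha (t / s_ k))) *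
    cos (A * s_ k `^ alpha * exponent_im alpha (t / s_ k)))).
    near=> k; have [<- _] := twisted_mu (t / s_ k) (s_gt0 k).
    by apply: eq_Rintegral => x _; rewrite tE.
  apply: cvgM; first exact: exp_cvg.
  by apply: (cvg_comp _ _ im_cvg); exact: continuous_cos.
- have H := damped_limit (@continuous_sinM R t) (fun x => norm_sin_le1 (t * x)).
  apply: (cvg_unique _ H) => //.
  apply: (@near_cvg _ _ \oo _ (fun k =>
    expR (- (A * s_ k `^ alpha * exponent_re alpha (t / s_ k))) *
    sin (A * s_ k `^ alpha * exponent_im alpha (t / s_ k)))).
    near=> k; have [_ <-] := twisted_mu (t / s_ k) (s_gt0 k).
    by apply: eq_Rintegral => x _; rewrite tE.
  apply: cvgM; first exact: exp_cvg.
  by apply: (cvg_comp _ _ im_cvg); exact: continuous_sin.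
Unshelve. all: by end_near. Qed.

End positive_time.

(** Negative frequencies follow by parity. *)
Theorem stable_identification : is_stable_law alpha stable_scale mu.
Proof.
split; first exact: stable_positive.
move=> t; rewrite /characteristic_function /cexp /=.
rewrite !(mul0r, mulr0, mulr1, subr0, addr0, oppr0, mulrN, mulNr, opprK).
have [t0|t0|->] := ltgtP t 0.
- have nt : 0 < - t by rewrite oppr_gt0.
  have [Hc Hs] := cf_positive nt.
  rewrite (ltr0_norm t0) invrN mulrN divff ?lt_eqF// !(mulN1r, mulrN).
  congr (_ +i* _)%C.
    rewrite cosN -Hc; apply: eq_Rintegral => x _.
    by rewrite mulNr cosN.
  rewrite sinN mulrN -Hs -mulN1r -RintegralZl//.
    by apply: eq_Rintegral => x _; rewrite mulN1r mulNr sinN opprK.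
  apply: (@bounded_integrable _ _ _ _ _ 1) => [|x]; last exact: norm_sin_le1.
  by apply: continuous_measurable_fun; exact: continuous_sinM.
- have [Hc Hs] := cf_positive t0.
  by rewrite (gtr0_norm t0) divff ?gt_eqF// mul1r Hc Hs.
- rewrite normr0 powR0 ?gt_eqF// !(mulr0, mul0r, oppr0) expR0 cos0 sin0 mulr0 mulr1.
  congr (_ +i* _)%C; rewrite -[RHS](Rintegral_prob_cst mu).
    by apply: eq_Rintegral => x _; rewrite mul0r cos0.
  by apply: eq_Rintegral => x _; rewrite mul0r sin0.
Qed.

End identification.

Theorem theorem2p11 (R : realType) (d : measure_display)
    (T : measurableType d) (P : probability T R)
    (phi : int -> {RV P >-> R}) (Z : int -> {RV P >-> nat})
    (B : int -> int -> {RV P >-> bool}) (alpha : R) (h : R -> R)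
    (model : rcinar_model phi Z B)
    (phi_lt1 : (P [set w | phi 0%R w = 1%R] < 1)%E)
    (alpha_gt0 : 0 < alpha) (alpha_lt1 : alpha < 1)
    (h_rv : regularly_varying h alpha)
    (h_tail : h t * fine (P [set w | t < (Z 0 w)%:R]) @[t --> +oo] --> (1 : R))
    (h_bound : has_ubound
      [set h t * fine (P [set w | t < (Z 0 w)%:R]) | t in [set t | 0 < t]]) :
  exists (b : R) (mu : probability R R),
    [/\ 0 < b, is_stable_law alpha b mu &
        converges_in_distribution P
          (fun n w => (scaling h n)^-1 *
             (partial_sum (rcinar Z B) n w)%:R) mu].
Proof.
have mZ : measurable_fun setT (Z 0) by exact: measurable_funPT.
have mZR : measurable_fun setT (fun w => (Z 0 w)%:R : R).
  exact: (measurable_nat_comp (fun n => n%:R : R)).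
pose U (t : R) : R := fine (P [set w | t < (Z 0 w)%:R]).
have U_ge0 t : 0 <= U t by exact: fine_ge0.
have U_le1 t : U t <= 1 by exact: (tail_le1 P mZR).
have U_noninc s t : s <= t -> U t <= U s by exact: (tail_nonincreasing P mZR).
have U_cvg0 : U t @[t --> +oo] --> (0 : R) by exact: (tail_cvg0 P mZR).
have alpha01 : 0 < alpha < 1 by rewrite alpha_gt0.
have b_ge0 := scaling_ge0 U_ge0 U_noninc U_cvg0 h_tail.
have b_cvgy := scaling_cvgy U_ge0 U_noninc U_cvg0 h_tail h_bound.
have tail_cvg := tail_scaled_cvg alpha_gt0 U_ge0 U_noninc U_cvg0 h_rv h_tail h_bound.
have [C [beta beta1 [_ tail_bound]]] :=
  potter_bound alpha_gt0 U_ge0 U_le1 U_noninc U_cvg0 h_rv h_tail h_bound alpha_lt1.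
pose c := gamma_const (1 - alpha).
have c_gt0 : 0 < c by apply: gamma_const_gt0; lra.
pose A := c * limit_moment phi alpha.
have A_gt0 : 0 < A.
  rewrite mulr_gt0// limit_moment_gt0//; first exact: phi_iid model.
  exact: phi_01 model.
pose Y n w := (scaling h n)^-1 * (partial_sum (rcinar Z B) n w)%:R.
have mY n : measurable_fun setT (Y n).
  apply: measurable_funM => //.
  exact: (measurableT_comp (f := fun k => k%:R : R) _ (measurable_partial_sum Z B n)).
have LY : laplace_cvg (fun s => expR (- (A * s `^ alpha))) P Y.
  split => //; first by move=> n w; rewrite mulr_ge0 ?invr_ge0.
  move=> s s_gt0.
  apply: (laplace_partial_sum model phi_lt1 alpha01 c_gt0 b_ge0 b_cvgy _ s_gt0).
  exact: (defect_scaled mZ alpha01 beta1 b_cvgy tail_cvg tail_bound).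
have L1 : expR (- (A * s `^ alpha)) @[s --> 0^'+] --> (1 : R).
  rewrite -[X in _ --> X]expR0; apply: continuous_cvg; first exact: continuous_expR.
  rewrite -[X in _ --> X]oppr0; apply: cvgN; rewrite -[X in _ --> X](mulr0 A); apply: cvgMr.
  exact: powR_cvg0.
have [mu [mu_neg mu_laplace mu_cvg]] := laplace_continuity LY L1.
exists (stable_scale alpha A), mu; split.
- exact: stable_scale_gt0.
- exact: (stable_identification (Z_iid model) alpha01 beta1 b_ge0 b_cvgy
    tail_cvg tail_bound A_gt0 mu_neg mu_laplace).
split=> // f f_cont f_bnd.
have [M fM] : exists M : R, forall y, `|f y| <= M.
  have [M [_ /(_ (M + 1))]] := f_bnd.
  by rewrite ltrDl ltr01 => /(_ isT) fM; exists (M + 1) => y; exact: fM.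
have mf : measurable_fun setT f by exact: continuous_measurable_fun.
rewrite (expectation_Rintegral (bounded_integrable mu mf fM)).
under eq_fun.
  move=> n; rewrite (@expectation_Rintegral _ _ _ _ (f \o Y n)); last first.
    apply: (@bounded_integrable _ _ _ P _ M); last by move=> w; exact: fM.
    exact: (measurableT_comp mf (mY n)).
  over.
apply: cvg_EFin; first by near=> n.
by apply: mu_cvg => //; exists M.
Unshelve. all: by end_near. Qed.
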